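(* Let $G=SL(3,\mathbf R)$ and $K=SO(3)$; all notation is as in the context. (i) Let $\nu_0=(\nu_{0,1},\nu_{0,2})\in\mathbf C^2$ and $\sigma_0=(\sigma_{0,1},\sigma_{0,2})\in\{0,1\}^2$. The action of $\mathfrak p_{\mathbf C}$ on the basis $\{s(l;p,q)\mid l\ge0,\ p\in Z(\sigma_0;l),\ 0\le q\le2l\}$ of $H_{(\nu_0,\sigma_0),K}$ is given, for $0\le r\le4$, by $$\pi_{(\nu_0,\sigma_0)}(X_r)s(l;p,q)=\sum_{-1\le j\le1}\ \sum_{-2\le m\le2}\gamma^{(0)}_{[l,m;p,j]}B_{[2l,2m;q,r]}\,s(l+m;p+m+2j,q+m+r-2).$$ Here we put $\gamma^{(0)}_{[0,m;0,j]}=B_{[0,2m;0,r]}=0$ for $m<2$; $\gamma^{(0)}_{[1,m;p,j]}=B_{[2,2m;q,r]}=0$ for $m<0$; $s(l;p,q)=0$ whenever $p\le l$ with $p\notin Z(\sigma_0;l)$, or $q<0$, or $q>2l$; and $s(l;p,q)=(-1)^{\varepsilon(\sigma_0;l)}s(l;2l-p,q)$ for $p>l$. (ii) Let $i\in\{1,2\}$, $\nu_i\in\mathbf C$, $k\ge2$ an integer and $\sigma_i=D_k$. The action of $\mathfrak p_{\mathbf C}$ on the basis $\{t_i(l;p,q)\mid l\ge k,\ 0\le p\le l-k,\ p\equiv l-k\bmod2,\ 0\le q\le2l\}$ of $H_{(\nu_i,\sigma_i),K}$ is given, for $0\le r\le4$, by $$\pi_{(\nu_i,\sigma_i)}(X_r)t_i(l;p,q)=\sum_{-1\le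 j\le1}\ \sum_{-2\le m\le2}\gamma^{(i)}_{[l,m;p,j]}B_{[2l,2m;q,r]}\,t_i(l+m;p+m+2j,q+m+r-2).$$ Here we put $t_i(l;p,q)=0$ unless $0\le p\le l-k$, $p\equiv l-k\bmod2$ and $0\le q\le2l$.
   Context: **Representations of $K$.** $V_l$ ($l\in\mathbf{Z}_{\ge0}$) is the space of homogeneous polynomials of degree $l$ in $\mathbf{C}[x,y]$; $g\in SU(2)$ with $g^{-1}=\begin{pmatrix}a&b\\-\bar b&\bar a\end{pmatrix}$ acts by $\tau_l(g)f(x,y)=f(ax+by,-\bar bx+\bar ay)$. Standard basis: $v^{(l)}_q=x^qy^{l-q}$ ($0\le q\le l$). The double covering $\varphi:SU(2)\to SO(3)=K$ is $$\varphi\begin{pmatrix}p+\sqrt{-1}q&r+\sqrt{-1}s\\-r+\sqrt{-1}s&p-\sqrt{-1}q\end{pmatrix}=\begin{pmatrix}p^2+q^2-r^2-s^2&-2(ps-qr)&2(pr+qs)\\2(ps+qr)&p^2-q^2+r^2-s^2&-2(pq-rs)\\-2(pr-qs)&2(pq+rs)&p^2-q^2-r^2+s^2\end{pmatrix},$$ and $\tau_{2l}$ descends via $\varphi$ to an irreducible representation $(\tau_{2l},V_{2l})$ of $K$. Put $v^{(2l)}_{1,q}=v^{(2l)}_q$ and $v^{(2l)}_{2,q}=\tau_{2l}(u_c)v^{(2l)}_{1,q}=2^{-l}(x+y)^q(-x+y)^{2l-q}$, where $u_c=\begin{pmatrix}0&0&-1\\0&1&0\\1&0&0\end{pmatrix}$;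 $v^{(2l)*}_q=v^{(2l)*}_{1,q}$ and $v^{(2l)*}_{2,q}$ are the respective dual bases of $V_{2l}^*$, and $\langle\,,\rangle$ is the canonical pairing. **Basis of $\mathfrak p_{\mathbf C}$** ($\mathfrak p$ = symmetric matrices in $\mathfrak{sl}(3,\mathbf R)$): $X_0=\begin{pmatrix}0&0&0\\0&1&-\sqrt{-1}\\0&-\sqrt{-1}&-1\end{pmatrix}$, $X_1=-\frac12\begin{pmatrix}0&\sqrt{-1}&1\\\sqrt{-1}&0&0\\1&0&0\end{pmatrix}$, $X_2=-\frac13\mathrm{diag}(2,-1,-1)$, $X_3=-\frac12\begin{pmatrix}0&\sqrt{-1}&-1\\\sqrt{-1}&0&0\\-1&0&0\end{pmatrix}$, $X_4=\begin{pmatrix}0&0&0\\0&1&\sqrt{-1}\\0&\sqrt{-1}&-1\end{pmatrix}$. **Coefficients $A$.** $A_{[l,2m;k,i]}=a(l,2m;k,i)/d(l,2m)$ for $0\le k\le l+2m$, and $A_{[l,2m;k,i]}=0$ for $k<0$ or $k>l+2m$ (here $k,i$ are just indices); the lists $a(\cdot;k,0),\dots,a(\cdot;k,4)$ are: - $m=2$: $(l+4-k)(l+3-k)(l+2-k)(l+1-k)$; $4(l+4-k)(l+3-k)(l+2-k)k$; $6(l+4-k)(l+3-k)k(k-1)$; $4(l+4-k)k(k-1)(k-2)$; $k(k-1)(k-2)(k-3)$; $d(l,4)=(l+4)(l+3)(l+2)(l+1)$. - $m=1$: $(l+2-k)(l+1-k)(l-k)$; $-(l+2-k)(l+1-k)(l-4k)$;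 $-3(l+2-k)(l-2k+2)k$; $-(3l-4k+8)k(k-1)$; $-k(k-1)(k-2)$; $d(l,2)=(l+2)(l+1)l$. - $m=0$: $(l-k)(l-1-k)$; $-2(l-k)(l-2k-1)$; $l^2-6kl+6k^2-l$; $2(l-2k+1)k$; $k(k-1)$; $d(l,0)=l(l-1)$. - $m=-1$: $l-k-2$; $-(3l-4k-6)$; $3(l-2k-2)$; $-(l-4k-2)$; $-k$; $d(l,-2)=l-2$. - $m=-2$: $1;-4;6;-4;1$; $d(l,-4)=1$. **Coefficients $B$.** $B_{[l,2m;q,r]}=b(l,2m;q,r)/d'(l,2m)$; the lists $b(\cdot;q,0),\dots,b(\cdot;q,4)$ are: - $m=2$: $1;1;1;1;1$; $d'(l,4)=1$. - $m=1$: $4q$; $-(l-4q)$; $-2(l-2q)$; $-(3l-4q)$; $-4(l-q)$; $d'(l,2)=l+4$. - $m=0$: $6q(q-1)$; $-3q(l-2q+1)$; $l^2-6lq+6q^2-l$; $3(l-2q-1)(l-q)$; $6(l-q)(l-q-1)$; $d'(l,0)=(l+3)(l+2)$. - $m=-1$: $4q(q-1)(q-2)$; $-q(q-1)(3l-4q+2)$; $2q(l-2q)(l-q)$; $-(l-4q-2)(l-q)(l-q-1)$; $-4(l-q)(l-q-1)(l-q-2)$; $d'(l,-2)=(l+2)(l+1)l$. - $m=-2$: $q(q-1)(q-2)(q-3)$; $-q(q-1)(q-2)(l-q)$; $q(q-1)(l-q)(l-q-1)$; $-q(l-q)(l-q-1)(l-q-2)$; $(l-q)(l-q-1)(l-q-2)(l-q-3)$;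 $d'(l,-4)=(l+1)l(l-1)(l-2)$. **Coefficients $\gamma$.** With $(\rho_{0,1},\rho_{0,2})=(2,1)$ and $\rho_1=\rho_2=3$: $\gamma^{(0)}_{[l,m;p,1]}=(\nu_{0,2}+\rho_{0,2}-l+p)A_{[2l,2m;2l-p+m-2,0]}$, $\gamma^{(0)}_{[l,m;p,0]}=-\frac13\big(2\nu_{0,1}-\nu_{0,2}+2\rho_{0,1}-\rho_{0,2}+lm-3+\frac{m(m+1)}2\big)A_{[2l,2m;2l-p+m,2]}$, $\gamma^{(0)}_{[l,m;p,-1]}=(\nu_{0,2}+\rho_{0,2}+l-p)A_{[2l,2m;2l-p+m+2,4]}$; for $i=1,2$: $\gamma^{(i)}_{[l,m;p,1]}=(-1)^{i+1}(k-l+p)A_{[2l,2m;2l-p+m-2,0]}$, $\gamma^{(i)}_{[l,m;p,0]}=\frac{(-1)^i}3\big(\nu_i+\rho_i+lm-3+\frac{m(m+1)}2\big)A_{[2l,2m;2l-p+m,2]}$, $\gamma^{(i)}_{[l,m;p,-1]}=(-1)^{i+1}(k+l-p)A_{[2l,2m;2l-p+m+2,4]}$. **Principal series ($i=0$).** $A_0$ = diagonal matrices in $G$ with positive entries, $N_0$ = upper triangular unipotent matrices, $M_0=\{\mathrm{diag}(\varepsilon_1,\varepsilon_2,\varepsilon_1\varepsilon_2)\mid\varepsilon_j=\pm1\}$. For $(\mu_1,\mu_2)\in\mathbf C^2$, $e^{\mu}(\mathrm{diag}(a_1,a_2,a_3))=a_1^{\mu_1}a_2^{\mu_2}$; $\sigma_0(\mathrm{diag}(\varepsilon_1,\varepsilon_2,\varepsilon_1\varepsilon_2))=\varepsilon_1^{\sigma_{0,1}}\varepsilon_2^{\sigma_{0,2}}$.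 $\pi_{(\nu_0,\sigma_0)}$ is the right regular representation of $G$ on $H_{(\nu_0,\sigma_0)}$, the completion, for $\|f\|^2=\int_K|f(x)|^2dx$, of the space of smooth $f:G\to\mathbf C$ with $f(namx)=e^{\nu_0+\rho_0}(a)\sigma_0(m)f(x)$ ($n\in N_0,a\in A_0,m\in M_0$). $\varepsilon(\sigma_0;l)\in\{0,1\}$, $\varepsilon(\sigma_0;l)\equiv l-\sigma_{0,1}-\sigma_{0,2}\bmod2$. $Z(\sigma_0;l)$ is the set of integers $p\equiv l-\sigma_{0,2}\bmod2$ with $0\le p\le l$ if $\varepsilon(\sigma_0;l)=0$, and $0\le p\le l-1$ if $\varepsilon(\sigma_0;l)=1$. For $p\in Z(\sigma_0;l)$, $0\le q\le2l$, $s(l;p,q)\in H_{(\nu_0,\sigma_0)}$ is the element whose restriction to $K$ is $x\mapsto\langle v^{(2l)*}_{2l-p}+(-1)^{\varepsilon(\sigma_0;l)}v^{(2l)*}_p,\tau_{2l}(x)v^{(2l)}_q\rangle$. **Discrete series $D_k$ of $SL^\pm(2,\mathbf R)=\{g\in GL(2,\mathbf R)\mid\det g=\pm1\}$.** $D_k=\mathrm{Ind}_{SL(2,\mathbf R)}^{SL^\pm(2,\mathbf R)}(D_k^+)$, with $D_k^+$ the discrete series of $SL(2,\mathbf R)$ of Blattner parameter $k\ge2$. It is realized on a Hilbert space $V_{D_k}$ whose $O(2)$-finite vectors have basis $\chi_p$, $p\in\{\pm(k+2\alpha)\mid\alpha\in\mathbf Z_{\ge0}\}$ (mutually orthogonal),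 with $D_k(\kappa_t)\chi_p=e^{\sqrt{-1}pt}\chi_p$ for $\kappa_t=\begin{pmatrix}\cos t&\sin t\\-\sin t&\cos t\end{pmatrix}$, $D_k(\mathrm{diag}(1,-1))\chi_p=\chi_{-p}$, and, for the differential, $D_k(x_\pm)\chi_p=(k\pm p)\chi_{p\pm2}$, where $x_\pm=\begin{pmatrix}1&\pm\sqrt{-1}\\\pm\sqrt{-1}&-1\end{pmatrix}$. **$P_i$-principal series ($i=1,2$).** $P_1$ (resp. $P_2$) is the standard block upper triangular parabolic subgroup of $G$ with blocks of sizes $(1,2)$ (resp. $(2,1)$), $N_i$ its unipotent radical, $A_i=\exp(\mathbf RH^{(i)})$ with $H^{(1)}=\mathrm{diag}(2,-1,-1)$, $H^{(2)}=\mathrm{diag}(1,1,-2)$, $M_i=m_i(SL^\pm(2,\mathbf R))$ with $m_1(h)=\mathrm{diag}(\det(h)^{-1},h)$, $m_2(h)=\mathrm{diag}(h,\det(h)^{-1})$ (block diagonal); $D_k$ is regarded as a representation of $M_i$ via $m_i$. $e^{\nu_i+\rho_i}(\exp(sH^{(i)}))=e^{s(\nu_i+\rho_i)}$. $\pi_{(\nu_i,\sigma_i)}$ is the right regular representation of $G$ on $H_{(\nu_i,\sigma_i)}$, the completion, for $\|f\|^2=\int_K\|f(x)\|^2dx$, of the space of smooth $f:G\to V_{D_k}$ with $f(namx)=e^{\nu_i+\rho_i}(a)\sigma_i(m)f(x)$ ($n\in N_i,a\in A_i,m\in M_i$). For $0\le p\le l-k$, $p\equiv l-k\bmod2$, $0\le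 q\le2l$, $t_i(l;p,q)\in H_{(\nu_i,\sigma_i)}$ is the element whose restriction to $K$ is $$x\mapsto\langle v^{(2l)*}_{i,2l-p},\tau_{2l}(x)v^{(2l)}_{1,q}\rangle\otimes\chi_{l-p}+c_i\langle v^{(2l)*}_{i,p},\tau_{2l}(x)v^{(2l)}_{1,q}\rangle\otimes\chi_{p-l},\qquad c_1=(-1)^p,\ c_2=(-1)^l.$$ The subscript $K$ denotes $K$-finite vectors, and the differential of a representation is denoted by the same symbol. *)

(* Defs.v *)
From HB Require Import structures.
From mathcomp Require Import all_boot all_order all_algebra.
From mathcomp Require Import complex.
From mathcomp Require mpoly.

Set Implicit Arguments.
Unset Strict Implicit.
Unset Printing Implicit Defensive.

(* mpoly is imported in this module only: its notations clash with those of
   mathcomp-analysis. *)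
Module BinaryForms.
Import mpoly GRing.Theory.
Local Open Scope ring_scope.

Section BinaryForms.
Variable C : fieldType.

(* V_l, the homogeneous polynomials of degree l in x = 'X_0 and y = 'X_1. *)
Definition form (l : nat) : vectType C := dhomog 2 C l.

Definition lin (a b : C) : {mpoly C[2]} := a *: 'X_0 + b *: 'X_1.

Lemma lin_homog a b : lin a b \is 1.-homog.
Proof. by rewrite rpredD// rpredZ// dhomogX /= mdeg1. Qed.

Lemma subst_homog l (f : form l) (a b c d : C) :
  comp_mpoly [tuple lin a b; lin c d] (mpoly_of_dhomog f) \is l.-homog.
Proof.
rewrite comp_mpolyE big_seq rpred_sum// => m mf; rewrite rpredZ//.
have /dhomogP/(_ _ mf) ml := dhomog_is_dhomog f.
rewrite -ml /= mdegE !big_ord_recl !big_ord0 /= !mulr1 addn0.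
by apply: dhomogM; rewrite -[X in X.-homog]mul1n;
  apply: dhomogMn; exact: lin_homog.
Qed.

(* f(x, y) |-> f(ax + by, cx + dy) *)
Definition subst (a b c d : C) l (f : form l) : form l :=
  DHomog (subst_homog f a b c d).

(* x^q y^(l - q) for q <= l (see monomE), and 0 for q > l. *)
Definition monom (l q : nat) : form l :=
  @indhomog 2 C l ('X_0 ^+ q * 'X_1 ^+ (l - q)).

Lemma monomE l q : (q <= l)%N ->
  mpoly_of_dhomog (monom l q) = 'X_0 ^+ q * 'X_1 ^+ (l - q).
Proof.
move=> ql; rewrite /monom /indhomog insubdK//.
rewrite -[X in X.-homog](subnKC ql); apply: dhomogM.
  by rewrite -[X in X.-homog]mul1n; apply: dhomogMn; rewrite dhomogX /= mdeg1.
by rewrite -[X in X.-homog]mul1n; apply: dhomogMn; rewrite dhomogX /= mdeg1.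
Qed.

End BinaryForms.
End BinaryForms.

From mathcomp Require Import all_classical all_reals all_analysis.
Import Order.TTheory GRing.Theory Num.Theory numFieldNormedType.Exports.
Local Open Scope classical_set_scope.
Local Open Scope ring_scope.
Local Open Scope complex_scope.

Definition rows (T : nmodType) n (s : seq (seq T)) : 'M[T]_n :=
  \matrix_(i, j) (nth [::] s i)`_j.

Section Groups.
Variable R : realType.
Local Notation C := R[i].

Definition SL3 : set 'M[R]_3 := [set g | \det g = 1].
Definition SO3 : set 'M[R]_3 := [set x | x *m x^T = 1%:M /\ \det x = 1].
Definition O2 : set 'M[R]_2 := [set x | x *m x^T = 1%:M].
Definition SLpm2 : set 'M[R]_2 := [set h | \det h = 1 \/ \det h = -1].
Definition SU2 : set 'M[C]_2 :=
  [set u | u *m (map_mx (@conjc R) u)^T = 1%:M /\ \det u = 1].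

Definition expmx n (X : 'M[R]_n.+1) : 'M[R]_n.+1 :=
  limn (series (fun k => k`!%:R^-1 *: X ^+ k)).

Definition cexp (z : C) : C :=
  (expR (complex.Re z))%:C * (cos (complex.Im z) +i* sin (complex.Im z)).

(* a^mu for a > 0 *)
Definition cpow (a : R) (mu : C) : C := cexp (mu * (ln a)%:C).

Definition phi (u : 'M[C]_2) : 'M[R]_3 :=
  let p := complex.Re (u 0 0) in let q := complex.Im (u 0 0) in
  let r := complex.Re (u 0 1) in let s := complex.Im (u 0 1) in
  rows 3 [::
    [:: p^+2 + q^+2 - r^+2 - s^+2; - 2 * (p * s - q * r); 2 * (p * r + q * s)];
    [:: 2 * (p * s + q * r); p^+2 - q^+2 + r^+2 - s^+2; - 2 * (p * q - r * s)];
    [:: - 2 * (p * r - q * s); 2 * (p * q + r * s); p^+2 - q^+2 - r^+2 + s^+2]].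

Definition Vrep (l : nat) : vectType C := BinaryForms.form C l.

Definition tau l (u : 'M[C]_2) (f : Vrep l) : Vrep l :=
  let a := invmx u 0 0 in let b := invmx u 0 1 in
  BinaryForms.subst a b (- conjc b) (conjc a) f.

(* For l even, tau factors through phi : SU(2) -> SO(3), so the chosen
   preimage is immaterial. *)
Definition tauK l (x : 'M[R]_3) : Vrep l -> Vrep l :=
  tau (xget 1%:M [set u | SU2 u /\ phi u = x]).

Definition u_c : 'M[R]_3 :=
  rows 3 [:: [:: 0; 0; -1]; [:: 0; 1; 0]; [:: 1; 0; 0]].

(* The bases (v_{i,q})_{0 <= q <= l} of V_l and their dual bases. *)
Definition vbase (i l q : nat) : Vrep l :=
  if i == 2%N then tauK u_c (BinaryForms.monom C l q) else BinaryForms.monom C l q.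

Definition vdual (i l p : nat) (f : Vrep l) : C :=
  coord [tuple vbase i l q | q < l.+1] (inord p) f.

(* The basis X_0, ..., X_4 of p_C. *)
Definition Xp (r : nat) : 'M[C]_3 :=
  let M := @rows C 3 in
  nth 0 [::
    M [:: [:: 0; 0; 0]; [:: 0; 1; - 'i%C]; [:: 0; - 'i%C; -1]];
    - 2^-1 *: M [:: [:: 0; 'i%C; 1]; [:: 'i%C; 0; 0]; [:: 1; 0; 0]];
    - 3^-1 *: M [:: [:: 2; 0; 0]; [:: 0; -1; 0]; [:: 0; 0; -1]];
    - 2^-1 *: M [:: [:: 0; 'i%C; -1]; [:: 'i%C; 0; 0]; [:: -1; 0; 0]];
    M [:: [:: 0; 0; 0]; [:: 0; 1; 'i%C]; [:: 0; 'i%C; -1]]] r.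

End Groups.

Section Coefficients.
Variable R : realType.
Local Notation C := R[i].

Definition Anum (l m k : int) : seq int :=
  if m == 2 then
    [:: (l + 4 - k) * (l + 3 - k) * (l + 2 - k) * (l + 1 - k);
        4 * (l + 4 - k) * (l + 3 - k) * (l + 2 - k) * k;
        6 * (l + 4 - k) * (l + 3 - k) * k * (k - 1);
        4 * (l + 4 - k) * k * (k - 1) * (k - 2);
        k * (k - 1) * (k - 2) * (k - 3)]
  else if m == 1 then
    [:: (l + 2 - k) * (l + 1 - k) * (l - k);
        - ((l + 2 - k) * (l + 1 - k) * (l - 4 * k));
        - (3 * (l + 2 - k) * (l - 2 * k + 2) * k);
        - ((3 * l - 4 * k + 8) * k * (k - 1));
        - (k * (k - 1) * (k - 2))]
  else if m == 0 then
    [:: (l - k) * (l - 1 - k);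
        - (2 * (l - k) * (l - 2 * k - 1));
        l ^+ 2 - 6 * k * l + 6 * k ^+ 2 - l;
        2 * (l - 2 * k + 1) * k;
        k * (k - 1)]
  else if m == -1 then
    [:: l - k - 2; - (3 * l - 4 * k - 6); 3 * (l - 2 * k - 2);
        - (l - 4 * k - 2); - k]
  else if m == -2 then [:: 1; -4; 6; -4; 1]
  else [::].

Definition Aden (l m : int) : int :=
  if m == 2 then (l + 4) * (l + 3) * (l + 2) * (l + 1)
  else if m == 1 then (l + 2) * (l + 1) * l
  else if m == 0 then l * (l - 1)
  else if m == -1 then l - 2
  else 1.

(* Acoef l m k i is A_[l, 2m; k, i]. *)
Definition Acoef (l m k : int) (i : nat) : C :=
  if (0 <= k) && (k <= l + 2 * m) then
    ((Anum l m k)`_i)%:~R / (Aden l m)%:~R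
  else 0.

Definition Bnum (l m q : int) : seq int :=
  if m == 2 then [:: 1; 1; 1; 1; 1]
  else if m == 1 then
    [:: 4 * q; - (l - 4 * q); - (2 * (l - 2 * q)); - (3 * l - 4 * q);
        - (4 * (l - q))]
  else if m == 0 then
    [:: 6 * q * (q - 1);
        - (3 * q * (l - 2 * q + 1));
        l ^+ 2 - 6 * l * q + 6 * q ^+ 2 - l;
        3 * (l - 2 * q - 1) * (l - q);
        6 * (l - q) * (l - q - 1)]
  else if m == -1 then
    [:: 4 * q * (q - 1) * (q - 2);
        - (q * (q - 1) * (3 * l - 4 * q + 2));
        2 * q * (l - 2 * q) * (l - q);
        - ((l - 4 * q - 2) * (l - q) * (l - q - 1));
        - (4 * (l - q) * (l - q - 1) * (l - q - 2))]
  else if m == -2 then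
    [:: q * (q - 1) * (q - 2) * (q - 3);
        - (q * (q - 1) * (q - 2) * (l - q));
        q * (q - 1) * (l - q) * (l - q - 1);
        - (q * (l - q) * (l - q - 1) * (l - q - 2));
        (l - q) * (l - q - 1) * (l - q - 2) * (l - q - 3)]
  else [::].

Definition Bden (l m : int) : int :=
  if m == 2 then 1
  else if m == 1 then l + 4
  else if m == 0 then (l + 3) * (l + 2)
  else if m == -1 then (l + 2) * (l + 1) * l
  else (l + 1) * l * (l - 1) * (l - 2).

(* The cases (l, m) in which B_[2l, 2m; q, r] and gamma0_[l, m; p, j] are set
   to 0 by convention (the formulas may have vanishing denominators). *)
Definition excluded (l m : int) : bool :=
  ((l == 0) && (m < 2)) || ((l == 1) && (m < 0)).

(* Bcoef l m q r is B_[2l, 2m; q, r]. *)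
Definition Bcoef (l m q : int) (r : nat) : C :=
  if excluded l m then 0
  else ((Bnum (2 * l) m q)`_r)%:~R / (Bden (2 * l) m)%:~R.

Definition gamma0 (nu1 nu2 : C) (l m p j : int) : C :=
  if excluded l m then 0
  else if j == 1 then
    (nu2 + 1 - l%:~R + p%:~R) * Acoef (2 * l) m (2 * l - p + m - 2) 0
  else if j == 0 then
    - 3^-1 * (2 * nu1 - nu2 + 2 * 2 - 1 + (l * m)%:~R - 3
              + (m * (m + 1))%:~R / 2) * Acoef (2 * l) m (2 * l - p + m) 2
  else if j == -1 then
    (nu2 + 1 + l%:~R - p%:~R) * Acoef (2 * l) m (2 * l - p + m + 2) 4
  else 0.

Definition gammaP (i k : nat) (nu : C) (l m p j : int) : C :=
  if j == 1 then
    (-1) ^+ i.+1 * (k%:R - l%:~R + p%:~R) * Acoef (2 * l) m (2 * l - p + m - 2) 0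
  else if j == 0 then
    (-1) ^+ i / 3 * (nu + 3 + (l * m)%:~R - 3 + (m * (m + 1))%:~R / 2)
      * Acoef (2 * l) m (2 * l - p + m) 2
  else if j == -1 then
    (-1) ^+ i.+1 * (k%:R + l%:~R - p%:~R) * Acoef (2 * l) m (2 * l - p + m + 2) 4
  else 0.

End Coefficients.

Section Analysis.
Variable R : realType.
Local Notation C := R[i].
Local Notation M3 := 'M[R]_3.

(* c has derivative w at 0, for a curve c in a complex normed space. *)
Definition curve_deriv (W : normedModType C) (c : R -> W) (w : W) : Prop :=
  (fun t : R => (t^-1)%:C *: (c t - c 0)) @ 0^' --> w.

(* w = pi(X) v for the complexified differential
   pi(X) = pi(Re X) + sqrt(-1) pi(Im X) of a representation pi. *)
Definition differential n (W : normedModType C) (pi : 'M[R]_n.+1 -> W -> W)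
    (X : 'M[C]_n.+1) (v w : W) : Prop :=
  exists w1 w2 : W,
    [/\ curve_deriv (fun t => pi (expmx (t *: map_mx (@complex.Re R) X)) v) w1,
        curve_deriv (fun t => pi (expmx (t *: map_mx (@complex.Im R) X)) v) w2
      & w = w1 + 'i%C *: w2].

(* L is the (real) Frechet derivative of F at x. *)
Definition frechet (W : normedModType C) (F : M3 -> W) (x : M3) (L : M3 -> W) :=
  (forall (a : R) h1 h2, L (a *: h1 + h2) = a%:C *: L h1 + L h2) /\
  (forall e : R, 0 < e -> \forall h \near (0 : M3),
     complex.Re `|F (x + h) - F x - L h| <= e * `|h|).

Fixpoint Ck (W : normedModType C) (U : set M3) (k : nat) (F : M3 -> W) : Prop :=
  if k is k'.+1 then
    exists dF : M3 -> M3 -> W,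
      (forall x, U x -> frechet F x (dF x)) /\
      (forall h, Ck U k' (fun x => dF x h))
  else forall x, U x -> {for x, continuous F}.

(* Smoothness on the submanifold SL(3, R) of M_3(R). Here and below, functions
   on SL(3, R) are represented by functions on M_3(R), whose values outside
   SL(3, R) are irrelevant. *)
Definition smooth_SL3 (W : normedModType C) (f : M3 -> W) : Prop :=
  forall g, SL3 g -> exists (U : set M3) (F : M3 -> W),
    [/\ open U, U g, forall k, Ck U k F
      & forall x, U x -> SL3 x -> f x = F x].

Definition borelM3 := g_sigma_algebraType (@open M3).

Definition haar_SO3 (mu : {measure set borelM3 -> \bar R}) : Prop :=
  (0 < mu (@SO3 R) < +oo)%E /\
  forall (k : M3) (B : set borelM3), SO3 k -> measurable B -> B `<=` @SO3 R ->
    mu [set k *m x | x in (B : set M3)] = mu B.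

Definition sqnormK (mu : {measure set borelM3 -> \bar R})
    (W : normedModType C) (f : M3 -> W) : \bar R :=
  (\int[mu]_(x in @SO3 R) ((complex.Re `|f x|) ^+ 2)%:E)%E.

(* iota : S -> H is the completion of the space S of functions on SL(3, R) for
   the norm sqnormK, and pi is the right regular representation on H. *)
Record right_regular (mu : {measure set borelM3 -> \bar R})
    (W : normedModType C) (S : set (M3 -> W)) (H : completeNormedModType C)
    (iota : (M3 -> W) -> H) (pi : M3 -> H -> H) : Prop := {
  iota_linear : forall (a : C) f g, S f -> S g ->
    iota (fun x => a *: f x + g x) = a *: iota f + iota g;
  iota_norm : forall f, S f ->
    ((complex.Re `|iota f|) ^+ 2)%:E = sqnormK mu f;
  iota_dense : closure (iota @` S) = setT;
  rep_linear : forall g, SL3 g -> forall (a : C) u w,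
    pi g (a *: u + w) = a *: pi g u + pi g w;
  rep_continuous : forall g, SL3 g -> continuous (pi g);
  rep_iota : forall g f, SL3 g -> S f ->
    pi g (iota f) = iota (fun x => f (x *m g)) }.

End Analysis.

Section PrincipalSeries.
Variable R : realType.
Local Notation C := R[i].
Local Notation M3 := 'M[R]_3.

Definition A0 : set M3 :=
  [set a : M3 | [/\ is_diag_mx a, forall i, 0 < a i i & \det a = 1]].
Definition N0 : set M3 :=
  [set n : M3 | forall i j : 'I_3, (j <= i)%N -> n i j = (i == j)%:R].
Definition M0 : set M3 :=
  [set m : M3 | exists e1 e2 : bool,
    m = rows 3 [:: [:: (-1) ^+ e1; 0; 0]; [:: 0; (-1) ^+ e2; 0];
                   [:: 0; 0; (-1) ^+ e1 * (-1) ^+ e2]]].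

Definition chi0 (mu1 mu2 : C) (a : M3) : C :=
  cpow (a 0 0) mu1 * cpow (a 1 1) mu2.
Definition sigma0 (s1 s2 : bool) (m : M3) : C :=
  ((m 0 0) ^+ s1 * (m 1 1) ^+ s2)%:C.

(* The smooth vectors whose completion is H_(nu_0, sigma_0); rho_0 = (2, 1). *)
Definition section0 (nu1 nu2 : C) (s1 s2 : bool) : set (M3 -> C^o) :=
  [set f | smooth_SL3 (W := C^o) f /\
    forall n a m x, N0 n -> A0 a -> M0 m -> SL3 x ->
      f (n *m a *m m *m x)
      = chi0 (nu1 + 2) (nu2 + 1) a * sigma0 s1 s2 m * f x].

Definition eps0 (s1 s2 : bool) (l : int) : nat := `|((l - (s1 : nat)%:Z - (s2 : nat)%:Z) %% 2)%Z|%N.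

Definition Zset (s1 s2 : bool) (l p : int) : bool :=
  [&& (p == l - (s2 : nat)%:Z %[mod 2])%Z, 0 <= p & p <= l - (eps0 s1 s2 l)%:Z].

(* f|_K is x |-> <v*_{2l-p} + (-1)^eps v*_p, tau_{2l}(x) v_q>. *)
Definition restr0 (s1 s2 : bool) (l p q : nat) (f : M3 -> C^o) : Prop :=
  forall x, SO3 x ->
    f x = vdual 1 (l.*2 - p)%N (tauK x (vbase R 1 l.*2 q))
        + (-1) ^+ eps0 s1 s2 l * vdual 1 p (tauK x (vbase R 1 l.*2 q)).

(* The extension of the family s to all integer indices. *)
Definition ext0 (s1 s2 : bool) (H : lmodType C) (s : nat -> nat -> nat -> H)
    (l p q : int) : H :=
  let base p :=
    if [&& Zset s1 s2 l p, 0 <= q & q <= 2 * l] then s `|l|%N `|p|%N `|q|%N else 0 in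
  if p <= l then base p else (-1) ^+ eps0 s1 s2 l *: base (2 * l - p).

(* The O(2)-types of D_k. *)
Definition Dk_weight (k : nat) : set int :=
  [set p | exists a : nat, p = (k + a.*2)%N%:Z \/ p = - (k + a.*2)%N%:Z].

Definition kappa (t : R) : 'M[R]_2 :=
  rows 2 [:: [:: cos t; sin t]; [:: - sin t; cos t]].
Definition xpm (e : C) : 'M[C]_2 :=
  rows 2 [:: [:: 1; e * 'i%C]; [:: e * 'i%C; -1]].

Definition O2_finite (W : lmodType C) (D : 'M[R]_2 -> W -> W) (w : W) : Prop :=
  exists (n : nat) (e : 'I_n -> W), forall x, O2 x ->
    exists c : 'I_n -> C, D x w = \sum_i c i *: e i.

(* (W, ip, D) is a Hilbert space realization of the discrete series D_k of
   SL^{+-}(2, R), and chi its standard basis of O(2)-finite vectors. The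
   conditions determine D_k up to unitary equivalence. *)
Record discrete_series (k : nat) (W : completeNormedModType C)
    (ip : W -> W -> C) (D : 'M[R]_2 -> W -> W) (chi : int -> W) : Prop := {
  ip_linear : forall (a : C) u1 u2 w, ip (a *: u1 + u2) w = a * ip u1 w + ip u2 w;
  ip_conj : forall u w, ip w u = conjc (ip u w);
  ip_norm : forall w, ip w w = `|w| ^+ 2;
  D_linear : forall g, SLpm2 g -> forall (a : C) u w,
    D g (a *: u + w) = a *: D g u + D g w;
  D_one : forall w, D 1%:M w = w;
  D_mul : forall g h w, SLpm2 g -> SLpm2 h -> D (g *m h) w = D g (D h w);
  D_unitary : forall g u w, SLpm2 g -> ip (D g u) (D g w) = ip u w;
  D_continuous : forall w, {within @SLpm2 R, continuous (fun g => D g w)};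
  chi_neq0 : forall p, Dk_weight k p -> chi p != 0;
  chi_orthogonal : forall p p', Dk_weight k p -> Dk_weight k p' -> p != p' ->
    ip (chi p) (chi p') = 0;
  chi_span : forall w, O2_finite D w <->
    exists (ps : seq int) (c : int -> C),
      (forall p, p \in ps -> Dk_weight k p) /\
      w = \sum_(p <- ps) c p *: chi p;
  D_kappa : forall p t, Dk_weight k p ->
    D (kappa t) (chi p) = cexp ('i%C * (p%:~R * t%:C)) *: chi p;
  D_reflection : forall p, Dk_weight k p ->
    D (rows 2 [:: [:: 1; 0]; [:: 0; -1]]) (chi p) = chi (- p);
  D_xplus : forall p, Dk_weight k p ->
    differential D (xpm 1) (chi p) ((k%:R + p%:~R) *: chi (p + 2));
  D_xminus : forall p, Dk_weight k p ->
    differential D (xpm (-1)) (chi p) ((k%:R - p%:~R) *: chi (p - 2)) }.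

(* Data of the maximal parabolic subgroup P_i, for i = 1, 2. *)
Definition NP (i : nat) : set M3 :=
  if i == 1%N then [set n : M3 | exists w : 'rV[R]_2, n = block_mx 1%:M w 0 (1%:M : 'M[R]_2)]
  else [set n : M3 | exists w : 'cV[R]_2, n = block_mx (1%:M : 'M[R]_2) w 0 1%:M].

Definition HP (i : nat) : M3 :=
  if i == 1%N then rows 3 [:: [:: 2; 0; 0]; [:: 0; -1; 0]; [:: 0; 0; -1]]
  else rows 3 [:: [:: 1; 0; 0]; [:: 0; 1; 0]; [:: 0; 0; -2]].

Definition mP (i : nat) (h : 'M[R]_2) : M3 :=
  if i == 1%N then block_mx ((\det h)^-1%:M : 'M[R]_1) 0 0 h
  else block_mx h 0 0 ((\det h)^-1%:M : 'M[R]_1).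

(* The smooth vectors whose completion is H_(nu_i, sigma_i), sigma_i = D_k;
   rho_i = 3. *)
Definition sectionP (i : nat) (nu : C) (W : normedModType C)
    (D : 'M[R]_2 -> W -> W) : set (M3 -> W) :=
  [set f | smooth_SL3 f /\
    forall n t h x, NP i n -> SLpm2 h -> SL3 x ->
      f (n *m expmx (t *: HP i) *m mP i h *m x)
      = cexp (t%:C * (nu + 3)) *: D h (f x)].

(* f|_K is x |-> <v*_{i,2l-p}, tau_{2l}(x) v_{1,q}> chi_{l-p}
               + c_i <v*_{i,p}, tau_{2l}(x) v_{1,q}> chi_{p-l}. *)
Definition restrP (i : nat) (W : normedModType C) (chi : int -> W)
    (l p q : nat) (f : M3 -> W) : Prop :=
  forall x, SO3 x ->
    f x = vdual i (l.*2 - p)%N (tauK x (vbase R 1 l.*2 q)) *: chi (l%:Z - p%:Z)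
        + ((-1) ^+ (if i == 1%N then p else l)
           * vdual i p (tauK x (vbase R 1 l.*2 q))) *: chi (p%:Z - l%:Z).

Definition ZP (k : nat) (l p : int) : bool :=
  [&& (p == l - k%:Z %[mod 2])%Z, 0 <= p & p <= l - k%:Z].

(* The extension by 0 of the family t to all integer indices. *)
Definition extP (k : nat) (H : lmodType C) (t : nat -> nat -> nat -> H)
    (l p q : int) : H :=
  if [&& ZP k l p, 0 <= q & q <= 2 * l] then t `|l|%N `|p|%N `|q|%N else 0.

End PrincipalSeries.

(* Main.v *)
(* A section f restricts to SO(3) as a combination of matrix coefficients of
   tau_2l, and its derivative at x in SO(3) along x exp(t X_r) is a first order
   expression in f. Writing x X_r = (Ad(x) X_r) x and expanding Ad(x) X_r in the
   basis X_r' (the adjoint action on p_C is tau_4), the derivative becomes a sum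
   of products of a matrix coefficient of tau_4 with the derivative of f in the
   left directions X_r'. By the Iwasawa-type decomposition X_r' = n + a + m + k,
   the left transformation law of f gives the n, a and m parts, and the k part
   is a shift of the index of the matrix coefficient. The products are expanded
   by the explicit Clebsch-Gordan decomposition of V_4 (x) V_2l into the
   V_(2l+2m), whose two transition matrices are the coefficients A and B, and a
   recurrence between A_[2l,2m;k,1], A_[2l,2m;k,2] and A_[2l,2m;k,3] collects
   the three middle terms into gamma_[l,m;p,0]. For P_2 everything is
   transported by u_c. Since SO(3) is compact, the pointwise derivatives are
   uniform on SO(3), hence derivatives in the norm of H. *)

Require Import Defs.
From mathcomp Require Import all_boot all_order all_algebra.
From mathcomp Require Import complex reals ring lra zify.
From mathcomp Require mpoly.
Import Order.TTheory GRing.Theory Num.Theory.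
Local Open Scope ring_scope.
Set Implicit Arguments.
Unset Strict Implicit.
Unset Printing Implicit Defensive.

(** * Clebsch-Gordan coefficients *)

(** Two obstacles shape the analytic half. A limit in the abstract completion must be named in
    advance, as [iota] of a section restricting on SO(3) to the pointwise derivative. No section is
    built from its restriction: the candidate is the right-hand side itself, a combination of given
    basis vectors, each carrying the section behind it. Moreover only real matrices are
    exponentiated, while X_r is complex. Conjugation maps X_r to (-1)^r X_(4-r), so the real and
    imaginary parts of X_r are combinations of these two, and the five formulas are handled
    together. The coefficients A come from the SL(2)-map from V_L to V_4 tensor V_n that polarizes a
    form and multiplies it by a power of the invariant determinant x w - y z; equivariance is then a
    substitution in a polynomial identity. B enters only as a one-sided inverse of A. The scalar l m
    - 3 + m (m + 1) / 2 in gamma_[l,m;p,0] is half of c(l + m) - c(l) - c(2) with c(j) = j (j + 1):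
    the mixed Casimir term on V_4 tensor V_2l. *)

Section BinarySubst.
Variable F : fieldType.

(* The coefficient of x^p y^(L-p) in (x^q y^(L-q)) o M, for q <= L. *)
Definition subst_coef (M : 'M[F]_2) (L p q : nat) : F :=
  ((M 0 0 *: 'X + (M 0 1)%:P) ^+ q * (M 1 0 *: 'X + (M 1 1)%:P) ^+ (L - q))`_p.

Section Homogenize.
Variables (A : comNzRingType) (f : {rmorphism F -> A}) (Z W : A).

(** Undoes the dehomogenization at y = 1 built into [subst_coef]. Coefficients above degree [L]
    would be lost, hence the size bounds carried along below. *)
Definition homogenize (L : nat) (P : {poly F}) : A :=
  \sum_(p < L.+1) f P`_p * (Z ^+ p * W ^+ (L - p)).

Lemma homogenize_linear L (a b : F) (P : {poly F}) : (size P <= L.+1)%N ->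
  homogenize L.+1 ((a *: 'X + b%:P) * P) = (f a * Z + f b * W) * homogenize L P.
Proof.
move=> sP.
have -> : (a *: 'X + b%:P) * P = a *: (P * 'X) + b *: P.
  by rewrite mulrDl -scalerAl [_ * P]mulrC mul_polyC.
rewrite mulrDl /homogenize !mulr_sumr.
under eq_bigr do rewrite coefD !coefZ coefMX rmorphD !rmorphM/= mulrDl.
rewrite big_split/=; congr (_ + _).
  rewrite big_ord_recl /= rmorph0 mulr0 mul0r add0r; apply: eq_bigr => i _.
  by rewrite /bump /= add1n subSS exprS; ring.
rewrite big_ord_recr /= nth_default// rmorph0 mulr0 mul0r addr0.
apply: eq_bigr => i _; rewrite subSn ?exprS; [ring | by rewrite -ltnS].
Qed.

Lemma size_linear_le (a b : F) : (size (a *: 'X + b%:P)%R <= 2)%N.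
Proof.
rewrite (leq_trans (size_polyD _ _))// geq_max size_polyC.
by rewrite (leq_trans (size_scale_leq _ _)) ?size_polyX//; case: (b == 0).
Qed.

Lemma homogenize_linear_exp n L (a b : F) (P : {poly F}) : (size P <= L.+1)%N ->
  homogenize (n + L) ((a *: 'X + b%:P) ^+ n * P)
  = (f a * Z + f b * W) ^+ n * homogenize L P
  /\ (size ((a *: 'X + b%:P) ^+ n * P)%R <= (n + L).+1)%N.
Proof.
move=> sP; elim: n => [|n [IH sn]]; first by rewrite !expr0 !mul1r.
rewrite addSn !exprS -!mulrA homogenize_linear// IH; split => //.
rewrite (leq_trans (size_polyMleq _ _))//.
by have := size_linear_le a b; move: sn; set u := size _; set v := size _; lia.
Qed.

(** Stated over an arbitrary ring receiving [F], because it is applied to univariate, nested and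
    multivariate polynomials alike. *)
Lemma subst_coef_expand (M : 'M[F]_2) L q : (q <= L)%N ->
  (f (M 0 0) * Z + f (M 0 1) * W) ^+ q * (f (M 1 0) * Z + f (M 1 1) * W) ^+ (L - q)
  = \sum_(p < L.+1) f (subst_coef M L p q) * (Z ^+ p * W ^+ (L - p)).
Proof.
move=> /subnKC <-; move: (L - q)%N => n; rewrite /subst_coef addKn.
have s1 : (size (1%R : {poly F}) <= 1)%N by rewrite size_poly1.
have [E1 S1] := homogenize_linear_exp n (M 1 0) (M 1 1) s1.
rewrite addn0 mulr1 in E1 S1.
have [+ _] := homogenize_linear_exp q (M 0 0) (M 0 1) S1.
by rewrite E1 /homogenize big_ord1 coef1 rmorph1 !expr0 !mulr1 => ->.
Qed.

End Homogenize.
End BinarySubst.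

Section SubstCoef.
Variable F : fieldType.
Implicit Types M : 'M[F]_2.

(** The linear forms of [M' *m M] are those of [M'] evaluated at the linear forms of [M], which
    reverses the order of the factors. Passing to inverse matrices later restores it. *)
Lemma subst_coefM M M' L p q : (q <= L)%N ->
  subst_coef (M' *m M) L p q = \sum_(c < L.+1) subst_coef M L p c * subst_coef M' L c q.
Proof.
move=> qL; rewrite /subst_coef.
have E i : (M' *m M) i 0 *: 'X + ((M' *m M) i 1)%:P
   = polyC (M' i 0) * (M 0 0 *: 'X + (M 0 1)%:P) + polyC (M' i 1) * (M 1 0 *: 'X + (M 1 1)%:P).
  rewrite !mxE !big_ord_recl !big_ord0 !addr0 !mul_polyC.
  have -> : lift ord0 ord0 = 1 :> 'I_2 by apply/val_inj.
  have -> : ord0 = 0 :> 'I_2 by apply/val_inj.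
  by rewrite scalerDl !polyCD !polyCM -!scalerA -!mul_polyC; ring.
rewrite !E (subst_coef_expand polyC)// coef_sum; apply: eq_bigr => c _.
by rewrite coefCM mulrC.
Qed.

Lemma subst_coef1 L p q : (q <= L)%N -> subst_coef (1%:M : 'M[F]_2) L p q = (p == q)%:R.
Proof.
move=> qL; rewrite /subst_coef !mxE /= scale1r scale0r addr0 add0r expr1n mulr1.
by rewrite coefXn.
Qed.

Lemma subst_coefZ M (c : F) L p q : (q <= L)%N ->
  subst_coef (c *: M) L p q = c ^+ L * subst_coef M L p q.
Proof.
move=> qL; rewrite /subst_coef !mxE !polyCM -!scalerA -!mul_polyC -!mulrDr.
by rewrite !exprMn mulrACA -exprD subnKC// -polyC_exp coefCM.
Qed.

End SubstCoef.

(** * Polarization of binary forms *)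

Section Polarization.
Variable A : comNzRingType.
Implicit Types x y z w : A.

(* The coefficient of t^s in (z + t x)^k (w + t y)^(L-k). *)
Definition polarize s L k x y z w : A :=
  \sum_(i < s.+1) ('C(k, i) * 'C(L - k, s - i))%:R *
    (x ^+ i * y ^+ (s - i) * (z ^+ (k - i) * w ^+ (L - k - (s - i)))).

Lemma coef_linear_exp x z k i :
  ((x *: 'X + z%:P) ^+ k)`_i = 'C(k, i)%:R * (x ^+ i * z ^+ (k - i)).
Proof.
rewrite addrC exprDn coef_sum.
under eq_bigr do rewrite coefMn exprZn -polyC_exp coefCM coefZ coefXn.
case: (leqP i k) => ik; last first.
  rewrite bin_small// mul0r big1// => j _.
  case: eqP => [E|_]; last by rewrite !mulr0 mul0rn.
  by have := ltn_ord j; rewrite -E ltnS leqNgt ik.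
have ik' : (i < k.+1)%N by [].
rewrite (bigD1 (Ordinal ik'))//= eqxx mulr1 big1 ?addr0; last first.
  move=> j /eqP ji; case: eqP => [E|_]; last by rewrite !mulr0 mul0rn.
  by case: ji; apply/val_inj.
rewrite -mulr_natl /=; ring.
Qed.

Lemma polarizeE s L k x y z w :
  polarize s L k x y z w
  = ((x *: 'X + z%:P) ^+ k * (y *: 'X + w%:P) ^+ (L - k))`_s.
Proof.
rewrite coefM; apply: eq_bigr => i _; rewrite !coef_linear_exp natrM; ring.
Qed.

(** The generating polynomial is the monomial evaluated at the point (z + t x, w + t y). A linear
    substitution acts on this point as a whole, so it may be expanded before the coefficient of t^s
    is taken. *)
Lemma polarize_subst (F : fieldType) (f : {rmorphism F -> A}) (M : 'M[F]_2)
    s L k x y z w : (k <= L)%N ->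
  polarize s L k (f (M 0 0) * x + f (M 0 1) * y) (f (M 1 0) * x + f (M 1 1) * y)
    (f (M 0 0) * z + f (M 0 1) * w) (f (M 1 0) * z + f (M 1 1) * w)
  = \sum_(k' < L.+1) f (subst_coef M L k' k) * polarize s L k' x y z w.
Proof.
move=> kL; rewrite polarizeE.
have E i : (f (M i 0) * x + f (M i 1) * y) *: 'X + (f (M i 0) * z + f (M i 1) * w)%:P
  = (polyC \o f) (M i 0) * (x *: 'X + z%:P) + (polyC \o f) (M i 1) * (y *: 'X + w%:P).
  by rewrite /= scalerDl !polyCD !polyCM -!scalerA -!mul_polyC; ring.
rewrite !E (subst_coef_expand (polyC \o f))// coef_sum; apply: eq_bigr => k' _.
by rewrite coefCM -polarizeE.
Qed.

End Polarization.

Section Intertwiner.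
Variable A : idomainType.
Implicit Types x y z w : A.

Lemma natr_ffact (n : nat) : [/\ (n ^_ 0)%:R = 1 :> A, (n ^_ 1)%:R = n%:R :> A,
  (n ^_ 2)%:R = n%:R * (n%:R - 1) :> A, (n ^_ 3)%:R = n%:R * (n%:R - 1) * (n%:R - 2) :> A
  & (n ^_ 4)%:R = n%:R * (n%:R - 1) * (n%:R - 2) * (n%:R - 3) :> A].
Proof.
have S k : (n ^_ k.+1)%:R = (n ^_ k)%:R * (n%:R - k%:R) :> A.
  rewrite ffactnSr natrM; case: (leqP k n) => kn; first by rewrite natrB.
  by rewrite ffact_small// !mul0r.
by rewrite !S !ffactn0 !subr0 !mul1r; split.
Qed.

(** The factor [z ^+ 4] trades the truncated exponent [k - i] for [4 - i], which does not depend on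
    [k]; for [i > k] both sides vanish. *)
Lemma bin_ffact_exp k i z : (i <= 4)%N ->
  (i`! * 'C(k, i))%:R * z ^+ (k - i) * z ^+ 4 = (k ^_ i)%:R * z ^+ k * z ^+ (4 - i) :> A.
Proof.
move=> i4; rewrite mulnC bin_ffact; case: (leqP i k) => ik.
  rewrite -!mulrA -!exprD; congr (_ * _ ^+ _); lia.
by rewrite ffact_small// !mul0r.
Qed.

Lemma polarizeM4 s L k x y z w : (s <= 4)%N ->
  s`!%:R * polarize s L k x y z w * (z ^+ 4 * w ^+ 4)
  = z ^+ k * w ^+ (L - k) * \sum_(i < s.+1) ('C(s, i) * k ^_ i * (L - k) ^_ (s - i))%:R *
    (x ^+ i * y ^+ (s - i) * (z ^+ (4 - i) * w ^+ (4 - (s - i)))).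
Proof.
move=> s4; rewrite mulr_sumr mulr_suml mulr_sumr; apply: eq_bigr => i _.
have is_ : (i <= s)%N by rewrite -ltnS.
rewrite -(bin_fact is_) !natrM.
have e1 := bin_ffact_exp k z (leq_trans is_ s4).
have e2 := bin_ffact_exp (L - k) w (leq_trans (leq_subr i s) s4).
rewrite !natrM in e1 e2.
transitivity ('C(s, i)%:R * (x ^+ i * y ^+ (s - i)) *
  (i`!%:R * 'C(k, i)%:R * z ^+ (k - i) * z ^+ 4) *
  ((s - i)`!%:R * 'C(L - k, s - i)%:R * w ^+ (L - k - (s - i)) * w ^+ 4)); first ring.
rewrite e1 e2; ring.
Qed.

End Intertwiner.

Section AnumFacts.

Lemma nat_le4 (s : nat) : (s <= 4)%N -> [\/ s = 0, s = 1, s = 2 | s = 3 \/ s = 4]%N.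
Proof.
case: s => [|[|[|[|[|s]]]]] // _; by [constructor 1|constructor 2|constructor 3|
  constructor 4; left|constructor 4; right].
Qed.

(** Such a [k] lies close to an end, with [k < 4] or [L - k < 4], and there a linear factor of the
    numerator vanishes. *)
Lemma Anum_out (n L s k i : nat) : (s <= 4)%N -> (i <= 4)%N -> (L + 4 = n + 2 * s)%N ->
  (k <= L)%N -> (k + 4 < s + i)%N || (n + s + i < k + 4)%N ->
  (Anum n (s%:Z - 2) k)`_i = 0.
Proof.
move=> s4 i4 EL kL /orP[h|h].
  have [e [ee ek]] : exists e, (e < 4)%N /\ k = e by exists k; lia.
  subst k.
  case: (nat_le4 s4) => [||| []] ?; subst s => //;
  case: (nat_le4 i4) => [||| []] ?; subst i => //;
  move: e h {ee} kL => [|[|[|[|e]]]] //= h _; rewrite /Anum /=; first [ring | lia].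
have [e [ee ek]] : exists e, (e + i < s)%N /\ (n + 2 * s = k + e + 4)%N.
  by exists (L - k)%N; lia.
have kE : k%:Z = n%:Z + 2 * s%:Z - e%:Z - 4 by lia.
clear L EL kL.
case: (nat_le4 s4) => [||| []] ?; subst s => //;
case: (nat_le4 i4) => [||| []] ?; subst i => //;
move: e ek {h} ee kE => [|[|[|[|e]]]] //= _ h -> {h}; rewrite /Anum /=; ring.
Qed.

End AnumFacts.

Section IntertwinerExpansion.
Variable A : idomainType.
Implicit Types x y z w : A.

(** The origin of the numerators of A: up to the sign (-1)^s they are the coefficients of s! times
    the polarization times [(x * w - y * z) ^+ (4 - s)]. The extra factor [z ^+ 4 * w ^+ 4] keeps
    all exponents nonnegative. *)
Lemma polarize_expand4 n L s k x y z w : (s <= 4)%N -> (L + 4 = n + 2 * s)%N -> (k <= L)%N ->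
  s`!%:R * polarize s L k x y z w * (x * w - y * z) ^+ (4 - s) * (z ^+ 4 * w ^+ 4)
  = (-1) ^+ s * (z ^+ k * w ^+ (L - k)) * \sum_(i < 5) ((Anum n (s%:Z - 2) k)`_i)%:~R *
     (x ^+ i * y ^+ (4 - i) * (z ^+ (8 - s - i) * w ^+ (4 - s + i))).
Proof.
move=> s4 EL kL; rewrite mulrAC polarizeM4// [(-1) ^+ s * _]mulrC -[LHS]mulrA -[RHS]mulrA; congr (_ * _).
pose fk i : A := (k ^_ i)%:R; pose fl i : A := ((L - k) ^_ i)%:R.
under eq_bigr do rewrite !natrM -[(k ^_ _)%:R]/(fk _) -[((L - k) ^_ _)%:R]/(fl _).
have [F0 F1 F2 F3 F4] : [/\ fk 0 = 1, fk 1 = k%:R, fk 2 = k%:R * (k%:R - 1),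
  fk 3 = k%:R * (k%:R - 1) * (k%:R - 2) & fk 4 = k%:R * (k%:R - 1) * (k%:R - 2) * (k%:R - 3)].
  exact: natr_ffact.
(* Once the truncated subtraction [L - k] is a polynomial in n, s and k, the identity for each of
   the five values of s is decided by [ring]. *)
have E : (L - k)%:R = n%:R + (2 * s)%:R - 4 - k%:R :> A.
  by rewrite natrB// -natrD -EL natrD; ring.
have : [/\ fl 0 = 1, fl 1 = (L - k)%:R, fl 2 = (L - k)%:R * ((L - k)%:R - 1),
  fl 3 = (L - k)%:R * ((L - k)%:R - 1) * ((L - k)%:R - 2)
  & fl 4 = (L - k)%:R * ((L - k)%:R - 1) * ((L - k)%:R - 2) * ((L - k)%:R - 3)].
  exact: natr_ffact.
rewrite {}E => -[G0 G1 G2 G3 G4]; move: fk fl F0 F1 F2 F3 F4 G0 G1 G2 G3 G4 => fk fl.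
have bE i : bump 0 i = i.+1 by [].
have binE : ('C(2, 1) = 2) * ('C(3, 1) = 3) * ('C(3, 2) = 3) * ('C(4, 1) = 4)
  * ('C(4, 2) = 6) * ('C(4, 3) = 4) by [].
by case: (nat_le4 s4) => [||| []] ?; subst s => F0 F1 F2 F3 F4 G0 G1 G2 G3 G4;
  rewrite !big_ord_recl !big_ord0 !lift0 /= ?bE ?(bin0, binn, binE)
    ?subSS ?subn0 ?F0 ?F1 ?F2 ?F3 ?F4 ?G0 ?G1 ?G2 ?G3 ?G4 /Anum /=; ring.
Qed.
End IntertwinerExpansion.

Section IntertwinerExpansion2.
Variable A : idomainType.
Implicit Types x y z w : A.

(** Cancel [z ^+ 4 * w ^+ 4] in the domain; [Anum_out] disposes of the terms whose exponents of z or
    w would be negative. *)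
Lemma polarize_expand n L s k x y z w : z != 0 -> w != 0 ->
    (s <= 4)%N -> (L + 4 = n + 2 * s)%N -> (k <= L)%N ->
  s`!%:R * polarize s L k x y z w * (x * w - y * z) ^+ (4 - s)
  = (-1) ^+ s * \sum_(i < 5) \sum_(j < n.+1 | (j + i + s == k + 4)%N)
      ((Anum n (s%:Z - 2) k)`_i)%:~R * (x ^+ i * y ^+ (4 - i)) * (z ^+ j * w ^+ (n - j)).
Proof.
move=> z0 w0 s4 EL kL; have zw0 : z ^+ 4 * w ^+ 4 != 0 by rewrite mulf_neq0// expf_neq0.
apply: (mulIf zw0); rewrite (polarize_expand4 _ _ _ _ s4 EL kL) -!mulrA; congr (_ * _).
rewrite mulr_suml mulrA mulr_sumr; apply: eq_bigr => i _.
have i4 : (i <= 4)%N by rewrite -ltnS.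
have [/(Anum_out s4 i4 EL kL) -> | ] := boolP ((k + 4 < s + i) || (n + s + i < k + 4))%N.
  by rewrite mulr0z !mul0r mulr0 big1 ?mul0r// => j _; rewrite !mul0r.
rewrite negb_or -!leqNgt => /andP[h1 h2].
have jn : (k + 4 - (s + i) < n.+1)%N by lia.
rewrite (big_pred1 (Ordinal jn)); last first.
  move=> j; apply/eqP/eqP => [e|-> /=]; last lia.
  by apply/val_inj => /=; lia.
have ez : z ^+ k * z ^+ (8 - s - i) = z ^+ (k + 4 - (s + i)) * z ^+ 4.
  by rewrite -!exprD; congr (_ ^+ _); lia.
have ew : w ^+ (L - k) * w ^+ (4 - s + i) = w ^+ (n - (k + 4 - (s + i))) * w ^+ 4.
  by rewrite -!exprD; congr (_ ^+ _); lia.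
rewrite /=; set a := _%:~R.
transitivity (a * (x ^+ i * y ^+ (4 - i)) * ((z ^+ k * z ^+ (8 - s - i)) *
  (w ^+ (L - k) * w ^+ (4 - s + i)))); first by ring.
by rewrite ez ew; ring.
Qed.

End IntertwinerExpansion2.

Lemma det_mx2 (R : comNzRingType) (M : 'M[R]_2) :
  \det M = M 0 0 * M 1 1 - M 0 1 * M 1 0.
Proof.
rewrite (expand_det_row _ 0) !big_ord_recl big_ord0 /cofactor !det_mx11 !mxE /=.
have -> : lift ord0 ord0 = 1 :> 'I_2 by apply/val_inj.
have -> : lift 1 0 = 0 :> 'I_2 by apply/val_inj.
have -> : ord0 = 0 :> 'I_2 by apply/val_inj.
by rewrite /= addr0 expr0 expr1 mul1r mulN1r mulrN.
Qed.

Section Intertwiner.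
Variable F : fieldType.
Hypothesis F0 : forall n, (n.+1%:R : F) != 0.

Let ff : {rmorphism F -> {poly {poly F}}} := polyC \o polyC.

Lemma coef2_sum m n (c : nat -> nat -> F) i j : (i < m)%N -> (j < n)%N ->
  (\sum_(i < m) \sum_(j < n) ff (c i j) * ('X ^+ i * ('X%:P) ^+ j))`_i`_j = c i j.
Proof.
move=> im jn.
have -> : \sum_(i < m) \sum_(j < n) ff (c i j) * ('X ^+ i * ('X%:P) ^+ j)
   = \poly_(i < m) \poly_(j < n) c i j.
  rewrite !poly_def; apply: eq_bigr => a _; rewrite poly_def scaler_suml; apply: eq_bigr => b _.
  rewrite -!mul_polyC -polyC_exp polyCM /ff /=; ring.
by rewrite coef_poly im coef_poly jn.
Qed.

(** One substitution is computed twice on the polynomial of [polarize_expand]: inside V_4 and V_n it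
    gives the left side, on V_L through [polarize_subst] the right side. The power of x w - y z is
    unchanged because the determinant is 1. *)
Lemma intertwine (M : 'M[F]_2) n L s k p q : \det M = 1 ->
    (s <= 4)%N -> (L + 4 = n + 2 * s)%N -> (k <= L)%N -> (p <= 4)%N -> (q <= n)%N ->
  \sum_(i < 5) \sum_(j < n.+1 | (j + i + s == k + 4)%N)
     ((Anum n (s%:Z - 2) k)`_i)%:~R * subst_coef M 4 p i * subst_coef M n q j
  = \sum_(k' < L.+1 | (q + p + s == k' + 4)%N)
     subst_coef M L k' k * ((Anum n (s%:Z - 2) k')`_p)%:~R.
Proof.
move=> dM s4 EL kL p4 qn.
(* Setting y = w = 1 loses nothing, because all forms are homogeneous separately in (x, y) and in
   (z, w). *)
pose x : {poly {poly F}} := 'X; pose z : {poly {poly F}} := ('X)%:P.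
have dM' : ff (M 0 0) * ff (M 1 1) - ff (M 0 1) * ff (M 1 0) = 1.
  by rewrite -!rmorphM -rmorphB/= -det_mx2 dM.
pose lin u i := ff (M i 0) * u + ff (M i 1) * 1.
(* A zero linear form would be a zero row of [M]. The nonvanishing lets [polarize_expand] be applied
   to the transformed variables. *)
have lin0 i : lin z i != 0.
  have E : lin z i = (M i 0 *: 'X + (M i 1)%:P)%:P.
    by rewrite /lin mulr1 polyCD -mul_polyC polyCM.
  rewrite E polyC_eq0; apply/eqP => E0.
  have c1 : M i 0 = 0.
    by have /(congr1 (fun P : {poly F} => P`_1)) := E0; rewrite coefD coefZ coefX coefC coef0 /= mulr1 addr0.
  have c0 : M i 1 = 0.
    by have /(congr1 (fun P : {poly F} => P`_0)) := E0; rewrite coefD coefZ coefX coefC coef0 /= mulr0 add0r.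
  have := oner_neq0 F; rewrite -dM det_mx2.
  have [/eqP|/eqP] : i == 0 \/ i == 1 by case: i c1 c0 {E E0} => [[|[|[]]]] // *; [left|right].
    by move=> i0; subst i; rewrite c1 c0 !mul0r subr0 eqxx.
  by move=> i0; subst i; rewrite c1 c0 !mulr0 subr0 eqxx.
have lin_det : lin x 0 * lin z 1 - lin x 1 * lin z 0 = x * 1 - 1 * z.
  transitivity ((ff (M 0 0) * ff (M 1 1) - ff (M 0 1) * ff (M 1 0)) * (x - z)).
    by rewrite /lin; ring.
  by rewrite dM'; ring.
have key := polarize_subst ff M s x 1 z 1 kL.
have /(congr1 (fun u => s`!%:R * u * (x * 1 - 1 * z) ^+ (4 - s))) := key.
rewrite -{1}lin_det.
rewrite -/(lin x 0) -/(lin x 1) -/(lin z 0) -/(lin z 1).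
rewrite (polarize_expand _ _ (lin0 0) (lin0 1) s4 EL kL).
have z0 : z != 0 by rewrite polyC_eq0 polyX_eq0.
have sg : (-1) ^+ s != 0 :> {poly {poly F}} by rewrite signr_eq0.
have -> : s`!%:R * (\sum_(k' < L.+1) ff (subst_coef M L k' k) * polarize s L k' x 1 z 1) *
    (x * 1 - 1 * z) ^+ (4 - s) =
  (-1) ^+ s * \sum_(k' < L.+1) ff (subst_coef M L k' k) *
   (\sum_(i < 5) \sum_(j < n.+1 | (j + i + s == k' + 4)%N)
      ((Anum n (s%:Z - 2) k')`_i)%:~R * (x ^+ i * 1 ^+ (4 - i)) * (z ^+ j * 1 ^+ (n - j))).
  rewrite mulr_sumr mulr_suml mulr_sumr; apply: eq_bigr => k' _.
  have k'L : (k' <= L)%N by rewrite -ltnS.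
  rewrite [RHS]mulrCA -(polarize_expand x 1 z0 (oner_neq0 _) s4 EL k'L); ring.
move/(mulfI sg) => E.
pose c1 i' j' := \sum_(i < 5) \sum_(j < n.+1 | (j + i + s == k + 4)%N)
     ((Anum n (s%:Z - 2) k)`_i)%:~R * subst_coef M 4 i' i * subst_coef M n j' j.
pose c2 p q := \sum_(k' < L.+1 | (q + p + s == k' + 4)%N)
     subst_coef M L k' k * ((Anum n (s%:Z - 2) k')`_p)%:~R.
suff Ec : \sum_(i < 5) \sum_(j < n.+1) ff (c1 i j) * ('X ^+ i * ('X%:P) ^+ j)
   = \sum_(i < 5) \sum_(j < n.+1) ff (c2 i j) * ('X ^+ i * ('X%:P) ^+ j).
  have p5 : (p < 5)%N by [].
  have qn1 : (q < n.+1)%N by [].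
  by move/(congr1 (fun u : {poly {poly F}} => u`_p`_q)): Ec; rewrite !coef2_sum.
transitivity (\sum_(i < 5)
        \sum_(j < n.+1 | (j + i + s == k + 4)%N)
            ((Anum n (s%:Z - 2) k)`_i)%:~R *
            (lin x 0 ^+ i * lin x 1 ^+ (4 - i)) *
            (lin z 0 ^+ j * lin z 1 ^+ (n - j))).
  under eq_bigr => i' _ do under eq_bigr => j' _ do
    (rewrite rmorph_sum mulr_suml; under eq_bigr => i _ do rewrite rmorph_sum mulr_suml).
  under eq_bigr do rewrite exchange_big.
  rewrite exchange_big; apply: eq_bigr => i _.
  under eq_bigr do rewrite exchange_big.
  rewrite exchange_big; apply: eq_bigr => j _.
  have i4 : (i <= 4)%N by rewrite -ltnS.
  have jn : (j <= n)%N by rewrite -ltnS.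
  rewrite /lin (subst_coef_expand ff x 1 M i4) (subst_coef_expand ff z 1 M jn).
  rewrite -mulrA mulr_suml mulr_sumr; apply: eq_bigr => i' _.
  rewrite [X in _ = _ * X]mulr_sumr mulr_sumr; apply: eq_bigr => j' _.
  by rewrite !expr1n !rmorphM rmorph_int; ring.
rewrite E.
under eq_bigr do (rewrite mulr_sumr; under eq_bigr do rewrite big_mkcond mulr_sumr).
rewrite exchange_big; apply: eq_bigr => i' _.
rewrite exchange_big; apply: eq_bigr => j' _.
rewrite rmorph_sum mulr_suml [RHS]big_mkcond; apply: eq_bigr => k' _ /=.
case: ifP => _; last by rewrite mulr0.
by rewrite !expr1n rmorphM rmorph_int; ring.
Qed.
End Intertwiner.

(** * Clebsch-Gordan expansion of products of matrix coefficients *)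

Section ClebschGordan.
Variable R : realType.
Local Notation C := R[i].
Local Notation ms := ([:: -2; -1; 0; 1; 2] : seq int).

(** For l at least 2 no denominator vanishes and this is an identity of rational functions. For l =
    0 and l = 1 some V_(2l+2m) are missing and B is 0 by convention there, so these cases are
    checked value by value. *)
Lemma BA_sum (l q : nat) r i : (q <= 2 * l)%N -> (r <= 4)%N -> (i <= 4)%N ->
  \sum_(m <- ms) Bcoef R l m q r *
     (((Anum (2 * l%:Z) m (q%:Z + r%:Z + m - 2))`_i)%:~R / (Aden (2 * l%:Z) m)%:~R)
  = (i == r)%:R.
Proof.
move=> ql r4 i4; rewrite !big_cons big_nil /Bcoef.
case: l ql => [|[|n]] ql.
- have -> : q = 0%N by lia.
  case: (nat_le4 r4) => [||| []] ?; subst r;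
  case: (nat_le4 i4) => [||| []] ?; subst i; rewrite /excluded /Bnum /Bden /Anum /Aden /=; rewrite ?mul0r; field => //.
- have q3 : (q < 3)%N by lia.
  case: q q3 {ql} => [|[|[|q]]] // _;
  case: (nat_le4 r4) => [||| []] ?; subst r;
  case: (nat_le4 i4) => [||| []] ?; subst i; rewrite /excluded /Bnum /Bden /Anum /Aden /= ?mul0r; field => //.
have -> m : excluded n.+2 m = false by rewrite /excluded; lia.
have h0 : 2 + n%:R != 0 :> C by rewrite -natrD pnatr_eq0; lia.
have h a : 2 * (2 + n%:R) + a%:R != 0 :> C by rewrite -natrD -natrM -natrD pnatr_eq0; lia.
have h1 : 2 * (2 + n%:R) - 1 != 0 :> C.
  by have -> : 2 * (2 + n%:R) - 1 = (2 * n + 3)%:R :> C by [ring]; rewrite pnatr_eq0; lia.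
have h2 : 2 * (2 + n%:R) - 2 != 0 :> C.
  by have -> : 2 * (2 + n%:R) - 2 = (2 * n + 2)%:R :> C by [ring]; rewrite pnatr_eq0; lia.
by case: (nat_le4 r4) => [||| []] ?; subst r;
case: (nat_le4 i4) => [||| []] ?; subst i; rewrite /Bnum /Bden /Anum /Aden /=; field;
rewrite ?h0 ?h ?h1 ?h2 ?(h 1).
Qed.

Lemma Aden_neq0 (l : nat) (m : int) : m \in ms -> excluded l m = false ->
  (Aden (2 * l%:Z) m)%:~R != 0 :> C.
Proof.
rewrite intr_eq0 !inE /excluded /Aden => /orP[|/orP[|/orP[|/orP[|]]]] /eqP -> /=; rewrite ?mulf_eq0; lia.
Qed.

(* subst_coef extended by 0, so that sums over V_(2l+2m) need no boundary cases. *)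
Definition wcoef (M : 'M[C]_2) (L p q : int) : C :=
  if [&& 0 <= p, p <= L, 0 <= q & q <= L] then subst_coef M `|L|%N `|p|%N `|q|%N else 0.

(** The condition puts [q] at a distance [d < 4] from 0 or from 2l, and a factor of B vanishes
    there. *)
Lemma B_out (l q r : nat) (m : int) : (q <= 2 * l)%N -> (r <= 4)%N -> m \in ms ->
  ~~ (0 <= q%:Z + r%:Z + m - 2 <= 2 * l%:Z + 2 * m) -> Bcoef R l m q r = 0.
Proof.
move=> ql r4 mm h; rewrite /Bcoef; case: ifP => // ex.
suff -> : (Bnum (2 * l%:Z) m q)`_r = 0 by rewrite mul0r.
have h' : (q%:Z + r%:Z + m < 2) || (2 * l%:Z + m < q%:Z + r%:Z - 2) by lia.
have [d [eq|eq]] : exists d : nat, q = d /\ (d%:Z + r%:Z + m < 2) \/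
   (q%:Z = 2 * l%:Z - d%:Z) /\ (d%:Z + 2 + m < r%:Z).
  case/orP: h' => ?; first by exists q; left.
  by exists (2 * l - q)%N; right; lia.
all: case: eq => eq; move: mm ex; rewrite !inE => /orP[|/orP[|/orP[|/orP[|]]]] /eqP -> ex; 
  case: (nat_le4 r4) => [||| []] ?; subst r => hd; rewrite /Bnum ?eq /=; try lia.
all: move: d hd {h h'} eq => [|[|[|[|[|d]]]]] //= hd eq; rewrite ?eq; first [ring | lia].
Qed.

Lemma wcoefE (M : 'M[C]_2) (L p q : nat) : (p <= L)%N -> (q <= L)%N ->
  wcoef M L p q = subst_coef M L p q.
Proof. by move=> pL qL; rewrite /wcoef !lez_nat pL qL. Qed.

Lemma wcoef_out (M : 'M[C]_2) (L p q : int) :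
  ~~ [&& 0 <= p, p <= L, 0 <= q & q <= L] -> wcoef M L p q = 0.
Proof. by rewrite /wcoef => /negbTE ->. Qed.

(** This is [intertwine] weighted by B over the denominator of A. Each inner sum has at most one
    term, which [wcoef] expresses without boundary cases; an upper index outside the range is killed
    by B. *)
Lemma B_intertwine (M : 'M[C]_2) (l p q r r' : nat) (m : int) : \det M = 1 ->
    (p <= 2 * l)%N -> (q <= 2 * l)%N -> (r <= 4)%N -> (r' <= 4)%N -> m \in ms ->
  Bcoef R l m q r * Acoef R (2 * l%:Z) m (p%:Z + r'%:Z + m - 2) r'
     * wcoef M (2 * l%:Z + 2 * m) (p%:Z + r'%:Z + m - 2) (q%:Z + r%:Z + m - 2)
  = \sum_(i < 5) Bcoef R l m q r *
      (((Anum (2 * l%:Z) m (q%:Z + r%:Z + m - 2))`_i)%:~R / (Aden (2 * l%:Z) m)%:~R)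
      * subst_coef M 4 r' i * wcoef M (2 * l%:Z) p (q%:Z + r%:Z - i%:Z).
Proof.
move=> dM pl ql r4 r'4 mm.
have [ex|ex] := boolP (excluded l m).
  by rewrite /Bcoef ex !mul0r big1// => i _; rewrite !mul0r.
have [kr|kr] := boolP (0 <= q%:Z + r%:Z + m - 2 <= 2 * l%:Z + 2 * m); last first.
  by rewrite (B_out ql r4 mm kr) !mul0r big1// => i _; rewrite !mul0r.
have [s [s4 ms_]] : exists s : nat, (s <= 4)%N /\ m = s%:Z - 2.
  by exists (absz (m + 2)%R); move: mm; rewrite !inE => /orP[|/orP[|/orP[|/orP[|]]]] /eqP ->.
have [k kE] : exists k : nat, q%:Z + r%:Z + m - 2 = k by exists (absz (q%:Z + r%:Z + m - 2)%R); lia.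
have [L LE] : exists L : nat, 2 * l%:Z + 2 * m = L by exists (absz (2 * l%:Z + 2 * m)%R); lia.
have EL : (L + 4 = 2 * l + 2 * s)%N by lia.
have kL : (k <= L)%N by lia.
have d0 := Aden_neq0 mm (negbTE ex).
have := intertwine dM s4 EL kL r'4 pl.
rewrite -ms_ PoszM LE kE => E.
transitivity (Bcoef R l m q r / (Aden (2 * l%:Z) m)%:~R *
  \sum_(i < 5) \sum_(j < (2 * l).+1 | (j + i + s == k + 4)%N)
     ((Anum (2%:Z * l%:Z) m k)`_i)%:~R * subst_coef M 4 r' i * subst_coef M (2 * l) p j); last first.
  rewrite mulr_sumr; apply: eq_bigr => i _.
  have [h|h] := boolP ((k + 4 < s + i) || (2 * l + s + i < k + 4))%N.
    rewrite big1 ?mulr0; last by move=> j /eqP; have := ltn_ord j; lia.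
    rewrite wcoef_out ?mulr0//; lia.
  have jn : (k + 4 - (s + i) < (2 * l).+1)%N by lia.
  rewrite (big_pred1 (Ordinal jn)); last first.
    move=> j; apply/eqP/eqP => [e|-> /=]; last lia.
    by apply/val_inj => /=; lia.
  have -> : q%:Z + r%:Z - i%:Z = (k + 4 - (s + i))%N :> int by lia.
  by rewrite -PoszM wcoefE//= PoszM; field.
rewrite E; have [h|h] := boolP (0 <= p%:Z + r'%:Z + m - 2 <= L%:Z); last first.
  rewrite wcoef_out ?mulr0; last by apply: contra h => /and4P[-> ->].
  by rewrite big1 ?mulr0// => j /eqP; have := ltn_ord j; lia.
have jn : (p + r' + s - 4 < L.+1)%N by lia.
rewrite (big_pred1 (Ordinal jn)); last first.
  move=> j; apply/eqP/eqP => [e|-> /=]; last lia.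
  by apply/val_inj => /=; lia.
have -> : p%:Z + r'%:Z + m - 2 = (p + r' + s - 4)%N :> int by lia.
rewrite wcoefE//= /Acoef LE !lez_nat /= -ltnS jn.
by field.
Qed.

(** Sum [B_intertwine] over m and exchange the sums: by [BA_sum] only the term [i = r] survives.
    Allowing any integer p makes index shifts harmless at the ends. *)
Theorem clebsch_gordan (M : 'M[C]_2) (l q r r' : nat) (p : int) : \det M = 1 ->
    (q <= 2 * l)%N -> (r <= 4)%N -> (r' <= 4)%N ->
  subst_coef M 4 r' r * wcoef M (2 * l%:Z) p q
  = \sum_(m <- ms) Bcoef R l m q r * Acoef R (2 * l%:Z) m (p + r'%:Z + m - 2) r'
      * wcoef M (2 * l%:Z + 2 * m) (p + r'%:Z + m - 2) (q%:Z + r%:Z + m - 2).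
Proof.
move=> dM ql r4 r'4.
have [|pr] := boolP (0 <= p <= 2 * l%:Z); last first.
  rewrite wcoef_out ?mulr0; last by apply: contra pr => /and4P[-> ->].
  rewrite big_seq big1// => m mm.
  have [ex|ex] := boolP (excluded l m); first by rewrite /Bcoef ex !mul0r.
  rewrite /Acoef; case: ifP; last by rewrite mulr0 mul0r.
  move=> kr.
  have [s [s4 ms_]] : exists s : nat, (s <= 4)%N /\ m = s%:Z - 2.
    by exists (absz (m + 2)%R); move: mm; rewrite !inE => /orP[|/orP[|/orP[|/orP[|]]]] /eqP ->.
  have [k kE] : exists k : nat, p + r'%:Z + m - 2 = k by exists (absz (p + r'%:Z + m - 2)%R); lia.
  have [L LE] : exists L : nat, 2 * l%:Z + 2 * m = L by exists (absz (2 * l%:Z + 2 * m)%R); lia.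
  have EL : (L + 4 = 2 * l + 2 * s)%N by lia.
  have kL : (k <= L)%N by lia.
  (* Here [p] is out of range although the index of A is not, so the vanishing comes from the
     numerator. *)
  rewrite kE; have := Anum_out s4 r'4 EL kL; rewrite -ms_ PoszM => ->; last lia.
  by rewrite !mul0r mulr0 mul0r.
case: p => [p|//] /andP[_ pl].
have {}pl : (p <= 2 * l)%N by lia.
under [RHS]eq_big_seq => m mm do rewrite B_intertwine//.
rewrite exchange_big /=.
have r5 : (r < 5)%N by [].
rewrite (bigD1 (Ordinal r5))//= [X in _ = _ + X]big1 ?addr0; last first.
  move=> i /eqP ir; rewrite -!mulr_suml BA_sum//; last by rewrite -ltnS.
  case: eqP => [e|]; last by rewrite !mul0r.
  by case: ir; apply/val_inj.
by rewrite -!mulr_suml BA_sum// eqxx mul1r addrK.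
Qed.

(** The left-hand factors are those by which the so(3)-parts of X_1 and X_3 shift the index. At the
    middle weight of V_4 they form the mixed Casimir term, which is scalar on the component
    V_(2l+2m). *)
Lemma A_middle (l : nat) (m a : int) : m \in ms -> excluded l m = false ->
  - ((a%:~R + 1) / 2 * Acoef R (2 * l%:Z) m (a + m) 1)
    - (2 * l%:R - a%:~R + 1) / 2 * Acoef R (2 * l%:Z) m (a + m) 3
  = - 3^-1 * (l%:R * m%:~R - 3 + (m * (m + 1))%:~R / 2) * Acoef R (2 * l%:Z) m (a + m) 2.
Proof.
move=> mm ex; have d0 := Aden_neq0 mm ex; rewrite /Acoef.
case: ifP => _; last by rewrite !mulr0 subr0 oppr0.
move: (_%:~R) d0 => d d0.
by move: mm; rewrite !inE => /orP[|/orP[|/orP[|/orP[|]]]] /eqP ->; rewrite /Anum /=; field.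
Qed.

(** Exchanging (x, z) with (y, w) reverses all indices and negates x w - y z, whose exponent 4 - s =
    2 - m has the parity of m. *)
Lemma A_sym (l : nat) (m k : int) (i : nat) : m \in ms -> excluded l m = false -> (i <= 4)%N ->
  Acoef R (2 * l%:Z) m (2 * l%:Z + 2 * m - k) (4 - i)
  = (-1) ^+ `|m|%N * Acoef R (2 * l%:Z) m k i.
Proof.
move=> mm ex i4; have d0 := Aden_neq0 mm ex; rewrite /Acoef.
have -> : (0 <= 2 * l%:Z + 2 * m - k <= 2 * l%:Z + 2 * m) = (0 <= k <= 2 * l%:Z + 2 * m) by lia.
case: ifP => _; last by rewrite !mulr0.
move: (_%:~R) d0 => d d0.
by move: mm; rewrite !inE => /orP[|/orP[|/orP[|/orP[|]]]] /eqP ->;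
  case: (nat_le4 i4) => [||| []] ?; subst i; rewrite /Anum /=; field.
Qed.
End ClebschGordan.

(** * From coefficients to forms in two variables *)

Module BinaryFormFacts.
Import mpoly GRing.Theory BinaryForms.
Local Open Scope ring_scope.

Section BinaryFormFacts.
Variable F : fieldType.
Implicit Types M : 'M[F]_2.

Lemma mpoly_of_sum (I : Type) (r : seq I) (P : pred I) l (f : I -> form F l) :
  mpoly_of_dhomog (\sum_(i <- r | P i) f i) = \sum_(i <- r | P i) mpoly_of_dhomog (f i).
Proof. exact: (raddf_sum (mpoly_of_dhomog (n := 2) (R := F) (d := l))). Qed.

Lemma subst_monom M L q : (q <= L)%N ->
  subst (M 0 0) (M 0 1) (M 1 0) (M 1 1) (monom F L q)
  = \sum_(p < L.+1) subst_coef M L p q *: monom F L p.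
Proof.
move=> qL; apply: val_inj; rewrite /= mpoly_of_sum monomE//.
rewrite rmorphM !rmorphXn /= !comp_mpolyXU /= /lin -!mul_mpolyC.
rewrite (subst_coef_expand (@mpolyC 2 F))//; apply: eq_bigr => p _.
by rewrite monomE ?mul_mpolyC// -ltnS.
Qed.

(** The evaluation x = 'X, y = 1 sends the monomials to distinct powers. *)
Lemma monom_free L (c : 'I_L.+1 -> F) :
  \sum_(p < L.+1) c p *: monom F L p = 0 -> forall p, c p = 0.
Proof.
move=> E p; have := congr1 (fun f : form F L => mmap (@polyC F) (fun i : 'I_2 => if i == 0 then 'X else 1) (mpoly_of_dhomog f)) E.
rewrite mpoly_of_sum rmorph_sum /= mmap0.
under eq_bigr => i _.
  rewrite monomE; last by rewrite -ltnS.
  rewrite mmapZ rmorphM !rmorphXn /= !mmapX !mmap1U /= expr1n mulr1 mul_polyC.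
  over.
move=> /(congr1 (fun P : {poly F} => P`_p)); rewrite coef_sum coef0 (bigD1 p)//=.
rewrite coefZ coefXn eqxx mulr1 big1 ?addr0// => i /negbTE ip.
by rewrite coefZ coefXn eq_sym val_eqE ip mulr0.
Qed.

Definition substM M L (f : form F L) : form F L := subst (M 0 0) (M 0 1) (M 1 0) (M 1 1) f.

Lemma coord_monom L (c : nat -> F) (p : 'I_L.+1) :
  coord [tuple monom F L q | q < L.+1] p (\sum_(b < L.+1) c b *: monom F L b) = c p.
Proof.
rewrite -[RHS](coord_sum_free (X := [tuple monom F L q | q < L.+1]) (fun b : 'I_L.+1 => c b)).
  by congr (coord _ _ _); apply: eq_bigr => b _; rewrite -tnth_nth tnth_mktuple.
by apply/freeP => k; under eq_bigr do rewrite -tnth_nth tnth_mktuple; exact: monom_free.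
Qed.

Lemma substM_comp M M' L q : (q <= L)%N ->
  substM (M' *m M) (monom F L q) = \sum_(c < L.+1) subst_coef M' L c q *: substM M (monom F L c).
Proof.
move=> qL; rewrite /substM subst_monom//.
under [RHS]eq_bigr => i _.
  rewrite subst_monom; last by rewrite -ltnS.
  rewrite scaler_sumr; over.
rewrite exchange_big; apply: eq_bigr => b _ /=.
by rewrite subst_coefM// scaler_suml; apply: eq_bigr => c _; rewrite scalerA mulrC.
Qed.

(** Serves the second basis, the image of the monomials under tau(u_c). A linear relation among the
    images is undone by the coefficients of the inverse substitution. *)
Lemma coord_substM M L (c : nat -> F) (p : 'I_L.+1) : M \in unitmx ->
  coord [tuple substM M (monom F L q) | q < L.+1] p (\sum_(b < L.+1) c b *: substM M (monom F L b))
  = c p.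
Proof.
move=> uM; rewrite -[RHS](coord_sum_free (X := [tuple substM M (monom F L q) | q < L.+1]) (fun b : 'I_L.+1 => c b)).
  by congr (coord _ _ _); apply: eq_bigr => b _; rewrite -tnth_nth tnth_mktuple.
apply/freeP => k; under eq_bigr do rewrite -tnth_nth tnth_mktuple.
move=> E a.
have G (b : 'I_L.+1) : \sum_(a < L.+1) subst_coef M L b a * k a = 0.
  move: b; apply: (@monom_free L (fun b => \sum_(a < L.+1) subst_coef M L b a * k a)); rewrite -[RHS]E /=.
  under eq_bigr do rewrite scaler_suml.
  rewrite exchange_big; apply: eq_bigr => i _.
  rewrite /substM subst_monom; last by rewrite -ltnS.
  by rewrite scaler_sumr; apply: eq_bigr => b _; rewrite scalerA mulrC.
transitivity (\sum_(b < L.+1) subst_coef (invmx M) L a b * (\sum_(d < L.+1) subst_coef M L b d * k d)).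
  transitivity (\sum_(d < L.+1) (a == d)%:R * k d).
    rewrite (bigD1 a)//= eqxx mul1r big1 ?addr0// => i ia.
    by rewrite eq_sym (negbTE ia) mul0r.
  under [RHS]eq_bigr do rewrite mulr_sumr.
  rewrite exchange_big; apply: eq_bigr => d _.
  have dL : (d <= L)%N by rewrite -ltnS.
  under eq_bigr do rewrite mulrA.
  by rewrite -mulr_suml -subst_coefM// mulmxV// subst_coef1.
by rewrite big1// => b _; rewrite G mulr0.
Qed.

End BinaryFormFacts.
End BinaryFormFacts.

From mathcomp Require Import all_classical all_reals all_analysis.
Import numFieldNormedType.Exports.
Local Open Scope classical_set_scope.
Local Open Scope ring_scope.
Local Open Scope complex_scope.

(** * The double covering of SO(3) *)

Lemma ord2P (P : 'I_2 -> Prop) : P 0 -> P 1 -> forall i, P i.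
Proof.
move=> p0 p1 [[|[|//]] i]; first by move: p0; congr P; apply/val_inj.
by move: p1; congr P; apply/val_inj.
Qed.

Lemma ord3P (P : 'I_3 -> Prop) : P 0 -> P 1 -> P 2 -> forall i, P i.
Proof.
move=> p0 p1 p2 [[|[|[|//]]] i]; [move: p0|move: p1|move: p2]; congr P; exact/val_inj.
Qed.

Section Rows.
Variable T : nmodType.

Lemma rows2E (s : seq (seq T)) : [/\ rows 2 s 0 0 = (nth [::] s 0)`_0,
  rows 2 s 0 1 = (nth [::] s 0)`_1, rows 2 s 1 0 = (nth [::] s 1)`_0
  & rows 2 s 1 1 = (nth [::] s 1)`_1].
Proof. by rewrite !mxE. Qed.

Lemma matrix2P (A B : 'M[T]_2) : A 0 0 = B 0 0 -> A 0 1 = B 0 1 -> A 1 0 = B 1 0 ->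
  A 1 1 = B 1 1 -> A = B.
Proof. by move=> *; apply/matrixP; do 2 apply: ord2P. Qed.

Lemma matrix3P (A B : 'M[T]_3) :
  [/\ A 0 0 = B 0 0, A 0 1 = B 0 1 & A 0 2 = B 0 2] ->
  [/\ A 1 0 = B 1 0, A 1 1 = B 1 1 & A 1 2 = B 1 2] ->
  [/\ A 2 0 = B 2 0, A 2 1 = B 2 1 & A 2 2 = B 2 2] -> A = B.
Proof. by move=> [? ? ?] [? ? ?] [? ? ?]; apply/matrixP; do 2 apply: ord3P. Qed.

End Rows.

Lemma sum2E (V : nmodType) (F : 'I_2 -> V) : \sum_i F i = F 0 + F 1.
Proof. by rewrite !big_ord_recl big_ord0 addr0; congr (_ + F _); apply/val_inj. Qed.

Lemma sum3E (V : nmodType) (F : 'I_3 -> V) : \sum_i F i = F 0 + F 1 + F 2.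
Proof.
by rewrite !big_ord_recl big_ord0 addr0 addrA; congr (_ + F _ + F _); apply/val_inj.
Qed.

Lemma det_mx3 (R : comNzRingType) (A : 'M[R]_3) : \det A =
  A 0 0 * (A 1 1 * A 2 2 - A 1 2 * A 2 1) - A 0 1 * (A 1 0 * A 2 2 - A 1 2 * A 2 0)
  + A 0 2 * (A 1 0 * A 2 1 - A 1 1 * A 2 0).
Proof.
rewrite (expand_det_row _ 0) sum3E /cofactor !det_mx2 !mxE.
have e00 : lift 0 0 = 1 :> 'I_3 by apply/val_inj.
have e01 : lift 0 1 = 2 :> 'I_3 by apply/val_inj.
have e10 : lift 1 0 = 0 :> 'I_3 by apply/val_inj.
have e11 : lift 1 1 = 2 :> 'I_3 by apply/val_inj.
have e20 : lift 2 0 = 0 :> 'I_3 by apply/val_inj.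
have e21 : lift 2 1 = 1 :> 'I_3 by apply/val_inj.
by rewrite e00 e01 e10 e11 e20 e21 /=; ring.
Qed.

Section Quaternions.
Variable R : realType.
Local Notation C := R[i].

(** Unit quaternions parametrize SU(2), so statements about [phi] become real polynomial identities
    in p, q, r, s. *)
Definition quat (p q r s : R) : 'M[C]_2 :=
  rows 2 [:: [:: p +i* q; r +i* s]; [:: (- r) +i* s; p +i* (- q)]].

Lemma quatE p q r s : [/\ quat p q r s 0 0 = p +i* q, quat p q r s 0 1 = r +i* s,
  quat p q r s 1 0 = (- r) +i* s & quat p q r s 1 1 = p +i* (- q)].
Proof. exact: rows2E. Qed.

Lemma quatM p q r s p' q' r' s' : quat p q r s *m quat p' q' r' s' =
  quat (p * p' - q * q' - r * r' - s * s') (p * q' + q * p' + r * s' - s * r')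
       (p * r' - q * s' + r * p' + s * q') (p * s' + q * r' - r * q' + s * p').
Proof.
have [e1 e2 e3 e4] := quatE p q r s; have [f1 f2 f3 f4] := quatE p' q' r' s'.
by apply: matrix2P; rewrite mxE sum2E ?e1 ?e2 ?e3 ?e4 ?f1 ?f2 ?f3 ?f4 !mxE /=; simpc;
  congr (_ +i* _); ring.
Qed.

Lemma quat1 : quat 1 0 0 0 = 1%:M.
Proof. by apply: matrix2P; rewrite !mxE /= ?oppr0. Qed.

Lemma quat_inv p q r s : p ^+ 2 + q ^+ 2 + r ^+ 2 + s ^+ 2 = 1 ->
  invmx (quat p q r s) = quat p (- q) (- r) (- s).
Proof.
move=> n1; have E : quat p q r s *m quat p (- q) (- r) (- s) = 1%:M.
  by rewrite quatM -quat1 -n1; congr quat; ring.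
have [U _] := mulmx1_unit E.
by rewrite -[RHS]mul1mx -(mulVmx U) -mulmxA E mulmx1.
Qed.

Lemma quat_SU2 p q r s : p ^+ 2 + q ^+ 2 + r ^+ 2 + s ^+ 2 = 1 -> SU2 (quat p q r s).
Proof.
move=> n1; split.
  have -> : (map_mx (@conjc R) (quat p q r s))^T = quat p (- q) (- r) (- s).
    by apply: matrix2P; rewrite !mxE /= ?opprK.
  by rewrite quatM -quat1 -n1; congr quat; ring.
have [e1 e2 e3 e4] := quatE p q r s.
rewrite det_mx2 e1 e2 e3 e4; simpc; rewrite -[RHS]/(1 +i* 0) -n1; congr (_ +i* _); ring.
Qed.

Lemma SU2_quat (u : 'M[C]_2) : SU2 u ->
  exists p q r s : R, p ^+ 2 + q ^+ 2 + r ^+ 2 + s ^+ 2 = 1 /\ u = quat p q r s.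
Proof.
move=> [uu du].
have := congr1 (fun M : 'M[C]_2 => (M 0 0, M 1 0)) uu.
rewrite det_mx2 in du.
rewrite !mxE !sum2E !mxE /=.
case E0 : (u 0 0) => [p q]; case E1 : (u 0 1) => [r s].
rewrite -!E0 -!E1 => -[n0 n1].
exists p, q, r, s.
have n0' : p ^+ 2 + q ^+ 2 + r ^+ 2 + s ^+ 2 = 1.
  move: n0; rewrite E0 E1 /=; simpc => /(congr1 (@complex.Re R)) /= <-; ring.
split=> //.
have h0 : u 1 1 = conjc (u 0 0).
  transitivity ((u 0 0 * conjc (u 0 0) + u 0 1 * conjc (u 0 1)) * u 1 1
     - u 0 1 * (u 1 0 * conjc (u 0 0) + u 1 1 * conjc (u 0 1))).
    by rewrite n0 n1 mulr0 subr0 mul1r.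
  by rewrite -[RHS]mulr1 -du; ring.
have h1 : u 1 0 = - conjc (u 0 1).
  transitivity ((u 0 0 * conjc (u 0 0) + u 0 1 * conjc (u 0 1)) * u 1 0
     - u 0 0 * (u 1 0 * conjc (u 0 0) + u 1 1 * conjc (u 0 1))).
    by rewrite n0 n1 mulr0 subr0 mul1r.
  by rewrite -[RHS]mulr1 -du; ring.
apply: matrix2P; rewrite ?h0 ?h1 ?E0 ?E1 mxE //=.
by simpc.
Qed.

Lemma phi_quat p q r s : phi (quat p q r s) = rows 3 [::
    [:: p^+2 + q^+2 - r^+2 - s^+2; - 2 * (p * s - q * r); 2 * (p * r + q * s)];
    [:: 2 * (p * s + q * r); p^+2 - q^+2 + r^+2 - s^+2; - 2 * (p * q - r * s)];
    [:: - 2 * (p * r - q * s); 2 * (p * q + r * s); p^+2 - q^+2 - r^+2 + s^+2]].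
Proof. by have [e1 e2 e3 e4] := quatE p q r s; rewrite /phi e1 e2. Qed.

Lemma phiM p q r s p' q' r' s' :
  phi (quat p q r s *m quat p' q' r' s') = phi (quat p q r s) *m phi (quat p' q' r' s').
Proof.
rewrite quatM !phi_quat; apply: matrix3P; split; rewrite [RHS]mxE sum3E !mxE /=; ring.
Qed.

Lemma phi_SO3 p q r s : p ^+ 2 + q ^+ 2 + r ^+ 2 + s ^+ 2 = 1 -> SO3 (phi (quat p q r s)).
Proof.
move=> n1; have p2 : p ^+ 2 = 1 - q ^+ 2 - r ^+ 2 - s ^+ 2 by rewrite -n1; ring.
split.
  have -> : (phi (quat p q r s))^T = phi (quat p (- q) (- r) (- s)).
    by rewrite !phi_quat; apply: matrix3P; split; rewrite !mxE /=; ring.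
  rewrite -phiM quatM phi_quat; apply: matrix3P; split; rewrite !mxE /= ?mulr1n ?mulr0n; ring: p2.
rewrite det_mx3 phi_quat !mxE /=; ring: p2.
Qed.

End Quaternions.

Section SO3Cover.
Variable R : realType.
Local Notation C := R[i].
Implicit Types x : 'M[R]_3.

Lemma SO3_mul x y : SO3 x -> SO3 y -> SO3 (x *m y).
Proof.
move=> [xx dx] [yy dy]; split; last by rewrite det_mulmx dx dy mulr1.
by rewrite trmx_mul mulmxA -(mulmxA x) yy mulmx1.
Qed.

Lemma SO3_trVmul x : SO3 x -> x^T *m x = 1%:M.
Proof. by move=> [/mulmx1C]. Qed.

Lemma SO3_tr x : SO3 x -> SO3 x^T.
Proof. by move=> xS; split; [rewrite trmxK SO3_trVmul | rewrite det_tr; case: xS]. Qed.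

Lemma half_angle (a b : R) : a ^+ 2 + b ^+ 2 = 1 ->
  exists p q : R, [/\ p ^+ 2 + q ^+ 2 = 1, p ^+ 2 - q ^+ 2 = a & 2 * (p * q) = b].
Proof.
(* At a = -1 the half angle has cosine p = 0, and the formula b / (2 p) for its sine breaks down. *)
move=> ab; have [a1|a1] := eqVneq a (-1).
  exists 0, 1; rewrite a1; split; rewrite ?expr0n ?expr1n /= ?add0r//.
  have /eqP : b ^+ 2 = 0 by move: ab; rewrite a1 sqrrN expr1n => /(canRL (addKr _)); rewrite addNr.
  by rewrite expf_eq0 /= => /eqP ->; rewrite mul0r mulr0.
have a1' : 0 < (1 + a) / 2.
  rewrite divr_gt0// lt_neqAle eq_sym addrC addr_eq0 a1 /= -lerBlDr sub0r.
  have : a ^+ 2 <= 1 by rewrite -ab lerDl sqr_ge0.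
  by rewrite -ler_sqrt// sqrtr1 sqrtr_sqr ler_norml => /andP[].
set p := Num.sqrt ((1 + a) / 2).
have p0 : p != 0 by rewrite sqrtr_eq0 -ltNge.
have pp : p ^+ 2 = (1 + a) / 2 by rewrite sqr_sqrtr// ltW.
have a1n : 1 + a != 0 by rewrite addrC addr_eq0.
have qq : (b / (2 * p)) ^+ 2 = (1 - a) / 2.
  rewrite expr_div_n exprMn pp.
  have -> : b ^+ 2 = 1 - a ^+ 2 by rewrite -ab; ring.
  by field.
by exists p, (b / (2 * p)); split; rewrite ?qq ?pp; field.
Qed.

(** The rotation about an axis orthogonal to the first one that carries the first axis to (a, b, c).
    Its quaternion has q = 0, and the three right-hand sides are the first column of its image under
    [phi]. *)
Lemma axis_rotation (a b c : R) : a ^+ 2 + b ^+ 2 + c ^+ 2 = 1 ->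
  exists p r s : R, [/\ p ^+ 2 + r ^+ 2 + s ^+ 2 = 1, p ^+ 2 - r ^+ 2 - s ^+ 2 = a,
    2 * (p * s) = b & - 2 * (p * r) = c].
Proof.
move=> abc; have [a1|a1] := eqVneq a (-1).
  have bc : b ^+ 2 + c ^+ 2 = 0.
    by move: abc; rewrite a1 sqrrN expr1n -addrA => /(canRL (addKr _)); rewrite addNr.
  move/eqP: bc; rewrite paddr_eq0 ?sqr_ge0// !expf_eq0 /= => /andP[/eqP -> /eqP ->].
  by exists 0, 1, 0; rewrite a1; split; rewrite ?mulr0 ?mul0r ?mulr0 ?expr0n ?expr1n /= ?add0r ?addr0 ?subr0.
have a1' : 0 < (1 + a) / 2.
  rewrite divr_gt0// lt_neqAle eq_sym addrC addr_eq0 a1 /= -lerBlDr sub0r.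
  have : a ^+ 2 <= 1 by rewrite -abc -addrA lerDl addr_ge0 ?sqr_ge0.
  by rewrite -ler_sqrt// sqrtr1 sqrtr_sqr ler_norml => /andP[].
set p := Num.sqrt ((1 + a) / 2).
have p0 : p != 0 by rewrite sqrtr_eq0 -ltNge.
have pp : p ^+ 2 = (1 + a) / 2 by rewrite sqr_sqrtr// ltW.
have a1n : 1 + a != 0 by rewrite addrC addr_eq0.
have qq : (- c / (2 * p)) ^+ 2 + (b / (2 * p)) ^+ 2 = (1 - a) / 2.
  rewrite !expr_div_n sqrrN exprMn pp -mulrDl.
  have -> : c ^+ 2 + b ^+ 2 = 1 - a ^+ 2 by rewrite -abc; ring.
  by field.
exists p, (- c / (2 * p)), (b / (2 * p)); split.
- by rewrite -addrA qq pp; field.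
- by rewrite -addrA -opprD qq pp; field.
- by field.
- by field.
Qed.

(** Split off a rotation with the same first column as x. The quotient fixes the first axis, hence
    is a plane rotation, lifted by its half angle. *)
Lemma phi_surj x : SO3 x -> exists p q r s : R,
  p ^+ 2 + q ^+ 2 + r ^+ 2 + s ^+ 2 = 1 /\ phi (quat p q r s) = x.
Proof.
move=> xS.
have c1 : x 0 0 ^+ 2 + x 1 0 ^+ 2 + x 2 0 ^+ 2 = 1.
  by have /matrixP/(_ 0 0) := SO3_trVmul xS; rewrite !mxE sum3E !mxE /= ?mulr1n => <-; ring.
have [p [r [s [n1 e0 e1 e2]]]] := axis_rotation c1.
have n1' : p ^+ 2 + 0 ^+ 2 + r ^+ 2 + s ^+ 2 = 1 by rewrite -n1; ring.
set g := phi (quat p 0 r s); have gS : SO3 g := phi_SO3 n1'.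
have gx i : x i 0 = g i 0.
  rewrite /g phi_quat; move: i; apply: ord3P; rewrite !mxE /= -?e0 -?e1 -?e2; ring.
have [y yD] : exists y, y = g^T *m x by exists (g^T *m x).
have yS : SO3 y by rewrite yD; exact: SO3_mul (SO3_tr gS) xS.
have y0 i : y i 0 = (i == 0)%:R.
  have /matrixP/(_ i 0) := SO3_trVmul gS; rewrite yD !mxE => <-; apply: eq_bigr => j _.
  by rewrite gx.
have y00 : y 0 0 = 1 by rewrite y0.
have y10 : y 1 0 = 0 by rewrite y0.
have y20 : y 2 0 = 0 by rewrite y0.
have yyT := yS.1; have yTy := SO3_trVmul yS.
have y01 : y 0 1 = 0.
  by have /matrixP/(_ 0 1) := yTy; rewrite !mxE sum3E !mxE y00 y10 y20 !mul0r !addr0 mul1r.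
have y02 : y 0 2 = 0.
  by have /matrixP/(_ 0 2) := yTy; rewrite !mxE sum3E !mxE y00 y10 y20 !mul0r !addr0 mul1r.
have dy := yS.2; rewrite det_mx3 y00 y01 y02 y10 y20 in dy.
have d1 : y 1 1 * y 2 2 - y 1 2 * y 2 1 = 1 by rewrite -dy; ring.
have k11 : y 1 1 ^+ 2 + y 2 1 ^+ 2 = 1.
  by have /matrixP/(_ 1 1) := yTy; rewrite !mxE sum3E !mxE y01 /= ?mulr1n => <-; ring.
have k12 : y 1 1 * y 1 2 + y 2 1 * y 2 2 = 0.
  by have /matrixP/(_ 1 2) := yTy; rewrite !mxE sum3E !mxE y01 y02 /= ?mulr0n => h; rewrite -[RHS]h; ring.
have y22 : y 2 2 = y 1 1.
  transitivity ((y 1 1 ^+ 2 + y 2 1 ^+ 2) * y 2 2); first by rewrite k11 mul1r.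
  transitivity (y 1 1 * (y 1 1 * y 2 2 - y 1 2 * y 2 1) + y 2 1 * (y 1 1 * y 1 2 + y 2 1 * y 2 2)); first ring.
  by rewrite d1 k12; ring.
have y12 : y 1 2 = - y 2 1.
  transitivity ((y 1 1 ^+ 2 + y 2 1 ^+ 2) * y 1 2); first by rewrite k11 mul1r.
  transitivity (y 1 1 * (y 1 1 * y 1 2 + y 2 1 * y 2 2) - y 2 1 * (y 1 1 * y 2 2 - y 1 2 * y 2 1)); first ring.
  by rewrite d1 k12; ring.
have [p' [q' [n2 f1 f2]]] := half_angle k11.
have n2' : p' ^+ 2 + q' ^+ 2 + 0 ^+ 2 + 0 ^+ 2 = 1 by rewrite -n2; ring.
have yE : phi (quat p' q' 0 0) = y.
  rewrite phi_quat; apply: matrix3P; split; rewrite ?y00 ?y01 ?y02 ?y10 ?y20 ?y12 ?y22 -?f1 -?f2 !mxE /= -?n2; ring.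
have xE : x = phi (quat p 0 r s *m quat p' q' 0 0).
  by rewrite phiM yE yD mulmxA gS.1 mul1mx.
rewrite xE quatM; do 4 eexists; split; last reflexivity.
rewrite -[RHS]mulr1 -{1}n1' -n2'; ring.
Qed.

Lemma phi_inj (p q r s p' q' r' s' : R) :
    p ^+ 2 + q ^+ 2 + r ^+ 2 + s ^+ 2 = 1 -> p' ^+ 2 + q' ^+ 2 + r' ^+ 2 + s' ^+ 2 = 1 ->
    phi (quat p q r s) = phi (quat p' q' r' s') ->
  quat p' q' r' s' = quat p q r s \/ quat p' q' r' s' = - quat p q r s.
Proof.
move=> n1 n1' E.
have n2 : p ^+ 2 + (- q) ^+ 2 + (- r) ^+ 2 + (- s) ^+ 2 = 1 by rewrite -n1; ring.
have trE : phi (quat p (- q) (- r) (- s)) = (phi (quat p q r s))^T.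
  by rewrite !phi_quat; apply: matrix3P; split; rewrite !mxE /=; ring.
have EP : phi (quat p (- q) (- r) (- s) *m quat p' q' r' s') = 1%:M.
  by rewrite phiM trE -E SO3_trVmul//; exact: phi_SO3.
have uu : quat p q r s *m quat p (- q) (- r) (- s) = 1%:M.
  by rewrite quatM -quat1 -n1; congr quat; ring.
have vE : quat p' q' r' s' = quat p q r s *m (quat p (- q) (- r) (- s) *m quat p' q' r' s').
  by rewrite mulmxA uu mul1mx.
rewrite {}vE; move: EP; rewrite quatM.
have : (p * p' - - q * q' - - r * r' - - s * s') ^+ 2 + (p * q' + - q * p' + - r * s' - - s * r') ^+ 2
  + (p * r' - - q * s' + - r * p' + - s * q') ^+ 2 + (p * s' + - q * r' - - r * q' + - s * p') ^+ 2 = 1.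
  by rewrite -[RHS]mulr1 -{1}n1 -n1'; ring.
move: (_ - - s * s') (_ - - s * r') (_ + - s * q') (_ + - s * p') => a b c d nn.
rewrite phi_quat => F.
(* Two diagonal entries equal to 1, together with norm one, force b = c = d = 0. *)
have /matrixP/(_ 0 0) := F; rewrite !mxE /= mulr1n => F0.
have /matrixP/(_ 1 1) := F; rewrite !mxE /= mulr1n => F1.
have cd : c ^+ 2 + d ^+ 2 = 0 by lra.
have b0 : b ^+ 2 + d ^+ 2 = 0 by lra.
move/eqP: cd; rewrite paddr_eq0 ?sqr_ge0// !expf_eq0 /= => /andP[/eqP c0 /eqP d0].
move/eqP: b0; rewrite paddr_eq0 ?sqr_ge0// !expf_eq0 /= => /andP[/eqP b0 _].
have /eqP : a ^+ 2 = 1 by move: F0; rewrite b0 c0 d0 !expr0n /= !subr0 addr0.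
rewrite -{1}(expr1n _ 2) eqf_sqr b0 c0 d0 => /orP[] /eqP ->; [left|right].
  by rewrite quat1 mulmx1.
have -> : @quat R (- 1) 0 0 0 = - 1%:M.
  by apply: matrix2P; rewrite !mxE /=; simpc.
by rewrite mulmxN mulmx1.
Qed.

(** The very term chosen inside [tauK], so that one folds into the other. *)
Definition su2_lift (x : 'M[R]_3) : 'M[C]_2 := xget 1%:M [set u | SU2 u /\ phi u = x].

Lemma su2_liftP x : SO3 x -> SU2 (su2_lift x) /\ phi (su2_lift x) = x.
Proof.
move=> /phi_surj [p [q [r [s [n1 E]]]]].
apply: (@xgetPex _ 1%:M [set u : 'M[C]_2 | SU2 u /\ phi u = x]).
by exists (quat p q r s); split => //; exact: quat_SU2.
Qed.

Lemma SU2_mul (u v : 'M[C]_2) : SU2 u -> SU2 v -> SU2 (u *m v).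
Proof.
move=> /SU2_quat[p [q [r [s [n1 ->]]]]] /SU2_quat[p' [q' [r' [s' [n1' ->]]]]].
by rewrite quatM; apply: quat_SU2; rewrite -[RHS]mulr1 -{1}n1 -n1'; ring.
Qed.

Lemma SU2_unit (u : 'M[C]_2) : SU2 u -> u \in unitmx.
Proof. by case=> _ du; rewrite unitmxE du unitr1. Qed.

Lemma SU2_phiM (u v : 'M[C]_2) : SU2 u -> SU2 v -> phi (u *m v) = phi u *m phi v.
Proof.
by move=> /SU2_quat[p [q [r [s [_ ->]]]]] /SU2_quat[p' [q' [r' [s' [_ ->]]]]]; exact: phiM.
Qed.

Lemma SU2_inv (u : 'M[C]_2) : SU2 u -> SU2 (invmx u).
Proof.
move=> /SU2_quat[p [q [r [s [n1 ->]]]]]; rewrite quat_inv//.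
by apply: quat_SU2; rewrite -n1; ring.
Qed.

Lemma phi_invmx (u : 'M[C]_2) : SU2 u -> phi (invmx u) = (phi u)^T.
Proof.
move=> /SU2_quat[p [q [r [s [n1 ->]]]]]; rewrite quat_inv// !phi_quat.
by apply: matrix3P; split; rewrite !mxE /=; ring.
Qed.

Lemma SU2_phi_SO3 (u : 'M[C]_2) : SU2 u -> SO3 (phi u).
Proof. by move=> /SU2_quat[p [q [r [s [n1 ->]]]]]; exact: phi_SO3. Qed.

(* <v*_p, tau_L(x) v_q>, extended by 0 to all integers p and q. *)
Definition kcoef (L p q : int) (x : 'M[R]_3) : C := wcoef (invmx (su2_lift x)) L p q.

(** Two preimages differ by a sign at most, and forms of the even degree 2l do not see it. *)
Lemma kcoef_phi (l p q : int) (u : 'M[C]_2) : SU2 u ->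
  kcoef (2 * l) p q (phi u) = wcoef (invmx u) (2 * l) p q.
Proof.
move=> uS; have [vS] := su2_liftP (SU2_phi_SO3 uS).
rewrite /kcoef; move: (su2_lift _) vS => v vS.
move: uS vS => /SU2_quat[p1 [q1 [r1 [s1 [n1 ->]]]]] /SU2_quat[p2 [q2 [r2 [s2 [n2 ->]]]]].
move=> /(phi_inj n2 n1) [->//|->].
have -> : invmx (- quat p2 q2 r2 s2) = - invmx (quat p2 q2 r2 s2).
  have -> : - quat p2 q2 r2 s2 = quat (- p2) (- q2) (- r2) (- s2).
    by apply: matrix2P; rewrite !mxE /=; simpc.
  rewrite !quat_inv//; last by rewrite -n2; ring.
  by apply: matrix2P; rewrite !mxE /=; simpc; rewrite ?opprK.
rewrite /wcoef; case: ifP => // /and4P[p0 pl q0 ql].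
rewrite -scaleN1r subst_coefZ; last by lia.
have -> : absz (2 * l)%R = (absz l).*2 by lia.
by rewrite -mul2n exprM sqrrN !expr1n mul1r.
Qed.

Lemma kcoefM (l : nat) (p : int) (q : nat) x y : SO3 x -> SO3 y -> 0 <= p <= 2 * l%:Z -> (q <= 2 * l)%N ->
  kcoef (2 * l%:Z) p q (x *m y) =
  \sum_(c < (2 * l).+1) kcoef (2 * l%:Z) p c x * kcoef (2 * l%:Z) c q y.
Proof.
move=> /su2_liftP [uS <-] /su2_liftP[vS <-]; move: (su2_lift x) (su2_lift y) uS vS => u v uS vS.
case: p => [p|//] /andP[_ pl] ql.
have {}pl : (p <= 2 * l)%N by lia.
rewrite -SU2_phiM// kcoef_phi; last exact: SU2_mul.
have -> : invmx (u *m v) = invmx v *m invmx u.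
  have uU := SU2_unit uS; have vU := SU2_unit vS.
  have E : (u *m v) *m (invmx v *m invmx u) = 1%:M by rewrite mulmxA mulmxK// mulmxV.
  have [U _] := mulmx1_unit E.
  by rewrite -[LHS]mulmx1 -E mulKmx.
rewrite -PoszM wcoefE// subst_coefM//; apply: eq_bigr => c _.
have cl : (c <= 2 * l)%N by rewrite -ltnS.
by rewrite PoszM !kcoef_phi// -PoszM !wcoefE.
Qed.

End SO3Cover.

(** * Matrix coefficients in the two bases of V_2l *)

Section TauMatrix.
Variable R : realType.
Local Notation C := R[i].
Implicit Types (x : 'M[R]_3) (u : 'M[C]_2).

Lemma tau_substM u L (f : Vrep R L) : SU2 u -> tau u f = BinaryFormFacts.substM (invmx u) f.
Proof.
move=> /SU2_quat[p [q [r [s [n1 ->]]]]]; rewrite /tau /BinaryFormFacts.substM quat_inv//.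
have [-> -> -> ->] := quatE p (- q) (- r) (- s).
by rewrite /=; simpc.
Qed.

Lemma vdual1_tauK x l p q : SO3 x -> (p <= l.*2)%N -> (q <= l.*2)%N ->
  vdual 1 p (tauK x (vbase R 1 l.*2 q)) = kcoef (2 * l%:Z) p q x.
Proof.
move=> /su2_liftP [uS ux] pL qL; rewrite /tauK -/(su2_lift x) tau_substM//.
rewrite /vbase /= /BinaryFormFacts.substM BinaryFormFacts.subst_monom//.
rewrite /kcoef -PoszM mul2n wcoefE// -[in RHS](inordK (m := p) (n' := l.*2))//.
exact: (BinaryFormFacts.coord_monom (fun b => subst_coef (invmx (su2_lift x)) l.*2 b q)).
Qed.

Lemma u_c_SO3 : SO3 (u_c R).
Proof.
split; last by rewrite det_mx3 !mxE /=; ring.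
apply: matrix3P; split; rewrite [LHS]mxE sum3E !mxE /=; rewrite ?mulr1n ?mulr0n; ring.
Qed.

(** The second basis is the translate of the first by tau(u_c), so coordinates of tau(x) v in it are
    coordinates of tau(u_c^-1 x) v in the first. *)
Lemma vdual2_tauK x l p q : SO3 x -> (p <= l.*2)%N -> (q <= l.*2)%N ->
  vdual 2 p (tauK x (vbase R 1 l.*2 q)) = kcoef (2 * l%:Z) p q ((u_c R)^T *m x).
Proof.
move=> /su2_liftP [uS ux] pL qL; have [wS wx] := su2_liftP u_c_SO3.
have -> : kcoef (2 * l%:Z) p q ((u_c R)^T *m x)
    = subst_coef (invmx (invmx (su2_lift (u_c R)) *m su2_lift x)) l.*2 p q.
  rewrite -[in LHS]wx -[in LHS]ux -phi_invmx// -SU2_phiM//; last exact: SU2_inv.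
  rewrite kcoef_phi; last by apply: SU2_mul => //; exact: SU2_inv.
  by move: (invmx (_ *m _)) => W; rewrite -PoszM mul2n wcoefE.
rewrite /tauK -/(su2_lift x) tau_substM//.
have -> : invmx (su2_lift x) = invmx (invmx (su2_lift (u_c R)) *m su2_lift x) *m invmx (su2_lift (u_c R)).
  have wU := SU2_unit wS; have uU := SU2_unit uS.
  move: (su2_lift x) (su2_lift (u_c R)) uU wU => u w uU wU.
  have E1 : (invmx w *m u) *m (invmx u *m w) = 1%:M by rewrite mulmxA mulmxK// mulVmx.
  have [U _] := mulmx1_unit E1.
  have -> : invmx (invmx w *m u) = invmx u *m w by rewrite -[LHS]mulmx1 -E1 mulKmx.
  by rewrite mulmxK.
rewrite [vbase R 1 _ _]/(BinaryForms.monom C l.*2 q) BinaryFormFacts.substM_comp//.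
have wI : invmx (su2_lift (u_c R)) \in unitmx by rewrite unitmx_inv SU2_unit.
set c := fun b => subst_coef (invmx (invmx (su2_lift (u_c R)) *m su2_lift x)) l.*2 b q.
rewrite -[RHS]/(c p) -[in RHS](inordK (m := p) (n' := l.*2))//.
rewrite -[RHS](BinaryFormFacts.coord_substM c _ wI) /vdual; congr (coord _ _ _).
by apply/val_inj/eq_map => i; rewrite /vbase /= /tauK -/(su2_lift (u_c R)) tau_substM.
Qed.

End TauMatrix.

(** * The adjoint action on p *)

Lemma subst_coef_polarize (F : fieldType) (M : 'M[F]_2) L p q :
  subst_coef M L p q = polarize p L q (M 0 0) (M 1 0) (M 0 1) (M 1 1).
Proof. by rewrite polarizeE. Qed.

(** Whenever an exponent such as [q - 1] or [4 - q - 2] is truncated, its numerical coefficient is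
    0. *)
Lemma subst_coef4 (F : fieldType) (M : 'M[F]_2) q : (q <= 4)%N ->
  [/\ subst_coef M 4 0 q = M 0 1 ^+ q * M 1 1 ^+ (4 - q),
   subst_coef M 4 1 q = q%:R * (M 0 0 * M 0 1 ^+ (q - 1) * M 1 1 ^+ (4 - q))
      + (4 - q)%:R * (M 1 0 * M 0 1 ^+ q * M 1 1 ^+ (4 - q - 1)),
   subst_coef M 4 2 q = 'C(q, 2)%:R * (M 0 0 ^+ 2 * M 0 1 ^+ (q - 2) * M 1 1 ^+ (4 - q))
      + (q * (4 - q))%:R * (M 0 0 * M 1 0 * M 0 1 ^+ (q - 1) * M 1 1 ^+ (4 - q - 1))
      + 'C(4 - q, 2)%:R * (M 1 0 ^+ 2 * M 0 1 ^+ q * M 1 1 ^+ (4 - q - 2)),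
   subst_coef M 4 3 q = (4 - q)%:R * (M 0 0 ^+ q * M 1 0 ^+ (4 - q - 1) * M 1 1)
      + q%:R * (M 0 0 ^+ (q - 1) * M 0 1 * M 1 0 ^+ (4 - q))
   & subst_coef M 4 4 q = M 0 0 ^+ q * M 1 0 ^+ (4 - q)].
Proof.
move=> q4; rewrite !subst_coef_polarize /polarize.
have binE : (('C(2, 1) = 2%N) * ('C(3, 1) = 3%N) * ('C(3, 2) = 3%N) * ('C(4, 1) = 4%N)
  * ('C(4, 2) = 6%N) * ('C(4, 3) = 4%N))%type by [].
case: (nat_le4 q4) => [||| []] ?; subst q; rewrite !big_ord_recl !big_ord0 /= /bump /= ?add1n ?add0n;
  rewrite ?(bin0, binn, binE, subn0, subSS) ?bin_small// ?(muln0, mul0n) ?mul0r ?addr0 ?mulr0n ?add0r;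
  split; ring.
Qed.

Lemma sum5E (V : nmodType) (F : 'I_5 -> V) (i1 := lift ord0 ord0 : 'I_5) :
  \sum_i F i = F (inord 0) + F (inord 1) + F (inord 2) + F (inord 3) + F (inord 4).
Proof.
rewrite !big_ord_recl big_ord0 addr0 !addrA.
by congr (F _ + F _ + F _ + F _ + F _); apply/val_inj; rewrite /= inordK.
Qed.

Section AdjointIdentity.
Variables (F : numFieldType) (i : F).
Hypothesis ii : i ^+ 2 = -1.

(** The matrices [Xp] with the scalars multiplied in, over any field with a root of -1, in the form
    suited to [field]. *)
Definition Xi (r : nat) : 'M[F]_3 := nth 0 [::
  rows 3 [:: [:: 0; 0; 0]; [:: 0; 1; - i]; [:: 0; - i; -1]];
  rows 3 [:: [:: 0; - (i / 2); - 2^-1]; [:: - (i / 2); 0; 0]; [:: - 2^-1; 0; 0]];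
  rows 3 [:: [:: - (2 / 3); 0; 0]; [:: 0; 3^-1; 0]; [:: 0; 0; 3^-1]];
  rows 3 [:: [:: 0; - (i / 2); 2^-1]; [:: - (i / 2); 0; 0]; [:: 2^-1; 0; 0]];
  rows 3 [:: [:: 0; 0; 0]; [:: 0; 1; i]; [:: 0; i; -1]]] r.

Lemma conj_entry (g X : 'M[F]_3) a b : (g *m X *m g^T) a b =
  (g a 0 * X 0 0 + g a 1 * X 1 0 + g a 2 * X 2 0) * g b 0 +
  (g a 0 * X 0 1 + g a 1 * X 1 1 + g a 2 * X 2 1) * g b 1 +
  (g a 0 * X 0 2 + g a 1 * X 1 2 + g a 2 * X 2 2) * g b 2.
Proof. by rewrite mxE sum3E !mxE !sum3E. Qed.

Lemma Xi_combination (c0 c1 c2 c3 c4 : F) :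
  c0 *: Xi 0 + c1 *: Xi 1 + c2 *: Xi 2 + c3 *: Xi 3 + c4 *: Xi 4
  = rows 3 [:: [:: - (2 / 3) * c2; - (i / 2) * (c1 + c3); (c3 - c1) / 2];
               [:: - (i / 2) * (c1 + c3); c0 + c4 + c2 / 3; i * (c4 - c0)];
               [:: (c3 - c1) / 2; i * (c4 - c0); c2 / 3 - c0 - c4]].
Proof. by rewrite /Xi /=; apply: matrix3P; split; rewrite !mxE /=; field. Qed.

(** With the transpose in place of the inverse, both sides are homogeneous of degree four in P, Q,
    U, S, and the claim is a polynomial identity modulo i^2 = -1. For a unit quaternion, [M] is the
    inverse of its matrix. *)
Lemma adjoint_Xi (P Q U S : F) (M : 'M[F]_2) r (g := rows 3 [::
      [:: P^+2 + Q^+2 - U^+2 - S^+2; - 2 * (P * S - Q * U); 2 * (P * U + Q * S)];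
      [:: 2 * (P * S + Q * U); P^+2 - Q^+2 + U^+2 - S^+2; - 2 * (P * Q - U * S)];
      [:: - 2 * (P * U - Q * S); 2 * (P * Q + U * S); P^+2 - Q^+2 - U^+2 + S^+2]]) :
    M 0 0 = P - i * Q -> M 0 1 = - U - i * S -> M 1 0 = U - i * S -> M 1 1 = P + i * Q ->
    (r <= 4)%N ->
  g *m Xi r *m g^T = \sum_(r' < 5) subst_coef M 4 r' r *: Xi r'.
Proof.
move=> m0 m1 m2 m3 r4; rewrite sum5E !inordK// Xi_combination.
have [-> -> -> -> ->] := subst_coef4 M r4; rewrite m0 m1 m2 m3.
by case: (nat_le4 r4) => [||| []] ?; subst r;
  apply: matrix3P; split; rewrite conj_entry !mxE /= ?bin2 /= ?subn0 ?subSS ?subn0; field: ii.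
Qed.

End AdjointIdentity.

Section AdjointAction.
Variable R : realType.
Local Notation C := R[i].

Definition cmx (x : 'M[R]_3) : 'M[C]_3 := map_mx (real_complex R) x.

Lemma quatCE p q r s : [/\ quat p q r s 0 0 = p%:C + 'i%C * q%:C,
  quat p q r s 0 1 = r%:C + 'i%C * s%:C,
  quat p q r s 1 0 = - r%:C + 'i%C * s%:C & quat p q r s 1 1 = p%:C - 'i%C * q%:C :> C].
Proof.
have [-> -> -> ->] := quatE p q r s; split; rewrite [LHS]complexE //=.
  by rewrite rmorphN.
by rewrite rmorphN mulrN.
Qed.

Lemma XpE r : Xp R r = Xi ('i%C : C) r.
Proof.
case: r => [|[|[|[|[|r]]]]]; rewrite /Xp /Xi //=.
all: by apply: matrix3P; split; rewrite !mxE /=; field.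
Qed.

Lemma cmx_phi p q r s : cmx (phi (quat p q r s)) =
  let P := p%:C in let Q := q%:C in let U := r%:C in let S := s%:C in
  rows 3 [::
    [:: P^+2 + Q^+2 - U^+2 - S^+2; - 2 * (P * S - Q * U); 2 * (P * U + Q * S)];
    [:: 2 * (P * S + Q * U); P^+2 - Q^+2 + U^+2 - S^+2; - 2 * (P * Q - U * S)];
    [:: - 2 * (P * U - Q * S); 2 * (P * Q + U * S); P^+2 - Q^+2 - U^+2 + S^+2]].
Proof.
rewrite phi_quat; apply: matrix3P; split;
  by rewrite !mxE /= ?(rmorphD, rmorphB, rmorphN, rmorphM, rmorphXn, rmorph_nat).
Qed.

Lemma phi_Xp (u : 'M[C]_2) r : SU2 u -> (r <= 4)%N ->
  cmx (phi u) *m Xp R r *m (cmx (phi u))^T =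
  \sum_(r' < 5) subst_coef (invmx u) 4 r' r *: Xp R r'.
Proof.
move=> /SU2_quat[p [q [r0 [s [n1 ->]]]]] r4; rewrite quat_inv// XpE cmx_phi /=.
under eq_bigr do rewrite XpE.
have [m0 m1 m2 m3] := quatCE p (- q) (- r0) (- s).
apply: adjoint_Xi => //; first by rewrite sqr_i.
- by rewrite m0 rmorphN mulrN.
- by rewrite m1 !rmorphN mulrN.
- by rewrite m2 !rmorphN opprK mulrN.
- by rewrite m3 rmorphN mulrN opprK.
Qed.

End AdjointAction.

(** * Curves and derivatives *)

Section RealNorm.
Variables (R : realType) (W : normedModType R[i]).
Implicit Types w : W.

(** Norms over [R[i]] take values in [R[i]]; estimates are carried out with this real value. *)
Definition nr w : R := complex.Re `|w|.

Lemma nrE w : `|w| = (nr w)%:C.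
Proof. by rewrite /nr RRe_real// normr_real. Qed.

Lemma nr_ge0 w : 0 <= nr w.
Proof. by rewrite -ler0c -nrE normr_ge0. Qed.

Lemma nr0 : nr 0 = 0.
Proof. by rewrite /nr normr0. Qed.

Lemma nrD v w : nr (v + w) <= nr v + nr w.
Proof. by rewrite -lecR rmorphD /= -!nrE ler_normD. Qed.

Lemma nrN w : nr (- w) = nr w.
Proof. by rewrite /nr normrN. Qed.

Lemma nr_dist v w : nr (v - w) = nr (w - v).
Proof. by rewrite -nrN opprB. Qed.

Lemma nrZ (a : R[i]) w : nr (a *: w) = complex.Re `|a| * nr w.
Proof.
apply: complexI; rewrite -nrE normrZ nrE rmorphM /= RRe_real//; exact: normr_real.
Qed.

Lemma nrZr (a : R) w : nr (a%:C *: w) = `|a| * nr w.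
Proof. by rewrite nrZ normc_def /= expr0n /= addr0 sqrtr_sqr. Qed.

Lemma cvg_nrP (T : Type) (F : set_system T) (FF : Filter F) (f : T -> W) l :
  f @ F --> l <-> forall e : R, 0 < e -> \forall x \near F, nr (f x - l) < e.
Proof.
split=> [/cvgrPdist_lt h e e0|h].
  have e0' : 0 < e%:C by rewrite ltcR.
  by apply: filterS (h _ e0') => x; rewrite distrC nrE ltcR.
apply/cvgrPdist_lt => e e0.
have eR : e = (complex.Re e)%:C by rewrite RRe_real// gtr0_real.
have := h (complex.Re e); rewrite -ltcR -eR => /(_ e0).
by apply: filterS => x; rewrite -ltcR -eR distrC nrE.
Qed.

End RealNorm.

Section CurveDerivative.
Variables (R : realType) (W : normedModType R[i]).
Implicit Types (c : R -> W) (w : W).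

Lemma curve_deriv_lin (a : R[i]) c1 c2 w1 w2 : curve_deriv c1 w1 -> curve_deriv c2 w2 ->
  curve_deriv (fun t => a *: c1 t + c2 t) (a *: w1 + w2).
Proof.
move=> h1 h2; rewrite /curve_deriv.
have -> : (fun t : R => (t^-1)%:C *: (a *: c1 t + c2 t - (a *: c1 0 + c2 0))) =
  (fun t => a *: ((t^-1)%:C *: (c1 t - c1 0)) + (t^-1)%:C *: (c2 t - c2 0)).
  by apply/funext => t; rewrite opprD addrACA -scalerBr scalerDr !scalerA [a * _]mulrC.
by apply: cvgD => //; apply: cvgZr.
Qed.

Lemma curve_deriv_cst w : curve_deriv (fun=> w) 0.
Proof.
rewrite /curve_deriv; under eq_fun do rewrite subrr scaler0.
exact: cvg_cst.
Qed.

Lemma curve_deriv_unique c w1 w2 : curve_deriv c w1 -> curve_deriv c w2 -> w1 = w2.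
Proof. by move=> h1 h2; apply: cvg_unique h1 h2. Qed.

Lemma curve_derivD c1 c2 w1 w2 : curve_deriv c1 w1 -> curve_deriv c2 w2 ->
  curve_deriv (fun t => c1 t + c2 t) (w1 + w2).
Proof.
move=> h1 h2; have := curve_deriv_lin (a := 1) h1 h2; rewrite scale1r.
by under eq_fun do rewrite scale1r.
Qed.

Lemma curve_derivZ (a : R[i]) c w : curve_deriv c w -> curve_deriv (fun t => a *: c t) (a *: w).
Proof.
move=> h; have := curve_deriv_lin (a := a) h (curve_deriv_cst 0); rewrite addr0.
by under eq_fun do rewrite addr0.
Qed.

Lemma curve_derivP c w : curve_deriv c w <->
  forall e : R, 0 < e -> \forall t \near (0 : R)^', nr (c t - c 0 - t%:C *: w) <= e * `|t|.
Proof.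
split=> [/cvg_nrP h e e0|h].
  near=> t.
  have t0 : t != 0 by near: t; exact: nbhs_dnbhs_neq.
  have -> : c t - c 0 - t%:C *: w = t%:C *: ((t^-1)%:C *: (c t - c 0) - w).
    by rewrite scalerBr scalerA -rmorphM /= mulfV// scale1r.
  rewrite nrZr mulrC ler_wpM2r//; apply/ltW; near: t; exact: h.
apply/cvg_nrP => e e0.
near=> t.
have t0 : t != 0 by near: t; exact: nbhs_dnbhs_neq.
have -> : (t^-1)%:C *: (c t - c 0) - w = (t^-1)%:C *: (c t - c 0 - t%:C *: w).
  by rewrite [RHS]scalerBr scalerA -rmorphM /= mulVf// scale1r.
rewrite nrZr normfV mulrC ltr_pdivrMr ?normr_gt0//.
apply: (@le_lt_trans _ _ (e / 2 * `|t|)); last first.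
  by rewrite ltr_pM2r ?normr_gt0// ltr_pdivrMr// ltr_pMr// ltr1n.
near: t; apply: h; exact: divr_gt0.
Unshelve. all: by end_near. Qed.

Lemma curve_deriv_continuous c w : curve_deriv c w -> c t @[t --> 0^'] --> c 0.
Proof.
move=> h; have : ((t : R)%:C *: ((t^-1)%:C *: (c t - c 0)) + c 0) @[t --> 0^'] --> (0 : R[i]) *: w + c 0.
  apply: cvgD; last exact: cvg_cst.
  apply: cvgZ => //.
  apply/(cvg_nrP (W := R[i]^o)) => e e0.
  near=> t; rewrite subr0 /nr normc_def /= expr0n /= addr0 sqrtr_sqr.
  near: t; exact: (@dnbhs0_lt _ R).
rewrite scale0r add0r; apply: cvg_trans; apply: near_eq_cvg.
near=> t; have t0 : t != 0 by near: t; exact: nbhs_dnbhs_neq.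
by rewrite scalerA -rmorphM /= mulfV// scale1r subrK.
Unshelve. all: by end_near. Qed.

End CurveDerivative.

Section CurveDerivativeProduct.
Variables (R : realType) (W : normedModType R[i]).

Lemma curve_derivM (f : R -> R[i]) (c : R -> W) (f' : R[i]) (w : W) :
  curve_deriv (W := R[i]^o) f f' -> curve_deriv c w ->
  curve_deriv (fun t => f t *: c t) (f' *: c 0 + f 0 *: w).
Proof.
move=> hf hc; have := curve_deriv_continuous hc => c0.
rewrite /curve_deriv.
have -> : (fun t : R => (t^-1)%:C *: (f t *: c t - f 0 *: c 0)) =
  (fun t => ((t^-1)%:C * (f t - f 0)) *: c t + f 0 *: ((t^-1)%:C *: (c t - c 0))).
  apply/funext => t.
  by rewrite mulrBr scalerBl !scalerBr !scalerA [f 0 * _]mulrC addrA subrK.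
by apply: cvgD; [apply: cvgZ|apply: cvgZr].
Qed.

Lemma curve_deriv_real (f : R -> R) (d : R) :
  (fun t : R => t^-1 * (f t - f 0)) @ 0^' --> d ->
  curve_deriv (W := R[i]^o) (fun t => (f t)%:C) (d%:C).
Proof.
move=> /cvgrPdist_lt h; apply/(cvg_nrP (W := R[i]^o)) => e e0.
apply: filterS (h e e0) => t.
rewrite distrC /= -rmorphB /= /GRing.scale /= -rmorphM /= -rmorphB /=.
by rewrite /nr normc_def /= expr0n /= addr0 sqrtr_sqr.
Qed.

End CurveDerivativeProduct.

Section MatrixNorm.
Variable R : realType.

Lemma mx_entry_le m n (x : 'M[R]_(m, n)) i j : `|x i j| <= `|x|.
Proof.
by rewrite -[leRHS]/(mx_norm x) mx_normrE; apply: (le_bigmax _ (fun ij => `|x ij.1 ij.2|) (i, j)).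
Qed.

Lemma mx_norm_le m n (x : 'M[R]_(m, n)) (c : R) : 0 <= c -> (forall i j, `|x i j| <= c) -> `|x| <= c.
Proof.
by move=> c0 h; rewrite -[leLHS]/(mx_norm x) mx_normrE; apply: bigmax_le => // ij _.
Qed.

Lemma mulmx_norm_le m n p (x : 'M[R]_(m, n)) (y : 'M[R]_(n, p)) : `|x *m y| <= n%:R * (`|x| * `|y|).
Proof.
apply: mx_norm_le => [|i j]; first by rewrite !mulr_ge0.
rewrite mxE (le_trans (ler_norm_sum _ _ _))//.
have -> : n%:R * (`|x| * `|y|) = \sum_(k < n) `|x| * `|y| by rewrite sumr_const card_ord mulr_natl.
by apply: ler_sum => k _; rewrite normrM ler_pM// mx_entry_le.
Qed.

End MatrixNorm.

Section Frechet.
Variables (R : realType) (W : normedModType R[i]).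
Local Notation M3 := 'M[R]_3.
Implicit Types (F : M3 -> W) (L : M3 -> W).

Definition real_linear L := forall (a : R) h1 h2, L (a *: h1 + h2) = a%:C *: L h1 + L h2.

Section RealLinear.
Variable L : M3 -> W.
Hypothesis lL : real_linear L.

Lemma real_linear0 : L 0 = 0.
Proof.
have := lL 1 0 0; rewrite scaler0 addr0 scale1r => /esym/eqP.
by rewrite -subr_eq0 addrK => /eqP.
Qed.

Lemma real_linearD h1 h2 : L (h1 + h2) = L h1 + L h2.
Proof. by have := lL 1 h1 h2; rewrite !scale1r. Qed.

Lemma real_linearZ a h : L (a *: h) = a%:C *: L h.
Proof. by have := lL a h 0; rewrite !addr0 real_linear0 addr0. Qed.

Lemma real_linearB h1 h2 : L (h1 - h2) = L h1 - L h2.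
Proof. by rewrite real_linearD -scaleN1r real_linearZ rmorphN scaleN1r. Qed.

Lemma real_linear_entries h : L h = \sum_i \sum_j (h i j)%:C *: L (delta_mx i j).
Proof.
rewrite {1}(matrix_sum_delta h) (big_morph L real_linearD real_linear0).
apply: eq_bigr => i _; rewrite (big_morph L real_linearD real_linear0).
by apply: eq_bigr => j _; rewrite real_linearZ.
Qed.

(** The factor 9 counts the entries, each bounded by the norm of [h], which is their maximum. *)
Lemma real_linear_le (B : R) h : (forall i j, nr (L (delta_mx i j)) <= B) ->
  nr (L h) <= 9 * B * `|h|.
Proof.
move=> hB; rewrite real_linear_entries.
have nrS (I : finType) (f : I -> W) : nr (\sum_i f i) <= \sum_i nr (f i).
  elim/big_ind2: _ => [|a b c d ab cd|//]; first by rewrite nr0.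
  by rewrite (le_trans (nrD _ _))// lerD.
apply: (le_trans (nrS _ _)).
have -> : 9 * B * `|h| = \sum_(i < 3) \sum_(j < 3) B * `|h|.
  by rewrite !sumr_const !card_ord; ring.
apply: ler_sum => i _; apply: (le_trans (nrS _ _)); apply: ler_sum => j _.
by rewrite nrZr mulrC ler_pM ?nr_ge0// mx_entry_le.
Qed.

Lemma real_linear_bounded : exists2 B, 0 <= B & forall h, nr (L h) <= B * `|h|.
Proof.
pose B := \sum_i \sum_j nr (L (delta_mx i j)).
exists (9 * B) => [|h].
  by rewrite mulr_ge0// sumr_ge0// => i _; rewrite sumr_ge0// => j _; exact: nr_ge0.
apply: real_linear_le => i j; rewrite /B (bigD1 i)//= (bigD1 j)//= -addrA lerDl.
rewrite addr_ge0// sumr_ge0// => k _; rewrite ?nr_ge0// sumr_ge0// => k' _; exact: nr_ge0.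
Qed.

End RealLinear.

Lemma real_linear_sub L L' : real_linear L -> real_linear L' -> real_linear (fun h => L h - L' h).
Proof. by move=> lL lL' a h1 h2; rewrite lL lL' opprD addrACA scalerBr. Qed.

(** Kept apart from [curve_deriv], which concerns complex normed spaces; the little-o form feeds
    directly into [frechet]. *)
Definition mx_curve_deriv (g : R -> M3) (v : M3) :=
  forall e : R, 0 < e -> \forall t \near (0 : R)^', `|g t - g 0 - t *: v| <= e * `|t|.

Lemma mx_curve_deriv_cvg g v : mx_curve_deriv g v -> g t - g 0 @[t --> 0^'] --> (0 : M3).
Proof.
move=> h; apply/cvgrPdist_lt => e e0.
have K0 : 0 < 1 + `|v| by rewrite ltr_pwDl.
near=> t; rewrite sub0r normrN.
have -> : g t - g 0 = (g t - g 0 - t *: v) + t *: v by rewrite subrK.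
apply: (le_lt_trans (ler_normD _ _)).
apply: (@le_lt_trans _ _ ((1 + `|v|) * `|t|)).
  rewrite mulrDl mul1r normrZ [`|v| * _]mulrC lerD// -[leRHS]mul1r.
  by near: t; apply: h.
rewrite -ltr_pdivlMl//.
by near: t; apply: dnbhs0_lt; rewrite mulr_gt0// invr_gt0.
Unshelve. all: by end_near. Qed.

Lemma frechet_curve F L (g : R -> M3) v : frechet F (g 0) L -> mx_curve_deriv g v ->
  curve_deriv (F \o g) (L v).
Proof.
move=> [lL hL] hg; have [B B0 hB] := real_linear_bounded lL.
apply/curve_derivP => e e0.
have K0 : 0 < 1 + `|v| by rewrite ltr_pwDl.
have e1 : 0 < e / 2 / (1 + `|v|) by rewrite !divr_gt0.
have e2 : 0 < e / 2 / (1 + B) by rewrite !divr_gt0// ltr_pwDl.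
near=> t => /=.
set h := g t - g 0.
have ht : `|h - t *: v| <= e / 2 / (1 + B) * `|t| by rewrite /h; near: t; apply: hg.
have ht1 : `|h - t *: v| <= 1 * `|t| by rewrite /h; near: t; apply: hg.
have hF : nr (F (g 0 + h) - F (g 0) - L h) <= e / 2 / (1 + `|v|) * `|h|.
  rewrite /h; near: t; exact: (mx_curve_deriv_cvg hg) (hL _ e1).
have hn : `|h| <= (1 + `|v|) * `|t|.
  have -> : h = (h - t *: v) + t *: v by rewrite subrK.
  by rewrite (le_trans (ler_normD _ _))// mulrDl lerD// normrZ mulrC.
have -> : F (g t) - F (g 0) - t%:C *: L v
    = (F (g 0 + h) - F (g 0) - L h) + L (h - t *: v).
  by rewrite (real_linearB lL h (t *: v)) (real_linearZ lL) addrA subrK [g 0 + h]addrC subrK.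
apply: (le_trans (nrD _ _)).
have -> : e * `|t| = e / 2 * `|t| + e / 2 * `|t| by rewrite -mulrDl; congr (_ * _); field.
apply: lerD.
  apply: (le_trans hF).
  have -> : e / 2 * `|t| = e / 2 / (1 + `|v|) * ((1 + `|v|) * `|t|).
    by field; rewrite gt_eqF.
  by rewrite ler_wpM2l// ltW.
apply: (le_trans (hB _)).
have -> : e / 2 * `|t| = (1 + B) * (e / 2 / (1 + B) * `|t|).
  by field; rewrite gt_eqF// ltr_pwDl.
by rewrite ler_pM// lerDr.
Unshelve. all: by end_near. Qed.

End Frechet.

(** * Mean value inequality and strict differentiability *)

Section MeanValue.
Variables (R : realType) (W : normedModType R[i]).

(** The vector-valued mean value inequality by a supremum argument: the slope M + e persists up to
    the supremum [c] of the good parameters and, unless c = 1, beyond it. *)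
Lemma lipschitz_segment (h : R -> W) (M : R) : 0 <= M ->
  (forall s, 0 <= s <= 1 -> forall e, 0 < e -> exists2 d, 0 < d & forall s', 0 <= s' <= 1 ->
     `|s' - s| < d -> nr (h s' - h s) <= (M + e) * `|s' - s|) ->
  nr (h 1 - h 0) <= M.
Proof.
move=> M0 hyp; apply/ler_addgt0Pr => e e0.
pose P s := forall r, 0 <= r <= s -> nr (h r - h 0) <= (M + e) * r.
pose A := [set s | 0 <= s <= 1 /\ P s].
have Me0 : 0 <= M + e by rewrite addr_ge0// ltW.
have A0 : A 0.
  split; first by rewrite lexx ler01.
  move=> r /andP[r0 r0']; have -> : r = 0 by apply/le_anti; rewrite r0 r0'.
  by rewrite subrr nr0 mulr0.
have supA : has_sup A.
  by split; [exists 0|exists 1 => s [/andP[]]].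
set c := sup A.
have c1 : c <= 1 by apply: sup_le_ub => [|s [/andP[]]//]; exists 0.
have c0 : 0 <= c by apply: sup_upper_bound.
have c01 : 0 <= c <= 1 by rewrite c0 c1.
have [d d0 hd] := hyp c c01 e e0.
have tri a b k : nr (h a - h k) <= nr (h a - h b) + nr (h b - h k).
  by rewrite -[h a - h k](subrKA (h b)) nrD.
have Plt r : 0 <= r -> r < c -> nr (h r - h 0) <= (M + e) * r.
  move=> r0 rc; have [s [sA Ps] rs] := sup_gt (ex_intro _ 0 A0) rc.
  by apply: Ps; rewrite r0 ltW.
have Pc : nr (h c - h 0) <= (M + e) * c.
  have [->|cn0] := eqVneq c 0; first by rewrite subrr nr0 mulr0.
  have cgt : 0 < c by rewrite lt_neqAle eq_sym cn0.
  pose r := Num.max 0 (c - d / 2).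
  have r0 : 0 <= r by rewrite le_max lexx.
  have rc : r < c by rewrite gt_max cgt ltrBlDr ltrDl divr_gt0.
  have rd : `|c - r| < d.
    rewrite ger0_norm ?subr_ge0 ?(ltW rc)// ltrBlDr -ltrBlDl.
    by rewrite lt_max; apply/orP; right; rewrite ltrD2l ltrN2 ltr_pdivrMr// ltr_pMr// ltr1n.
  apply: (le_trans (tri c r 0)).
  have := hd r; rewrite r0 (le_trans (ltW rc) c1) distrC nr_dist => /(_ isT rd) h1.
  have -> : (M + e) * c = (M + e) * (c - r) + (M + e) * r by rewrite -mulrDr subrK.
  apply: lerD; last exact: Plt.
  by move: h1; rewrite ger0_norm// subr_ge0 ltW.
have step r : c <= r <= 1 -> r - c < d -> nr (h r - h 0) <= (M + e) * r.
  move=> /andP[cr r1] rd; apply: (le_trans (tri r c 0)).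
  have -> : (M + e) * r = (M + e) * (r - c) + (M + e) * c by rewrite -mulrDr subrK.
  apply: lerD => //.
  have := hd r; rewrite r1 (le_trans c0 cr) ger0_norm ?subr_ge0//; exact.
have [cE|cn1] := eqVneq c 1.
  by move: Pc; rewrite cE mulr1.
have clt : c < 1 by rewrite lt_neqAle cn1.
(* The local estimate at [c] makes [b > c] a good parameter, against the choice of the supremum. *)
pose b := Num.min 1 (c + d / 2).
have bc : c < b by rewrite lt_min clt ltrDl divr_gt0.
have Ab : A b.
  split; first by rewrite (le_trans c0 (ltW bc)) ge_min lexx.
  move=> r /andP[r0 rb]; case: (ltP r c) => [|cr]; first exact: Plt.
  apply: step; first by rewrite cr (le_trans rb)// ge_min lexx.
  rewrite ltrBlDl (le_lt_trans rb)// gt_min; apply/orP; right.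
  by rewrite ltrD2l ltr_pdivrMr// ltr_pMr// ltr1n.
by have := sup_upper_bound supA Ab; rewrite leNgt bc.
Qed.

End MeanValue.

Section StrictDifferentiability.
Variables (R : realType) (W : normedModType R[i]).
Local Notation M3 := 'M[R]_3.

(** Apply the mean value inequality on the segment from z to y to [F] minus its differential at
    [x0]: near [x0] the derivative of this difference is small. *)
Lemma Ck1_strict (U : set M3) (F : M3 -> W) x0 : open U -> U x0 -> Ck U 1 F ->
  exists2 dF : M3 -> M3 -> W, (forall x, U x -> frechet F x (dF x)) &
  forall e, 0 < e -> exists2 d : R, 0 < d &
   (forall x, `|x - x0| < d -> U x /\ forall h, nr (dF x h - dF x0 h) <= e * `|h|) /\
   (forall y z, `|y - x0| < d -> `|z - x0| < d ->
     nr (F y - F z - dF x0 (y - z)) <= e * `|y - z|).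
Proof.
move=> oU Ux0 [dF [hF cF]]; exists dF => // e0 e00.
have lin x : U x -> real_linear (dF x) by move=> /hF[].
(* Nine entries at e0 / 18 make e0 / 2. The other half is spent on the Frechet estimate at the
   points of the segment. *)
have e9 : 0 < e0 / 18 by rewrite divr_gt0.
have : \forall x \near x0, U x /\ forall i j, nr (dF x (delta_mx i j) - dF x0 (delta_mx i j)) < e0 / 18.
  have N : \forall x \near x0, forall i j, nr (dF x (delta_mx i j) - dF x0 (delta_mx i j)) < e0 / 18.
    near=> x; move=> i j; move: i j; near: x.
    apply: filter_forall => i; apply: filter_forall => j.
    by have /cvg_nrP := cF (delta_mx i j) x0 Ux0; apply.
  near=> x; split; last by near: x.
  by near: x; exact: open_nbhs_nbhs.
move=> /nbhs_normP[d /= d0 hd].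
have hd' x : `|x - x0| < d -> U x /\ forall h, nr (dF x h - dF x0 h) <= e0 / 2 * `|h|.
  move=> xd; have [|Ux hx] := hd x; first by rewrite /= /ball_ distrC.
  split=> // h; have -> : e0 / 2 = 9 * (e0 / 18) by field.
  apply: (real_linear_le (L := fun h => dF x h - dF x0 h)); first exact: real_linear_sub (lin _ Ux) (lin _ Ux0).
  by move=> i j; exact/ltW.
exists d => //; split.
  move=> x /hd'[Ux hx]; split=> // h; rewrite (le_trans (hx h))// ler_wpM2r//.
  by rewrite ler_pdivrMr// ler_pMr// ler1n.
move=> y z yd zd; set k := y - z.
have seg s : 0 <= s <= 1 -> `|z + s *: k - x0| < d.
  move=> /andP[s0 s1].
  have -> : z + s *: k - x0 = (1 - s) *: (z - x0) + s *: (y - x0).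
    rewrite /k !scalerBr scalerBl !scale1r scalerBl scale1r.
    by rewrite !opprB; apply/matrixP => i j; rewrite !mxE; ring.
  apply: (le_lt_trans (ler_normD _ _)); rewrite !normrZ (ger0_norm s0) ger0_norm ?subr_ge0//.
  have [->|sn1] := eqVneq s 1; first by rewrite subrr mul0r add0r mul1r.
  have -> : d = (1 - s) * d + s * d by ring.
  apply: ltr_leD; first by rewrite ltr_pM2l// subr_gt0 lt_neqAle sn1.
  by rewrite ler_wpM2l// ltW.
have [k0|k0] := eqVneq k 0.
  have /eqP := k0; rewrite subr_eq0 => /eqP ->.
  by rewrite k0 (real_linear0 (lin _ Ux0)) subrr subr0 normr0 mulr0 nr0.
pose h s := F (z + s *: k) - s%:C *: dF x0 k.
have -> : F y - F z - dF x0 k = h 1 - h 0.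
  rewrite /h !scale1r !scale0r addr0 subr0 /k [z + _]addrC subrK.
  by rewrite -!addrA; congr (_ + _); rewrite addrC.
have kp : 0 < `|k| by rewrite normr_gt0.
apply: lipschitz_segment; first by rewrite mulr_ge0// ltW.
move=> s s01 e e_gt0; have [Us hs] := hd' _ (seg s s01).
have [_ /(_ (e0 / 2))] := hF _ Us.
have e02 : 0 < e0 / 2 by rewrite divr_gt0.
move=> /(_ e02)/nbhs_normP[d' /= d'0 hd2].
exists (d' / `|k|); first by rewrite divr_gt0.
move=> s' s'01 ss; set a := s' - s.
have ad : `|a *: k| < d' by rewrite normrZ -ltr_pdivlMr.
have := hd2 (a *: k); rewrite /= /ball_ /= sub0r normrN => /(_ ad); rewrite -/(nr _) => B1.
have -> : h s' - h s = (F (z + s *: k + a *: k) - F (z + s *: k) - dF (z + s *: k) (a *: k))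
    + (dF (z + s *: k) (a *: k) - dF x0 (a *: k)).
  rewrite subrKA [dF x0 (a *: k)](real_linearZ (lin _ Ux0)) /h.
  have -> : z + s *: k + a *: k = z + s' *: k by rewrite -addrA -scalerDl [s + a]addrC /a subrK.
  have -> : a%:C = s'%:C - s%:C by rewrite /a rmorphB.
  by rewrite scalerBl !opprB [LHS]addrACA [RHS]addrACA; congr (_ + _); exact: addrC.
apply: (le_trans (nrD _ _)).
have -> : (e0 * `|k| + e) * `|a| = e0 / 2 * `|a *: k| + e0 / 2 * `|a *: k| + e * `|a|.
  by rewrite normrZ; field.
apply: ler_wpDr; first by rewrite mulr_ge0// ltW.
by apply: lerD.
Unshelve. all: by end_near. Qed.

End StrictDifferentiability.

(** * Derivatives of the regular representation *)

Section MatrixTopology.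
Variable K : numFieldType.

Lemma mx_cvg (T : Type) (F : set_system T) (FF : Filter F) m n (f : T -> 'M[K]_(m, n)) (M : 'M[K]_(m, n)) :
  (forall i j, f x i j @[x --> F] --> M i j) -> f @ F --> M.
Proof.
move=> h A [P hP PA]; rewrite /= /fmap /=.
have : \forall x \near F, forall i j, P i j (f x i j).
  by apply: filter_forall => i; apply: filter_forall => j; apply: h; exact: hP.
by rewrite nbhs_filterE; apply: filterS => x Px; exact: PA.
Qed.

End MatrixTopology.

(** * Compactness of SO(3) and the norm of the completion *)

Section SO3Topology.
Variable R : realType.
Local Notation M3 := 'M[R]_3.

Lemma closed_level (f : M3 -> R) a : continuous f -> closed [set x | f x = a].
Proof.
move=> cf; have -> : [set x | f x = a] = f @^-1` [set a] by [].
by apply: closed_comp => [x _|]; [exact: cf|exact: closed_eq].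
Qed.

Lemma SO3_closed : closed (@SO3 R).
Proof.
have cf (i j : 'I_3) : continuous (fun x : M3 => x i j) by exact: coord_continuous.
have -> : @SO3 R = (\bigcap_(ij in [set: 'I_3 * 'I_3])
    [set x : M3 | x ij.1 0 * x ij.2 0 + x ij.1 1 * x ij.2 1 + x ij.1 2 * x ij.2 2
        = (ij.1 == ij.2)%:R])
  `&` [set x : M3 | x 0 0 * (x 1 1 * x 2 2 - x 1 2 * x 2 1) - x 0 1 * (x 1 0 * x 2 2 - x 1 2 * x 2 0)
  + x 0 2 * (x 1 0 * x 2 1 - x 1 1 * x 2 0) = 1].
  apply/seteqP; split=> x /=.
    move=> [xx dx]; rewrite -det_mx3; split=> // -[i j] _ /=.
    by have /matrixP/(_ i j) := xx; rewrite !mxE sum3E !mxE.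
  move=> [xx dx]; split; last by rewrite det_mx3.
  apply/matrixP => i j; rewrite !mxE sum3E !mxE; exact: (xx (i, j) I).
have cM (f g : M3 -> R) : continuous f -> continuous g -> continuous (fun x => f x * g x).
  by move=> h1 h2 x; exact: cvgM (h1 x) (h2 x).
have cD (f g : M3 -> R) : continuous f -> continuous g -> continuous (fun x => f x + g x).
  by move=> h1 h2 x; exact: cvgD (h1 x) (h2 x).
have cB (f g : M3 -> R) : continuous f -> continuous g -> continuous (fun x => f x - g x).
  by move=> h1 h2 x; exact: cvgB (h1 x) (h2 x).
have cMM i j k l := cM _ _ (cf i j) (cf k l).
apply: closedI.
  apply: closed_bigI => -[i j] _; apply: closed_level.
  exact: (cD _ _ (cD _ _ (cMM i 0 j 0) (cMM i 1 j 1)) (cMM i 2 j 2)).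
apply: closed_level.
exact: (cD _ _ (cB _ _ (cM _ _ (cf 0 0) (cB _ _ (cMM 1 1 2 2) (cMM 1 2 2 1)))
  (cM _ _ (cf 0 1) (cB _ _ (cMM 1 0 2 2) (cMM 1 2 2 0)))) (cM _ _ (cf 0 2) (cB _ _ (cMM 1 0 2 1) (cMM 1 1 2 0)))).
Qed.

Lemma SO3_entry_le x i j : SO3 x -> `|x i j : R| <= 1.
Proof.
move=> [xx _]; have /matrixP/(_ i i) := xx; rewrite !mxE eqxx mulr1n => E.
rewrite -(ler_pXn2r (n := 2)) ?nnegrE// expr1n -normrX ger0_norm ?sqr_ge0// -E.
rewrite (bigD1 j)//= !mxE -expr2 lerDl sumr_ge0// => k _.
by rewrite !mxE -expr2 sqr_ge0.
Qed.

(** Heine-Borel is applied to row vectors of length nine, and [vec_mx] carries the result to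
    matrices. *)
Lemma SO3_compact : compact (@SO3 R).
Proof.
pose g (v : 'rV[R]_(3 * 3)) : M3 := vec_mx v.
have cg : continuous g.
  move=> v; apply: (mx_cvg (F := nbhs v)) => i j; rewrite /g mxE.
  under eq_fun do rewrite mxE; exact: coord_continuous.
have -> : @SO3 R = g @` (g @^-1` @SO3 R).
  apply/seteqP; split=> [x xS|_ [v vS <-]//].
  by exists (mxvec x); rewrite /= /g mxvecK.
apply: continuous_compact; first by move=> v; apply: continuous_subspaceT; exact: cg.
apply: bounded_closed_compact.
  exists 1; split; first exact: real1.
  move=> M M1 v /= vS; apply: mx_norm_le => [|i k]; first by rewrite (le_trans ler01)// ltW.
  rewrite (le_trans _ (ltW M1))// ord1.
  have [i0 [j0 ->]] : exists i0 j0, k = mxvec_index i0 j0 by case/mxvec_indexP: k => i0 j0; exists i0, j0.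
  rewrite -[v]vec_mxK mxvecE; exact: SO3_entry_le vS.
by apply: closed_comp => [x _|]; [exact: cg|exact: SO3_closed].
Qed.

Lemma SO3_measurable : measurable (@SO3 R : set (borelM3 R)).
Proof.
rewrite -[X in measurable X]setCK; apply: measurableC.
apply: sub_sigma_algebra; apply: closed_openC; exact: SO3_closed.
Qed.

End SO3Topology.

Section RegularRepresentation.
Variables (R : realType) (mu : {measure set (borelM3 R) -> \bar R}).
Local Notation M3 := 'M[R]_3.

(** Argues with the supremum over simple functions that defines the integral, so the bound holds for
    the squared norm of any section without discussing its measurability. *)
Lemma integral_le_cst d (T : measurableType d) (nu : {measure set T -> \bar R}) (D : set T)
    (f : T -> \bar R) (c : R) : measurable D ->
  (forall x, D x -> (0 <= f x <= c%:E)%E) -> (\int[nu]_(x in D) f x <= c%:E * nu D)%E.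
Proof.
move=> mD fc; have [D0|/set0P[x Dx]] := eqVneq D set0.
  by rewrite D0 integral_set0 measure0 mule0.
have c0 : (0 <= c%:E)%E by have /andP[h1 h2] := fc x Dx; exact: le_trans h2.
rewrite -(integral_cst nu mD) ge0_integralE; last by move=> y /fc/andP[].
rewrite ge0_integralE//; apply: ereal_sup_le => _ [h hf <-]; exists h => // y.
apply: (le_trans (hf y)); rewrite /patch; case: ifP => // /set_mem yD.
by have /andP[] := fc y yD.
Qed.

Variables (W : normedModType R[i]) (S : set (M3 -> W)) (H : completeNormedModType R[i]).
Variables (iota : (M3 -> W) -> H) (pi : M3 -> H -> H).
Hypothesis mu_haar : haar_SO3 mu.
Hypothesis rr : right_regular mu S iota pi.

Definition iota_bound : R := Num.sqrt (fine (mu (@SO3 R))).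

(** Since SO(3) has finite mass, uniform estimates on it become estimates in H. *)
Lemma iota_le f c : S f -> 0 <= c -> (forall x, SO3 x -> nr (f x) <= c) ->
  nr (iota f) <= c * iota_bound.
Proof.
move=> Sf c0 fc; have [/andP[mu0 mu1] _] := mu_haar.
have muE : mu (@SO3 R) = (fine (mu (@SO3 R)))%:E.
  by rewrite fineK// ge0_fin_numE// ltW.
have h : ((nr (iota f) ^+ 2)%:E <= (c ^+ 2)%:E * mu (@SO3 R))%E.
  rewrite (iota_norm rr Sf); apply: integral_le_cst; first exact: SO3_measurable.
  move=> x xS; rewrite lee_fin sqr_ge0 lee_fin ler_pXn2r// ?nnegrE ?nr_ge0//; exact: fc.
move: h; rewrite muE -EFinM lee_fin => h.
rewrite -(ler_pXn2r (n := 2)) ?nnegrE ?nr_ge0 ?mulr_ge0 ?sqrtr_ge0//.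
by rewrite exprMn sqr_sqrtr// fine_ge0// ltW.
Qed.

End RegularRepresentation.

(** * Stability of smooth functions on SL(3, R) *)

Section SmoothClosure.
Variables (R : realType) (W : normedModType R[i]).
Local Notation M3 := 'M[R]_3.
Implicit Types (F G : M3 -> W) (U V : set M3).

Lemma frechet_lin (a : R[i]) F G x L L' : frechet F x L -> frechet G x L' ->
  frechet (fun y => a *: F y + G y) x (fun h => a *: L h + L' h).
Proof.
move=> [lL hL] [lL' hL']; split.
  move=> b h1 h2; rewrite lL lL' !scalerDr !scalerA [a * _]mulrC.
  by rewrite [LHS]addrACA.
move=> e e0; pose A := complex.Re `|a|.
have A0 : 0 <= A by rewrite -[A]/(nr (W := R[i]^o) a) nr_ge0.
have e1 : 0 < e / 2 / (1 + A) by rewrite !divr_gt0// ltr_pwDl.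
have e2 : 0 < e / 2 by rewrite divr_gt0.
near=> h.
have h1 : nr (F (x + h) - F x - L h) <= e / 2 / (1 + A) * `|h| by near: h; exact: hL.
have h2 : nr (G (x + h) - G x - L' h) <= e / 2 * `|h| by near: h; exact: hL'.
rewrite -/(nr _).
have -> : a *: F (x + h) + G (x + h) - (a *: F x + G x) - (a *: L h + L' h)
  = a *: (F (x + h) - F x - L h) + (G (x + h) - G x - L' h).
  by rewrite !scalerBr !opprD [X in X + _ = _]addrACA [LHS]addrACA.
apply: (le_trans (nrD _ _)); rewrite nrZ -/A.
have -> : e * `|h| = e / 2 * `|h| + e / 2 * `|h| by field.
apply: lerD => //.
have -> : e / 2 * `|h| = (1 + A) * (e / 2 / (1 + A) * `|h|).
  by field; rewrite gt_eqF// ltr_pwDl.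
by rewrite ler_pM ?nr_ge0// lerDr.
Unshelve. all: by end_near. Qed.

Lemma mul3_le (a b : R) : 0 <= a -> 3%:R * (a * b) <= (1 + 3 * b) * a.
Proof. by move=> a0; rewrite -subr_ge0; have -> : (1 + 3 * b) * a - 3 * (a * b) = a by ring. Qed.

Lemma mulmxr_continuous (g : M3) : continuous (fun x : M3 => x *m g).
Proof.
move=> x; apply/(@cvgrPdist_lt _ _ _ (nbhs x) _) => e e0.
have K0 : 0 < 1 + 3 * `|g| by rewrite ltr_pwDl// mulr_ge0.
have N : \forall y \near (x : M3), `|x - y| < (1 + 3 * `|g|)^-1 * e.
  by apply/nbhs_normP; exists ((1 + 3 * `|g|)^-1 * e); rewrite //= mulr_gt0// invr_gt0.
near=> y; rewrite -mulmxBl.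
apply: (le_lt_trans (mulmx_norm_le _ _)).
apply: (@le_lt_trans _ _ ((1 + 3 * `|g|) * `|x - y|)).
  exact: mul3_le.
rewrite -ltr_pdivlMl//; near: y; exact: N.
Unshelve. all: by end_near. Qed.

Lemma frechet_mulmxr F x (g : M3) L : frechet F (x *m g) L ->
  frechet (fun y => F (y *m g)) x (fun h => L (h *m g)).
Proof.
move=> [lL hL]; split=> [b h1 h2|e e0]; first by rewrite mulmxDl -scalemxAl lL.
have K0 : 0 < 1 + 3 * `|g| by rewrite ltr_pwDl// mulr_ge0.
have e1 : 0 < e / (1 + 3 * `|g|) by rewrite divr_gt0.
have c0 : (h *m g) @[h --> (0 : M3)] --> (0 : M3).
  by have := @mulmxr_continuous g 0; rewrite /continuous_at mul0mx.
near=> h; rewrite mulmxDl.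
have : complex.Re `|F (x *m g + h *m g) - F (x *m g) - L (h *m g)| <= e / (1 + 3 * `|g|) * `|h *m g|.
  by near: h; exact: c0 (hL _ e1).
move/le_trans; apply.
have -> : e * `|h| = e / (1 + 3 * `|g|) * ((1 + 3 * `|g|) * `|h|).
  by field; rewrite gt_eqF.
rewrite ler_wpM2l ?(ltW e1)// (le_trans (mulmx_norm_le _ _))//.
exact: mul3_le.
Unshelve. all: by end_near. Qed.

Lemma Ck_sub k U V F : U `<=` V -> Ck V k F -> Ck U k F.
Proof.
move=> UV; elim: k F => [|k IH] F /=; first by move=> h x /UV; exact: h.
by move=> [dF [h1 h2]]; exists dF; split=> [x /UV|h]; [exact: h1|apply: IH; exact: h2].
Qed.

Lemma Ck_lin k U (a : R[i]) F G : Ck U k F -> Ck U k G -> Ck U k (fun y => a *: F y + G y).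
Proof.
elim: k F G => [|k IH] F G /=.
  move=> hF hG x Ux; have FF := nbhs_filter x.
  exact: (@cvgD _ _ _ (nbhs x) FF _ _ _ _ (@cvgZl_tmp _ _ _ (nbhs x) FF a _ _ (hF x Ux)) (hG x Ux)).
move=> [dF [h1 h2]] [dG [k1 k2]]; exists (fun x h => a *: dF x h + dG x h); split.
  by move=> x Ux; apply: frechet_lin; [exact: h1|exact: k1].
by move=> h; apply: IH; [exact: h2|exact: k2].
Qed.

Lemma Ck_mulmxr k U F (g : M3) : Ck U k F ->
  Ck [set x | U (x *m g)] k (fun x => F (x *m g)).
Proof.
elim: k F => [|k IH] F /=.
  by move=> hF x Ux; apply: continuous_comp; [exact: mulmxr_continuous|exact: hF].
move=> [dF [h1 h2]]; exists (fun x h => dF (x *m g) (h *m g)); split.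
  by move=> x Ux; apply: frechet_mulmxr; exact: h1.
by move=> h; apply: (IH (fun x => dF x (h *m g))); exact: h2.
Qed.

Lemma smooth_lin (a : R[i]) F G : smooth_SL3 F -> smooth_SL3 G ->
  smooth_SL3 (fun y => a *: F y + G y).
Proof.
move=> sF sG x xS; have [U [F' [oU Ux cF eF]]] := sF x xS.
have [V [G' [oV Vx cG eG]]] := sG x xS.
exists (U `&` V), (fun y => a *: F' y + G' y); split=> //.
- exact: openI.
- by move=> k; apply: Ck_lin; [apply: Ck_sub (cF k)|apply: Ck_sub (cG k)] => y [].
- by move=> y [Uy Vy] yS; rewrite eF// eG.
Qed.

Lemma SL3_mul (g h : M3) : SL3 g -> SL3 h -> SL3 (g *m h).
Proof. by rewrite /SL3 /= det_mulmx => -> ->; rewrite mulr1. Qed.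

Lemma smooth_mulmxr F (g : M3) : SL3 g -> smooth_SL3 F -> smooth_SL3 (fun y => F (y *m g)).
Proof.
move=> gS sF x xS; have [U [F' [oU Ux cF eF]]] := sF _ (SL3_mul xS gS).
exists [set y | U (y *m g)], (fun y => F' (y *m g)); split=> //.
- by apply: open_comp oU => y _; exact: mulmxr_continuous.
- by move=> k; exact: Ck_mulmxr.
- by move=> y Uy yS; apply: eF => //; exact: SL3_mul.
Qed.

Lemma SO3_SL3 (x : M3) : SO3 x -> SL3 x.
Proof. by case. Qed.

Lemma SO3_norm_le (x : M3) : SO3 x -> `|x| <= 1.
Proof. by move=> xS; apply: mx_norm_le => // i j; exact: SO3_entry_le. Qed.

Lemma smooth_frechet F x : smooth_SL3 F -> SL3 x -> exists2 L : M3 -> W, real_linear L &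
  forall (g : R -> M3) v, g 0 = x -> (forall t, SL3 (g t)) -> mx_curve_deriv g v ->
    curve_deriv (F \o g) (L v).
Proof.
move=> sF xS; have [U [F' [oU Ux cF eF]]] := sF x xS.
have [dF [hF _]] := cF 1%N; have hx := hF _ Ux; exists (dF x); first by case: hx.
move=> g v g0 gS hg; rewrite -g0 in hx; have := frechet_curve hx hg; rewrite g0.
apply: cvg_trans; apply: near_eq_cvg.
have nU : \forall t \near (0 : R)^', U (g t).
  have := mx_curve_deriv_cvg hg; move/(cvgD (cvg_cst (g 0))); rewrite addr0 g0.
  have nx : nbhs x U by apply: open_nbhs_nbhs; split.
  move=> /(_ _ nx) h; have {}h : \forall t \near (0 : R)^', U (x + (g t - x)) by exact: h.
  by apply: filterS h => t; rewrite addrC subrK.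
by near=> t; rewrite /= -!eF ?g0//; near: t.
Unshelve. all: by end_near. Qed.

End SmoothClosure.

Section RepresentationDerivative.
Variables (R : realType) (mu : {measure set (borelM3 R) -> \bar R}).
Local Notation M3 := 'M[R]_3.
Variables (W : normedModType R[i]) (S : set (M3 -> W)) (H : completeNormedModType R[i]).
Variables (iota : (M3 -> W) -> H) (pi : M3 -> H -> H).
Hypothesis mu_haar : haar_SO3 mu.
Hypothesis rr : right_regular mu S iota pi.
Hypothesis S_smooth : forall f, S f -> smooth_SL3 f.
Hypothesis S_lin : forall (a : R[i]) f g, S f -> S g -> S (fun x => a *: f x + g x).
Hypothesis S_mulmxr : forall f g, SL3 g -> S f -> S (fun x => f (x *m g)).

(* By strict differentiability the estimate is locally uniform in x, hence uniform on the
   compact group SO(3); this is what makes the curve converge in the L^2 completion. *)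
Lemma uniform_derivative f f' (g : R -> M3) (Z : M3) :
    smooth_SL3 f -> g 0 = 1%:M -> (forall t, SL3 (g t)) -> mx_curve_deriv g Z ->
    (forall x, SO3 x -> curve_deriv (fun t => f (x *m g t)) (f' x : W)) ->
  forall e : R, 0 < e -> \forall t \near (0 : R)^', forall x, SO3 x ->
    nr (f (x *m g t) - f x - t%:C *: f' x) <= e * `|t|.
Proof.
move=> sf g0 gS hg hf e e0.
have /compact_near_coveringP cov := @SO3_compact R.
suff : \forall t \near (0 : R)^', @SO3 R `<=` (fun x => SO3 x ->
    nr (f (x *m g t) - f x - t%:C *: f' x) <= e * `|t|).
  by apply: filterS => t ht x xS; exact: ht.
apply: (cov R (0 : R)^' (fun t x => SO3 x -> nr (f (x *m g t) - f x - t%:C *: f' x) <= e * `|t|)).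
move=> x0 x0S; have [U [F [oU Ux cF eF]]] := sf x0 (SO3_SL3 x0S).
have [dF hF strict] := Ck1_strict oU Ux (cF 1%N).
have [B B0 hB] := real_linear_bounded (hF _ Ux).1.
pose Z1 := 1 + 3 * `|Z|.
have Z10 : 0 < Z1 by rewrite ltr_pwDl// mulr_ge0.
(* Chosen so that [e1 * Z1 <= e / 4]; the total error splits into three parts, each at most e / 4
   times the size of t. *)
pose e1 := e / (4 * Z1 + 4).
have e10 : 0 < e1 by rewrite divr_gt0// addr_gt0// mulr_gt0.
have [d d0 [hd1 hd2]] := strict e1 e10.
(* Multiplication by x costs a factor 3. The first bound then keeps [y - x] within [Z1] times the
   size of t, the second makes the image of the remainder under [dF x0] at most e / 4 times it. *)
pose e2 := Num.min (3^-1) (e / (12 * (1 + B))).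
have e20 : 0 < e2 by rewrite lt_min invr_gt0 ltr0n divr_gt0// mulr_gt0// ltr_pwDl.
have N1 : \forall t \near (0 : R)^', `|g t - g 0 - t *: Z| <= e2 * `|t| := hg _ e20.
have N2 : \forall t \near (0 : R)^', `|g t - g 0| < d / 6.
  have /cvgrPdist_lt h := mx_curve_deriv_cvg hg.
  have d6 : 0 < d / 6 by rewrite divr_gt0.
  by apply: filterS (h _ d6) => t; rewrite sub0r normrN.
have N0 : \forall x \near (x0 : M3), `|x0 - x| < d / 2.
  by apply/nbhs_normP; exists (d / 2); rewrite /= ?divr_gt0.
exists ([set x | `|x0 - x| < d / 2], [set t | `|g t - g 0 - t *: Z| <= e2 * `|t| /\ `|g t - g 0| < d / 6]).
  by split => /=; [exact: N0|exact: filterI].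
move=> [x t] /= [xd [ht1 ht2]] xS; rewrite distrC in xd.
have xn := SO3_norm_le xS.
have mulx (h : M3) : `|x *m h| <= 3 * `|h|.
  rewrite (le_trans (mulmx_norm_le _ _))// ler_wpM2l// -[leRHS]mul1r ler_wpM2r//.
have xd' : `|x - x0| < d by rewrite (lt_trans xd)// ltr_pdivrMr// ltr_pMr// ltr1n.
set y := x *m g t.
have yx : y - x = x *m (g t - g 0) by rewrite mulmxBr g0 mulmx1.
have yd : `|y - x0| < d.
  have -> : y - x0 = (x - x0) + (y - x) by rewrite [RHS]addrC subrKA.
  apply: (le_lt_trans (ler_normD _ _)).
  have -> : d = d / 2 + 3 * (d / 6) by field.
  by rewrite ltrD// yx (le_lt_trans (mulx _))// ltr_pM2l.
have [Ux' hx] := hd1 x xd'; have [Uy _] := hd1 y yd.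
have xSL := SO3_SL3 xS; have ySL : SL3 y := SL3_mul xSL (gS t).
(* Uniqueness of limits identifies the given pointwise derivative with that of the local extension,
   to which the strict estimate applies. *)
have f'E : f' x = dF x (x *m Z).
  have hxg : frechet F (x *m g 0) (dF x) by rewrite g0 mulmx1; exact: hF.
  have hxc : mx_curve_deriv (fun t => x *m g t) (x *m Z).
    move=> r r0; have r3 : 0 < r / 3 by rewrite divr_gt0.
    apply: filterS (hg _ r3) => u hu.
    rewrite -mulmxBr scalemxAr -mulmxBr (le_trans (mulx _))//.
    by rewrite -ler_pdivlMl// mulrA [3^-1 * _]mulrC.
  have h1 := @frechet_curve _ _ F (dF x) (fun t => x *m g t) _ hxg hxc.
  apply: curve_deriv_unique (hf x xS) _.
  apply: cvg_trans h1; apply: near_eq_cvg.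
  have nU : \forall u \near (0 : R)^', U (x *m g u).
    have h2 := mx_curve_deriv_cvg hxc; have nx : \forall h \near (0 : M3), U (x *m g 0 + h).
      have : \forall z \near (x *m g 0), U z by rewrite g0 mulmx1; apply: open_nbhs_nbhs.
      move=> /nbhs_normP[r /= r0 hr]; apply/nbhs_normP; exists r => //= h /=.
      rewrite /ball_ /= sub0r normrN => hh; apply: hr => /=.
      by rewrite opprD addrA subrr sub0r normrN.
    have h3 : \forall u \near (0 : R)^', U (x *m g 0 + (x *m g u - x *m g 0)) by exact: h2 _ nx.
    by apply: filterS h3 => u; rewrite addrC subrK.
  near=> u; rewrite /= g0 mulmx1 -(eF x Ux' xSL) -eF//; first by near: u.
  exact: SL3_mul (gS u).
rewrite f'E (eF x Ux' xSL) (eF y Uy ySL).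
have -> : F y - F x - t%:C *: dF x (x *m Z) = (F y - F x - dF x0 (y - x))
   + (dF x0 (y - x - t *: (x *m Z)) - t%:C *: (dF x (x *m Z) - dF x0 (x *m Z))).
  have lin0 := (hF _ Ux).1.
  rewrite (real_linearB lin0 (y - x) (t *: (x *m Z))) (real_linearZ lin0) scalerBr opprB.
  rewrite [X in _ = _ + X]addrA subrK.
  by rewrite [in RHS]addrA subrK.
have R0 : `|y - x - t *: (x *m Z)| <= 3 * (e2 * `|t|).
  by rewrite yx scalemxAr -mulmxBr (le_trans (mulx _))// ler_wpM2l.
have yxn : `|y - x| <= Z1 * `|t|.
  have -> : y - x = (y - x - t *: (x *m Z)) + t *: (x *m Z) by rewrite subrK.
  rewrite (le_trans (ler_normD _ _))// /Z1 mulrDl mul1r lerD//.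
    apply: (le_trans R0); rewrite -[leRHS]mul1r mulrA ler_wpM2r//.
    by rewrite -ler_pdivlMl// mulr1 ge_min lexx.
  by rewrite normrZ mulrC ler_wpM2r.
apply: (le_trans (nrD _ _)).
have t0 := normr_ge0 t.
have p1 : nr (F y - F x - dF x0 (y - x)) <= e1 * (Z1 * `|t|).
  by rewrite (le_trans (hd2 _ _ yd xd'))// ler_wpM2l// ltW.
have p2 : nr (dF x0 (y - x - t *: (x *m Z))) <= e / 4 * `|t|.
  apply: (le_trans (hB _)); apply: (@le_trans _ _ ((1 + B) * (3 * (e2 * `|t|)))).
    by rewrite ler_pM// lerDr.
  have B10 : 0 < 1 + B by rewrite ltr_pwDl.
  have -> : e / 4 * `|t| = (1 + B) * (3 * (e / (12 * (1 + B)) * `|t|)) by field; rewrite gt_eqF.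
  by rewrite !ler_wpM2l ?ler_wpM2r ?(ltW B10)// ge_min lexx orbT.
have p3 : nr (t%:C *: (dF x (x *m Z) - dF x0 (x *m Z))) <= e1 * (Z1 * `|t|).
  rewrite nrZr mulrA [leRHS]mulrC ler_wpM2l// (le_trans (hx _))// ler_wpM2l ?(ltW e10)//.
  by rewrite (le_trans (mulx _))// /Z1 lerDr.
apply: (@le_trans _ _ (e1 * (Z1 * `|t|) + (e / 4 * `|t| + e1 * (Z1 * `|t|)))).
  by rewrite lerD// (le_trans (nrD _ _))// nrN lerD.
have e1Z : e1 * Z1 <= e / 4.
  rewrite /e1 mulrAC ler_pdivrMr ?addr_gt0 ?mulr_gt0//.
  have -> : e / 4 * (4 * Z1 + 4) = e * Z1 + e by field.
  by rewrite lerDl ltW.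
have q : e1 * (Z1 * `|t|) <= e / 4 * `|t| by rewrite mulrA; exact: ler_wpM2r.
have -> : e * `|t| = e / 4 * `|t| + (e / 4 * `|t| + e / 4 * `|t|) + e / 4 * `|t| by field.
apply: ler_wpDr; first by rewrite mulr_ge0// ltW// divr_gt0.
by rewrite lerD// lerD.
Unshelve. all: by end_near. Qed.

(** Translates of [f] and the candidate [f'] lie in [S], so the error of the difference quotient is
    [iota] of a single section, bounded through [iota_le] by the uniform estimate. *)
Lemma representation_deriv f f' (g : R -> M3) (Z : M3) :
    S f -> S f' -> g 0 = 1%:M -> (forall t, SL3 (g t)) -> mx_curve_deriv g Z ->
    (forall x, SO3 x -> curve_deriv (fun t => f (x *m g t)) (f' x)) ->
  curve_deriv (fun t => pi (g t) (iota f)) (iota f').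
Proof.
move=> Sf Sf' g0 gS hg hf; apply/curve_derivP => e e0.
have b0 : 0 < 1 + iota_bound mu by rewrite ltr_pwDl// sqrtr_ge0.
have e1 : 0 < e / (1 + iota_bound mu) by rewrite divr_gt0.
apply: filterS (uniform_derivative (S_smooth Sf) g0 gS hg hf e1) => t ht.
rewrite !(rep_iota rr)//.
set ft := fun x => f (x *m g t); set fz := fun x => f (x *m g 0).
have Sft : S ft by exact: S_mulmxr.
have Sfz : S fz by exact: S_mulmxr.
pose h x := - t%:C *: f' x + (-1 *: fz x + ft x).
have Sh1 : S (fun x => -1 *: fz x + ft x) by exact: S_lin.
have Sh : S h by exact: S_lin.
have -> : iota ft - iota fz - t%:C *: iota f' = iota h.
  rewrite (iota_linear rr (- t%:C) Sf' Sh1) (iota_linear rr (-1) Sfz Sft).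
  by rewrite scaleN1r scaleNr [- iota fz + _]addrC [RHS]addrC.
have -> : e * `|t| = e / (1 + iota_bound mu) * `|t| * (1 + iota_bound mu).
  by field; rewrite gt_eqF.
apply: (@le_trans _ _ (e / (1 + iota_bound mu) * `|t| * iota_bound mu)); last first.
  by rewrite ler_wpM2l ?lerDr// mulr_ge0// ltW.
apply: (iota_le mu_haar rr Sh); first by rewrite mulr_ge0// ltW.
move=> x xS; have := ht x xS.
rewrite /h /fz /ft g0 mulmx1 scaleN1r scaleNr; congr (nr _ <= _).
by rewrite [- f x + _]addrC [RHS]addrC.
Qed.

End RepresentationDerivative.

(** * Exponentials *)

Section MatrixExponential.
Variable R : realType.

Lemma derive_quotient (f : R -> R) d : is_derive (0 : R) (1 : R) f d ->
  (fun t : R => t^-1 * (f t - f 0)) @ (0 : R)^' --> d.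
Proof.
move=> [df <-]; move: df => /(_) df; rewrite /derive.
have -> : (fun t : R => t^-1 * (f t - f 0)) = (fun h : R => h^-1 *: ((f \o shift 0) (h *: 1) - f 0)).
  by apply/funext => t; rewrite /= /GRing.scale /= mulr1 addr0.
exact: df.
Qed.

Lemma mx_curve_deriv_entries (g : R -> 'M[R]_3) (v : 'M[R]_3) :
  (forall i j, (fun t : R => t^-1 * (g t i j - g 0 i j)) @ (0 : R)^' --> (v i j : R)) ->
  mx_curve_deriv g v.
Proof.
move=> h e e0; have N : \forall t \near (0 : R)^', forall i j, `|v i j - t^-1 * (g t i j - g 0 i j)| < e.
  apply: filter_forall => i; apply: filter_forall => j.
  by have /cvgrPdist_lt := h i j; exact.
near=> t; have t0 : t != 0 by near: t; exact: nbhs_dnbhs_neq.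
apply: mx_norm_le => [|i j]; first by rewrite mulr_ge0// ltW.
rewrite !mxE.
have -> : g t i j - g 0 i j - t * v i j = - t * (v i j - t^-1 * (g t i j - g 0 i j)).
  by field.
rewrite normrM normrN mulrC ler_wpM2r// ltW//.
by have : forall i j, `|v i j - t^-1 * (g t i j - g 0 i j)| < e by near: t.
Unshelve. all: by end_near. Qed.

Lemma cvg_bigsum (T : Type) (F : set_system T) (FF : Filter F) (I : Type) (r : seq I)
    (f : I -> T -> R) (l : I -> R) : (forall i, f i @ F --> l i) ->
  (\sum_(i <- r) f i x) @[x --> F] --> \sum_(i <- r) l i.
Proof.
move=> h; elim: r => [|i r IH].
  by under eq_fun do rewrite big_nil; rewrite big_nil; exact: cvg_cst.
by under eq_fun do rewrite big_cons; rewrite big_cons; apply: cvgD.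
Qed.

Lemma expmx_conj_diag n (P Q : 'M[R]_n.+1) (d : 'rV[R]_n.+1) : Q *m P = 1%:M ->
  expmx (P *m diag_mx d *m Q) = P *m diag_mx (map_mx expR d) *m Q.
Proof.
move=> QP.
have pw k : (P *m diag_mx d *m Q) ^+ k = P *m diag_mx (map_mx (fun x => x ^+ k) d) *m Q.
  elim: k => [|k IH].
    rewrite expr0 (_ : map_mx _ _ = const_mx 1); last by apply/rowP => j; rewrite !mxE.
    by rewrite diag_const_mx mulmx1 mulmx1C.
  rewrite exprS IH -[LHS]/(_ *m _) !mulmxA -(mulmxA _ Q P) QP mulmx1 -(mulmxA P) mulmx_diag.
  congr (P *m diag_mx _ *m Q); apply/rowP => j; rewrite !mxE exprS; congr (_ * _).
rewrite /expmx; apply: cvg_lim => //; apply: (mx_cvg (F := \oo)) => i j.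
have E m : series (fun k => k`!%:R^-1 *: (P *m diag_mx d *m Q) ^+ k) m i j
   = \sum_k P i k * series (exp_coeff (d 0 k)) m * Q k j.
  rewrite /series /= summxE.
  under [LHS]eq_bigr => k _.
    rewrite mxE pw mxE; under eq_bigr do rewrite mul_mx_diag !mxE.
    rewrite mulr_sumr; over.
  rewrite exchange_big; apply: eq_bigr => k _.
  rewrite mulr_sumr mulr_suml; apply: eq_bigr => m' _.
  by rewrite /exp_coeff /=; field; rewrite pnatr_eq0 -lt0n fact_gt0.
under eq_fun do rewrite E.
have -> : (P *m diag_mx (map_mx expR d) *m Q) i j = \sum_k P i k * expR (d 0 k) * Q k j.
  by rewrite mxE; apply: eq_bigr => k _; rewrite mul_mx_diag !mxE.
apply: cvg_bigsum => k; apply: cvgMl; apply: cvgMr.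
exact: is_cvg_series_exp_coeff.
Qed.

(** Every matrix to be exponentiated (real and imaginary parts of X_r and of x_pm, and H^(i)) is
    symmetric of trace zero. An explicit diagonalization reduces [expmx] to scalar exponentials, and
    trace zero gives determinant one. *)
Definition traceless_diag n (Z : 'M[R]_n.+1) := exists (P Q : 'M[R]_n.+1) (d : 'rV[R]_n.+1),
  [/\ Q *m P = 1%:M, \sum_i d 0 i = 0 & Z = P *m diag_mx d *m Q].

Lemma expmx_entry n (P Q : 'M[R]_n.+1) (d : 'rV[R]_n.+1) t i j : Q *m P = 1%:M ->
  expmx (t *: (P *m diag_mx d *m Q)) i j = \sum_k P i k * expR (t * d 0 k) * Q k j.
Proof.
move=> QP; have -> : t *: (P *m diag_mx d *m Q) = P *m diag_mx (t *: d) *m Q.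
  by rewrite scalemxAl scalemxAr; congr (_ *m _ *m _); apply/matrixP => a b; rewrite !mxE mulrnAr.
by rewrite expmx_conj_diag// mxE; apply: eq_bigr => k _; rewrite mul_mx_diag !mxE.
Qed.

Lemma expmx0 n (Z : 'M[R]_n.+1) : expmx (0 *: Z) = 1%:M.
Proof.
have E : 0 *: Z = 1%:M *m diag_mx 0 *m 1%:M by rewrite scale0r mulmx1 mul1mx; apply/matrixP => i j; rewrite !mxE mul0rn.
rewrite E expmx_conj_diag ?mulmx1// mul1mx.
by apply/matrixP => i j; rewrite !mxE expR0.
Qed.

Lemma expmx_det n (Z : 'M[R]_n.+1) t : traceless_diag Z -> \det (expmx (t *: Z)) = 1.
Proof.
move=> [P [Q [d [QP d0 ->]]]].
have -> : t *: (P *m diag_mx d *m Q) = P *m diag_mx (t *: d) *m Q.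
  by rewrite scalemxAl scalemxAr; congr (_ *m _ *m _); apply/matrixP => a b; rewrite !mxE mulrnAr.
rewrite expmx_conj_diag// !det_mulmx mulrAC -det_mulmx (mulmx1C QP) det1 mul1r det_diag.
under eq_bigr do rewrite !mxE.
by rewrite -expR_sum -mulr_sumr d0 mulr0 expR0.
Qed.

Lemma expmx_entry_deriv n (Z : 'M[R]_n.+1) i j : traceless_diag Z ->
  (fun t : R => t^-1 * (expmx (t *: Z) i j - expmx (0 *: Z) i j)) @ (0 : R)^' --> (Z i j : R).
Proof.
move=> [P [Q [d [QP d0 ->]]]].
have -> : (fun t : R => t^-1 * (expmx (t *: (P *m diag_mx d *m Q)) i j
     - expmx (0 *: (P *m diag_mx d *m Q)) i j))
  = (fun t => \sum_k (P i k * (t^-1 * (expR (t * d 0 k) - expR (0 * d 0 k))) * Q k j)).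
  apply/funext => t; rewrite !expmx_entry// -sumrB mulr_sumr; apply: eq_bigr => k _.
  by ring.
have -> : (P *m diag_mx d *m Q) i j = \sum_k P i k * d 0 k * Q k j.
  by rewrite mxE; apply: eq_bigr => k _; rewrite mul_mx_diag !mxE.
apply: cvg_bigsum => k; apply: cvgMl; apply: cvgMr.
apply: (@derive_quotient (fun t => expR (t * d 0 k))).
apply: is_derive_eq; rewrite mul0r expR0 /GRing.scale /=; ring.
Qed.

Lemma mx_curve_derivM (g : R -> 'M[R]_3) v (a x : 'M[R]_3) : mx_curve_deriv g v ->
  mx_curve_deriv (fun t => a *m g t *m x) (a *m v *m x).
Proof.
move=> hg e e0; pose K := 9 * (`|a| * `|x|) + 1.
have K0 : 0 < K by rewrite ltr_wpDl// mulr_ge0// mulr_ge0.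
have eK : 0 < e / K by rewrite divr_gt0.
apply: filterS (hg _ eK) => t ht.
have -> : a *m g t *m x - a *m g 0 *m x - t *: (a *m v *m x) = a *m (g t - g 0 - t *: v) *m x.
  by rewrite !mulmxBr !mulmxBl -scalemxAr -scalemxAl.
set h := g t - g 0 - t *: v in ht *.
apply: (le_trans (mulmx_norm_le _ _)).
apply: (@le_trans _ _ (3 * ((3 * (`|a| * `|h|)) * `|x|))).
  by rewrite ler_wpM2l// ler_wpM2r// mulmx_norm_le.
have -> : 3 * (3 * (`|a| * `|h|) * `|x|) = 9 * (`|a| * `|x|) * `|h| by ring.
apply: (@le_trans _ _ (K * `|h|)); first by rewrite ler_wpM2r// lerDl.
by rewrite mulrC -ler_pdivlMr// mulrAC.
Qed.

Lemma traceless_expmx (Z : 'M[R]_3) : traceless_diag Z ->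
  (forall t, SL3 (expmx (t *: Z))) /\ mx_curve_deriv (fun t => expmx (t *: Z)) Z.
Proof.
move=> hZ; split=> [t|]; first exact: expmx_det.
by apply: mx_curve_deriv_entries => i j; exact: expmx_entry_deriv.
Qed.

Definition sym23 (c : R) : 'M[R]_3 := rows 3 [:: [:: 0; 0; 0]; [:: 0; 0; c]; [:: 0; c; 0]].
Definition sym13 (c : R) : 'M[R]_3 := rows 3 [:: [:: 0; 0; c]; [:: 0; 0; 0]; [:: c; 0; 0]].
Definition sym12 (c : R) : 'M[R]_3 := rows 3 [:: [:: 0; c; 0]; [:: c; 0; 0]; [:: 0; 0; 0]].
Definition diag3 (a b c : R) : 'M[R]_3 := rows 3 [:: [:: a; 0; 0]; [:: 0; b; 0]; [:: 0; 0; c]].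
Definition row3 (a b c : R) : 'rV[R]_3 := \row_j [:: a; b; c]`_j.

Lemma mul_diag3 (P Q : 'M[R]_3) a b c i j : (P *m diag_mx (row3 a b c) *m Q) i j
  = P i 0 * a * Q 0 j + P i 1 * b * Q 1 j + P i 2 * c * Q 2 j.
Proof. by rewrite mxE sum3E !mul_mx_diag !mxE. Qed.

Lemma sum_row3 a b c : \sum_i (row3 a b c) 0 i = a + b + c.
Proof. by rewrite sum3E !mxE. Qed.

Ltac mx3 := apply: matrix3P; split; rewrite ?mul_diag3 !mxE ?sum3E ?mxE /= ?mulr1n ?mulr0n; by field.

Lemma diag3_traceless a b c : a + b + c = 0 -> traceless_diag (diag3 a b c).
Proof.
move=> s; exists 1%:M, 1%:M, (row3 a b c); split; rewrite ?mulmx1 ?sum_row3//.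
by rewrite mul1mx; apply: matrix3P; split; rewrite !mxE.
Qed.

Lemma sym23_traceless c : traceless_diag (sym23 c).
Proof.
(* The eigenvectors do not depend on [c]: the untouched axis, and the sum and difference of the two
   exchanged ones. *)
exists (rows 3 [:: [:: 1; 0; 0]; [:: 0; 1; 1]; [:: 0; 1; -1]]),
  (rows 3 [:: [:: 1; 0; 0]; [:: 0; 1 / 2; 1 / 2]; [:: 0; 1 / 2; - (1 / 2)]]), (row3 0 c (- c)).
split; rewrite ?sum_row3; [mx3|ring|mx3].
Qed.

Lemma sym13_traceless c : traceless_diag (sym13 c).
Proof.
exists (rows 3 [:: [:: 1; 0; 1]; [:: 0; 1; 0]; [:: 1; 0; -1]]),
  (rows 3 [:: [:: 1 / 2; 0; 1 / 2]; [:: 0; 1; 0]; [:: 1 / 2; 0; - (1 / 2)]]), (row3 c 0 (- c)).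
split; rewrite ?sum_row3; [mx3|ring|mx3].
Qed.

Lemma sym12_traceless c : traceless_diag (sym12 c).
Proof.
exists (rows 3 [:: [:: 1; 1; 0]; [:: 1; -1; 0]; [:: 0; 0; 1]]),
  (rows 3 [:: [:: 1 / 2; 1 / 2; 0]; [:: 1 / 2; - (1 / 2); 0]; [:: 0; 0; 1]]), (row3 c (- c) 0).
split; rewrite ?sum_row3; [mx3|ring|mx3].
Qed.

Lemma Re_cmx (A B : 'M[R]_3) : map_mx (@complex.Re R) (cmx A + 'i%C *: cmx B) = A.
Proof. by apply/matrixP => i j; rewrite !mxE /=; simpc. Qed.

Lemma Im_cmx (A B : 'M[R]_3) : map_mx (@complex.Im R) (cmx A + 'i%C *: cmx B) = B.
Proof. by apply/matrixP => i j; rewrite !mxE /=; simpc. Qed.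

Lemma Xp_decomposition : [/\
  Xp R 0 = cmx (diag3 0 1 (-1)) + 'i%C *: cmx (sym23 (-1)),
  Xp R 1 = cmx (sym13 (- 2^-1)) + 'i%C *: cmx (sym12 (- 2^-1)),
  Xp R 2 = cmx (diag3 (- (2 / 3)) 3^-1 3^-1) + 'i%C *: cmx (sym23 0),
  Xp R 3 = cmx (sym13 2^-1) + 'i%C *: cmx (sym12 (- 2^-1))
  & Xp R 4 = cmx (diag3 0 1 (-1)) + 'i%C *: cmx (sym23 1)].
Proof.
by split; rewrite XpE /Xi; apply: matrix3P; split; rewrite !mxE /=
    ?(rmorph0, rmorph1, rmorphN, rmorphM, fmorphV, rmorph_nat); field.
Qed.

Lemma Xp_parts r : (r <= 4)%N -> traceless_diag (map_mx (@complex.Re R) (Xp R r))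
  /\ traceless_diag (map_mx (@complex.Im R) (Xp R r)).
Proof.
have [x0 x1 x2 x3 x4] := Xp_decomposition.
have t0 : traceless_diag (diag3 0 1 (-1)) by apply: diag3_traceless; ring.
have t2 : traceless_diag (diag3 (- (2 / 3)) 3^-1 3^-1) by apply: diag3_traceless; field.
have t23 := sym23_traceless; have t13 := sym13_traceless; have t12 := sym12_traceless.
by move=> r4; case: (nat_le4 r4) => [||| []] ->; rewrite ?(x0, x1, x2, x3, x4) Re_cmx Im_cmx.
Qed.

End MatrixExponential.

(** * Derivatives of matrix coefficients *)

Section PolynomialCurves.
Variable R : realType.
Local Notation C := R[i].
Local Notation cd := (curve_deriv (W := C^o)).

Lemma curve_deriv_sum (W : normedModType C) (I : Type) (r : seq I) (f : I -> R -> W) (f' : I -> W) :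
  (forall i, curve_deriv (f i) (f' i)) ->
  curve_deriv (fun t => \sum_(i <- r) f i t) (\sum_(i <- r) f' i).
Proof.
move=> h; elim: r => [|i r IH].
  by under eq_fun do rewrite big_nil; rewrite big_nil; exact: curve_deriv_cst.
by under eq_fun do rewrite big_cons; rewrite big_cons; apply: curve_derivD.
Qed.

Lemma curve_deriv_mul (f g : R -> C) f' g' : cd f f' -> cd g g' ->
  cd (fun t => f t * g t) (f' * g 0 + f 0 * g').
Proof. by move=> hf hg; exact: (curve_derivM hf hg). Qed.

Definition pcurve_deriv (P : R -> {poly C}) (P' : {poly C}) :=
  forall a, cd (fun t => (P t)`_a) P'`_a.

Lemma pcurve_derivM P Q P' Q' : pcurve_deriv P P' -> pcurve_deriv Q Q' ->
  pcurve_deriv (fun t => P t * Q t) (P' * Q 0 + P 0 * Q').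
Proof.
move=> hP hQ a; rewrite coefD !coefM -big_split /=; under eq_fun do rewrite coefM.
apply: curve_deriv_sum => i; exact: curve_deriv_mul.
Qed.

Lemma pcurve_derivX P P' n : pcurve_deriv P P' ->
  pcurve_deriv (fun t => P t ^+ n) (n%:R *: (P 0 ^+ n.-1 * P')).
Proof.
move=> hP; elim: n => [|n IH] a.
  have -> : (0%:R *: (P 0 ^+ 0.-1 * P'))`_a = 0 by rewrite scale0r coef0.
  have -> : (fun t => (P t ^+ 0)`_a) = (fun=> (1 : {poly C})`_a) by [].
  exact: curve_deriv_cst.
have h := pcurve_derivM hP IH; have {h} := h a; under eq_fun do rewrite -exprS.
congr (cd _ _`_a); case: n {IH} => [|n] /=; first by rewrite scale0r mulr0 addr0 expr0 scale1r !mulr1 mul1r.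
rewrite -scalerAr mulrA -exprS mulrC -[X in X + _]scale1r -scalerDl.
by rewrite -[1]/(1%:R) -natrD.
Qed.

Lemma pcurve_deriv_linear (f g : R -> C) f' g' : cd f f' -> cd g g' ->
  pcurve_deriv (fun t => f t *: 'X + (g t)%:P) (f' *: 'X + g'%:P).
Proof.
move=> hf hg a; under eq_fun do rewrite coefD coefZ coefC coefX.
rewrite coefD coefZ coefC coefX; apply: curve_derivD.
  have := curve_deriv_mul hf (curve_deriv_cst (W := C^o) ((a == 1%N)%:R : C)).
  by rewrite mulr0 addr0.
by case: (a == 0%N); [exact: hg|exact: curve_deriv_cst].
Qed.

(** The infinitesimal action of gl(2) on V_L at the identity: diagonal directions scale the
    monomial, off-diagonal ones move its exponent by one. *)
Lemma subst_coef_deriv (M : R -> 'M[C]_2) (a' b' c' d' : C) L p q :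
    M 0 = 1%:M -> cd (fun t => M t 0 0) a' -> cd (fun t => M t 0 1) b' ->
    cd (fun t => M t 1 0) c' -> cd (fun t => M t 1 1) d' -> (q <= L)%N ->
  cd (fun t => subst_coef (M t) L p q)
    (q%:R * (a' * (p == q)%:R + b' * (p.+1 == q)%:R)
     + (L - q)%:R * (c' * (p == q.+1)%:R + d' * (p == q)%:R)).
Proof.
move=> M0 ha hb hc hd qL.
have h1 := pcurve_derivX (n := q) (pcurve_deriv_linear ha hb).
have h2 := pcurve_derivX (n := L - q) (pcurve_deriv_linear hc hd).
have h := pcurve_derivM h1 h2; have {h} := h p; rewrite !M0 !mxE /= !scale1r !scale0r add0r addr0 polyC1 !expr1n !mul1r !mulr1.
congr (cd _ _); rewrite coefD -scalerAr !coefZ; congr (_ + _ * _).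
  case: q {h1 h2 qL} => [|q] /=; first by rewrite !mul0r.
  rewrite mulrDr coefD -scalerAr coefZ -exprSr coefXn mulrC [_ * b'%:P]mulrC mul_polyC coefZ coefXn eqSS.
  by rewrite mulrC.
by rewrite mulrDr coefD -scalerAr coefZ -exprSr coefXn [_ * d'%:P]mulrC mul_polyC coefZ coefXn.
Qed.

(** [z] may be any integer, so shifts by one past either end come out as 0 with no case
    distinction. *)
Lemma delta_sum n (z : int) (G : int -> C) : (forall c : int, ~~ (0 <= c <= n%:Z) -> G c = 0) ->
  \sum_(c < n.+1) (c%:Z == z)%:R * G c%:Z = G z.
Proof.
move=> G0; have [/andP[z0 zn]|h] := boolP (0 <= z <= n%:Z); last first.
  rewrite G0// big1// => c _; case: eqP => [E|]; last by rewrite mul0r.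
  by move: h; rewrite -E lez_nat -ltnS ltn_ord.
case: z z0 zn => [z|//] _ zn; have zn' : (z < n.+1)%N by lia.
rewrite (bigD1 (Ordinal zn'))//= eqxx mul1r big1 ?addr0// => c.
by rewrite -val_eqE /= => /negbTE h; rewrite eqz_nat h mul0r.
Qed.

Lemma kcoef_out (L p q : int) (x : 'M[R]_3) : ~~ (0 <= p <= L) -> kcoef L p q x = 0.
Proof. by move=> h; apply: wcoef_out; apply: contra h => /and4P[-> ->]. Qed.

(** By [kcoefM] only the factor at [phi (u t)] moves, and it is differentiated by
    [subst_coef_deriv]. The diagonal derivatives [a'] and [- a'] reflect that su(2) is traceless. *)
Lemma kcoef_deriv (l q : nat) (a : int) (u : R -> 'M[C]_2) (a' b' c' : C) (y : 'M[R]_3) :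
    (forall t, SU2 (u t)) -> u 0 = 1%:M ->
    cd (fun t => invmx (u t) 0 0) a' -> cd (fun t => invmx (u t) 0 1) b' ->
    cd (fun t => invmx (u t) 1 0) c' -> cd (fun t => invmx (u t) 1 1) (- a') ->
    SO3 y -> 0 <= a <= 2 * l%:Z -> (q <= 2 * l)%N ->
  cd (fun t => kcoef (2 * l%:Z) a q (phi (u t) *m y))
    (2 * (a%:~R - l%:R) * a' * kcoef (2 * l%:Z) a q y + (a%:~R + 1) * b' * kcoef (2 * l%:Z) (a + 1) q y
     + (2 * l%:R - a%:~R + 1) * c' * kcoef (2 * l%:Z) (a - 1) q y).
Proof.
move=> uS u0 ha hb hc hd yS al ql.
have E t : kcoef (2 * l%:Z) a q (phi (u t) *m y) = \sum_(c < (2 * l).+1)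
    subst_coef (invmx (u t)) (2 * l) `|a|%N c * kcoef (2 * l%:Z) c q y.
  rewrite kcoefM//; last exact: SU2_phi_SO3.
  apply: eq_bigr => c _; rewrite kcoef_phi//; congr (_ * _).
  have c2l : (c <= 2 * l)%N by rewrite -ltnS.
  case: a al {ha hb hc hd} => [a|//] al; rewrite -PoszM wcoefE//; lia.
under eq_fun do rewrite E.
have a0 : `|a|%N%:Z = a by lia.
pose T' c : C := c%:R * (a' * (`|a|%N == c)%:R + b' * (`|a|%N.+1 == c)%:R)
     + (2 * l - c)%:R * (c' * (`|a|%N == c.+1)%:R - a' * (`|a|%N == c)%:R).
have D : cd (fun t => \sum_(c < (2 * l).+1)
    subst_coef (invmx (u t)) (2 * l) `|a|%N c * kcoef (2 * l%:Z) c q y)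
   (\sum_(c < (2 * l).+1) T' c * kcoef (2 * l%:Z) c q y).
  apply: curve_deriv_sum => c; have c2l : (c <= 2 * l)%N by rewrite -ltnS.
  have M0 : invmx (u 0) = 1%:M by rewrite u0 invmx1.
  have h := subst_coef_deriv (p := `|a|%N) M0 ha hb hc hd c2l.
  have h2 := curve_deriv_mul h (curve_deriv_cst (W := C^o) (kcoef (2 * l%:Z) c q y)).
  by move: h2; congr (cd _ _); rewrite mulr0 addr0 /T' mulNr.
move: D; congr (cd _ _).
pose G1 c := 2 * (a%:~R - l%:R) * a' * kcoef (2 * l%:Z) c q y.
pose G2 c := (a%:~R + 1) * b' * kcoef (2 * l%:Z) c q y.
pose G3 c := (2 * l%:R - a%:~R + 1) * c' * kcoef (2 * l%:Z) c q y.
have Gout (k : C) c : ~~ (0 <= c <= (2 * l)%N%:Z) -> k * kcoef (2 * l%:Z) c q y = 0.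
  by rewrite PoszM => h; rewrite kcoef_out// mulr0.
rewrite -[RHS]/(G1 a + G2 (a + 1) + G3 (a - 1)).
rewrite -(@delta_sum (2 * l) a G1)//; last by move=> c; exact: Gout.
rewrite -(@delta_sum (2 * l) (a + 1) G2)//; last by move=> c; exact: Gout.
rewrite -(@delta_sum (2 * l) (a - 1) G3)//; last by move=> c; exact: Gout.
rewrite -!big_split /=; apply: eq_bigr => c _.
have c2l : (c <= 2 * l)%N by rewrite -ltnS.
rewrite /T' natrB// natrM /G1 /G2 /G3.
have -> : (`|a|%N == c :> nat) = (c%:Z == a) by apply/eqP/eqP; lia.
have -> : (`|a|%N.+1 == c :> nat) = (c%:Z == a + 1) by apply/eqP/eqP; lia.
have -> : (`|a|%N == c.+1 :> nat) = (c%:Z == a - 1) by apply/eqP/eqP; lia.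
move: (kcoef _ _ _ _) => k.
have cR : c%:R = (c%:Z)%:~R :> C by [].
have e1 : (a == a + 1) = false by lia.
have e2 : (a == a - 1) = false by lia.
have e3 : (a + 1 == a - 1) = false by lia.
rewrite {}cR; move: (Posz c) => z.
have [->|_] := eqVneq z a; first by rewrite e1 e2 /=; ring.
have [->|_] := eqVneq z (a + 1); first by rewrite e3 rmorphD /=; ring.
by have [->|_] := eqVneq z (a - 1); rewrite ?rmorphB /=; ring.
Qed.

End PolynomialCurves.

(** * Rotations along the three coordinate axes *)

Section OneParameterSubgroups.
Variable R : realType.
Local Notation C := R[i].
Local Notation cd := (curve_deriv (W := C^o)).

Lemma curve_deriv_complex (f g : R -> R) f' g' : is_derive (0 : R) (1 : R) f f' ->
  is_derive (0 : R) (1 : R) g g' -> cd (fun t => f t +i* g t) (f' +i* g').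
Proof.
move=> hf hg; have h1 := curve_deriv_real (derive_quotient hf).
have h2 := curve_derivZ (a := 'i%C) (curve_deriv_real (derive_quotient hg)).
have := curve_derivD h1 h2.
have E (a b : R) : a%:C + 'i%C *: (b%:C : C^o) = a +i* b by rewrite [RHS]complexE.
by rewrite E; under eq_fun do rewrite E.
Qed.

Lemma quat00 p q r s : quat p q r s 0 0 = p +i* q :> C. Proof. by case: (quatE p q r s). Qed.
Lemma quat01 p q r s : quat p q r s 0 1 = r +i* s :> C. Proof. by case: (quatE p q r s). Qed.
Lemma quat10 p q r s : quat p q r s 1 0 = (- r) +i* s :> C. Proof. by case: (quatE p q r s). Qed.
Lemma quat11 p q r s : quat p q r s 1 1 = p +i* (- q) :> C. Proof. by case: (quatE p q r s). Qed.

(** The entries are 2 and -2 because [phi] doubles the angle of [uq], [ur] and [us]. *)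
Definition kq : 'M[R]_3 := rows 3 [:: [:: 0; 0; 0]; [:: 0; 0; -2]; [:: 0; 2; 0]].
Definition kr : 'M[R]_3 := rows 3 [:: [:: 0; 0; 2]; [:: 0; 0; 0]; [:: -2; 0; 0]].
Definition ks : 'M[R]_3 := rows 3 [:: [:: 0; -2; 0]; [:: 2; 0; 0]; [:: 0; 0; 0]].

Lemma is_derive_cos0 : is_derive (0 : R) (1 : R) cos 0.
Proof. by apply: is_derive_eq; rewrite sin0 oppr0. Qed.

Lemma is_derive_sin0 : is_derive (0 : R) (1 : R) sin 1.
Proof. by apply: is_derive_eq; rewrite cos0. Qed.

Lemma is_derive_Nsin0 : is_derive (0 : R) (1 : R) (fun t : R => - sin t : R) (- 1).
Proof. by apply: is_derive_eq; rewrite cos0. Qed.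

Lemma is_derive_00 : is_derive (0 : R) (1 : R) (fun=> 0 : R) 0.
Proof. exact: is_derive_cst. Qed.

Let cs (t : R) : cos t ^+ 2 + sin t ^+ 2 = 1. Proof. exact: cos2Dsin2. Qed.

Lemma is_derive_cos2 : is_derive (0 : R) (1 : R) (fun t => cos t ^+ 2 - sin t ^+ 2) 0.
Proof. by apply: is_derive_eq; rewrite /GRing.scale /= sin0 cos0; ring. Qed.

Lemma is_derive_cossin k : is_derive (0 : R) (1 : R) (fun t => k * (cos t * sin t)) k.
Proof. by apply: is_derive_eq; rewrite /GRing.scale /= sin0 cos0; ring. Qed.

Lemma is_derive_one : is_derive (0 : R) (1 : R) (fun t => cos t ^+ 2 + sin t ^+ 2) 0.
Proof. by under eq_fun do rewrite cs; exact: is_derive_cst. Qed.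

Lemma phi_curve_entries (u : R -> 'M[C]_2) (v : 'M[R]_3) :
  (forall i j, is_derive (0 : R) (1 : R) (fun t => phi (u t) i j) (v i j)) ->
  mx_curve_deriv (fun t => phi (u t)) v.
Proof. by move=> h; apply: mx_curve_deriv_entries => i j; exact: derive_quotient. Qed.

Definition uq (t : R) := quat (cos t) (sin t) 0 0.
Definition ur (t : R) := quat (cos t) 0 (sin t) 0.
Definition us (t : R) := quat (cos t) 0 0 (sin t).

Lemma uq_SU2 t : SU2 (uq t).
Proof. by apply: quat_SU2; rewrite cs expr0n /= !addr0. Qed.
Lemma ur_SU2 t : SU2 (ur t).
Proof. by apply: quat_SU2; rewrite expr0n /= !addr0 cs. Qed.
Lemma us_SU2 t : SU2 (us t).
Proof. by apply: quat_SU2; rewrite expr0n /= !addr0 cs. Qed.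

Lemma uq0 : uq 0 = 1%:M. Proof. by rewrite /uq cos0 sin0 quat1. Qed.
Lemma ur0 : ur 0 = 1%:M. Proof. by rewrite /ur cos0 sin0 quat1. Qed.
Lemma us0 : us 0 = 1%:M. Proof. by rewrite /us cos0 sin0 quat1. Qed.

Lemma phi_uq : mx_curve_deriv (fun t => phi (uq t)) kq.
Proof.
apply: phi_curve_entries => i j.
suff h : forall i j, is_derive (0 : R) (1 : R) (fun t => phi (uq t) i j) (kq i j) by exact: h.
by do 2 apply: ord3P; under eq_fun do
    rewrite /uq phi_quat mxE /= ?(mul0r, mulr0, subrr, expr0n, subr0, addr0, add0r, sub0r, oppr0) /=;
  rewrite mxE /=; first [exact: is_derive_one|exact: is_derive_cos2|exact: is_derive_cossin|exact: is_derive_00].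
Qed.

Lemma phi_ur : mx_curve_deriv (fun t => phi (ur t)) kr.
Proof.
apply: phi_curve_entries => i j.
suff h : forall i j, is_derive (0 : R) (1 : R) (fun t => phi (ur t) i j) (kr i j) by exact: h.
by do 2 apply: ord3P; under eq_fun do
    rewrite /ur phi_quat mxE /= ?(mul0r, mulr0, subrr, expr0n, subr0, addr0, add0r, sub0r, oppr0) /=;
  rewrite mxE /=; first [exact: is_derive_one|exact: is_derive_cos2|exact: is_derive_cossin|exact: is_derive_00].
Qed.

Lemma phi_us : mx_curve_deriv (fun t => phi (us t)) ks.
Proof.
apply: phi_curve_entries => i j.
suff h : forall i j, is_derive (0 : R) (1 : R) (fun t => phi (us t) i j) (ks i j) by exact: h.
by do 2 apply: ord3P; under eq_fun do
    rewrite /us phi_quat mxE /= ?(mul0r, mulr0, subrr, expr0n, subr0, addr0, add0r, sub0r, oppr0) /=;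
  rewrite mxE /=; first [exact: is_derive_one|exact: is_derive_cos2|exact: is_derive_cossin|exact: is_derive_00].
Qed.

Lemma invmx_uq t : invmx (uq t) = quat (cos t) (- sin t) 0 0.
Proof. by rewrite /uq quat_inv ?oppr0// expr0n /= !addr0 cs. Qed.
Lemma invmx_ur t : invmx (ur t) = quat (cos t) 0 (- sin t) 0.
Proof. by rewrite /ur quat_inv ?oppr0// expr0n /= !addr0 cs. Qed.
Lemma invmx_us t : invmx (us t) = quat (cos t) 0 0 (- sin t).
Proof. by rewrite /us quat_inv ?oppr0// expr0n /= !addr0 cs. Qed.

Let cos' := is_derive_cos0.
Let nsin' := is_derive_Nsin0.
Let zero' := is_derive_00.
Let sin' := is_derive_sin0.

Lemma kcoef_uq (l q : nat) (a : int) (y : 'M[R]_3) : SO3 y -> 0 <= a <= 2 * l%:Z -> (q <= 2 * l)%N ->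
  cd (fun t => kcoef (2 * l%:Z) a q (phi (uq t) *m y))
   (- (2 * 'i%C * (a%:~R - l%:R)) * kcoef (2 * l%:Z) a q y).
Proof.
move=> yS al ql.
have h00 : cd (fun t => invmx (uq t) 0 0) (0 +i* (- 1)).
  under eq_fun do rewrite invmx_uq quat00; exact: curve_deriv_complex.
have h11 : cd (fun t => invmx (uq t) 1 1) (- (0 +i* (- 1))).
  under eq_fun do rewrite invmx_uq quat11 opprK.
  by rewrite -[- _]/((- 0) +i* (- - 1)) oppr0 opprK; exact: curve_deriv_complex.
have h01 : cd (fun t => invmx (uq t) 0 1) (0 +i* 0).
  under eq_fun do rewrite invmx_uq quat01; exact: curve_deriv_complex.
have h10 : cd (fun t => invmx (uq t) 1 0) (0 +i* 0).
  under eq_fun do rewrite invmx_uq quat10 oppr0; exact: curve_deriv_complex.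
have := kcoef_deriv uq_SU2 uq0 h00 h01 h10 h11 yS al ql.
have -> : 0 +i* (-1) = - 'i%C :> C by apply/eqP; rewrite eq_complex /= oppr0 !eqxx.
rewrite -[0 +i* 0]/(0 : C) !mulr0 !mul0r !addr0; congr (cd _ (_ * _)); ring.
Qed.

Lemma kcoef_ur (l q : nat) (a : int) (y : 'M[R]_3) : SO3 y -> 0 <= a <= 2 * l%:Z -> (q <= 2 * l)%N ->
  cd (fun t => kcoef (2 * l%:Z) a q (phi (ur t) *m y))
   (- ((a%:~R + 1) * kcoef (2 * l%:Z) (a + 1) q y) + (2 * l%:R - a%:~R + 1) * kcoef (2 * l%:Z) (a - 1) q y).
Proof.
move=> yS al ql.
have h00 : cd (fun t => invmx (ur t) 0 0) (0 +i* 0).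
  under eq_fun do rewrite invmx_ur quat00; exact: curve_deriv_complex.
have h11 : cd (fun t => invmx (ur t) 1 1) (- (0 +i* 0)).
  under eq_fun do rewrite invmx_ur quat11 oppr0.
  by rewrite -[- _]/((- 0) +i* (- 0)) oppr0; exact: curve_deriv_complex.
have h01 : cd (fun t => invmx (ur t) 0 1) (- 1 +i* 0).
  under eq_fun do rewrite invmx_ur quat01; exact: curve_deriv_complex.
have h10 : cd (fun t => invmx (ur t) 1 0) (1 +i* 0).
  under eq_fun do rewrite invmx_ur quat10 opprK; exact: curve_deriv_complex.
have := kcoef_deriv ur_SU2 ur0 h00 h01 h10 h11 yS al ql.
have -> : (- 1) +i* 0 = - 1 :> C by apply/eqP; rewrite eq_complex /= oppr0 !eqxx.
rewrite -[0 +i* 0]/(0 : C) -[1 +i* 0]/(1 : C); congr (cd _ _); ring.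
Qed.

Lemma kcoef_us (l q : nat) (a : int) (y : 'M[R]_3) : SO3 y -> 0 <= a <= 2 * l%:Z -> (q <= 2 * l)%N ->
  cd (fun t => kcoef (2 * l%:Z) a q (phi (us t) *m y))
   (- ('i%C * ((a%:~R + 1) * kcoef (2 * l%:Z) (a + 1) q y + (2 * l%:R - a%:~R + 1) * kcoef (2 * l%:Z) (a - 1) q y))).
Proof.
move=> yS al ql.
have h00 : cd (fun t => invmx (us t) 0 0) (0 +i* 0).
  under eq_fun do rewrite invmx_us quat00; exact: curve_deriv_complex.
have h11 : cd (fun t => invmx (us t) 1 1) (- (0 +i* 0)).
  under eq_fun do rewrite invmx_us quat11 oppr0.
  by rewrite -[- _]/((- 0) +i* (- 0)) oppr0; exact: curve_deriv_complex.
have h01 : cd (fun t => invmx (us t) 0 1) (0 +i* (- 1)).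
  under eq_fun do rewrite invmx_us quat01; exact: curve_deriv_complex.
have h10 : cd (fun t => invmx (us t) 1 0) (0 +i* (- 1)).
  under eq_fun do rewrite invmx_us quat10 oppr0; exact: curve_deriv_complex.
have := kcoef_deriv us_SU2 us0 h00 h01 h10 h11 yS al ql.
have -> : 0 +i* (-1) = - 'i%C :> C by apply/eqP; rewrite eq_complex /= oppr0 !eqxx.
rewrite -[0 +i* 0]/(0 : C); congr (cd _ _); ring.
Qed.

End OneParameterSubgroups.

(** * Left derivatives of sections *)

Section ComplexifiedDerivative.
Variables (R : realType) (W : normedModType R[i]).
Local Notation C := R[i].
Local Notation M3 := 'M[R]_3.

(** Extends L to complex directions in the same way as [differential] extends a representation. *)
Definition LC (L : M3 -> W) (Z : 'M[C]_3) : W :=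
  L (map_mx (@complex.Re R) Z) + 'i%C *: L (map_mx (@complex.Im R) Z).

Section LinearL.
Variable L : M3 -> W.
Hypothesis lL : real_linear L.

Lemma LC_cmx Y : LC L (cmx Y) = L Y.
Proof.
rewrite /LC (_ : map_mx (@complex.Im R) (cmx Y) = 0); last by apply/matrixP => i j; rewrite !mxE.
rewrite real_linear0// scaler0 addr0; congr L.
by apply/matrixP => i j; rewrite !mxE.
Qed.

Lemma LC_lin (a : C) Z Z' : LC L (a *: Z + Z') = a *: LC L Z + LC L Z'.
Proof.
rewrite /LC.
have -> : map_mx (@complex.Re R) (a *: Z + Z') = complex.Re a *: map_mx (@complex.Re R) Z
   + ((- complex.Im a) *: map_mx (@complex.Im R) Z + map_mx (@complex.Re R) Z').
  by apply/matrixP => i j; rewrite !mxE; case: a (Z i j) (Z' i j) => [a b] [c d] [c' d'] /=; ring.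
have -> : map_mx (@complex.Im R) (a *: Z + Z') = complex.Re a *: map_mx (@complex.Im R) Z
   + (complex.Im a *: map_mx (@complex.Re R) Z + map_mx (@complex.Im R) Z').
  by apply/matrixP => i j; rewrite !mxE; case: a (Z i j) (Z' i j) => [a b] [c d] [c' d'] /=; ring.
rewrite !(real_linearD lL) !(real_linearZ lL).
move: (L (map_mx (@complex.Re R) Z)) (L (map_mx (@complex.Im R) Z))
  (L (map_mx (@complex.Re R) Z')) (L (map_mx (@complex.Im R) Z')) => v1 v2 v3 v4.
have -> : a *: (v1 + 'i%C *: v2) = (complex.Re a)%:C *: v1 + ('i%C * (complex.Im a)%:C) *: v1
    + ((complex.Re a)%:C * 'i%C) *: v2 + (- complex.Im a)%:C *: v2.
  rewrite {1}[a]complexE scalerDr !scalerDl !scalerA.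
  have -> : 'i%C * (complex.Im a)%:C * 'i%C = (- complex.Im a)%:C.
    by rewrite mulrAC -expr2 sqr_i mulN1r rmorphN.
  by rewrite !addrA.
rewrite !scalerDr !scalerA [(complex.Re a)%:C * 'i%C]mulrC.
by rewrite [LHS](AC ((1*2)*(1*2)) (1*5*4*2*(3*6)))%AC.
Qed.

Lemma LC0 : LC L 0 = 0.
Proof. by have := LC_lin 1 0 0; rewrite scaler0 addr0 scale1r => /esym/eqP; rewrite -subr_eq0 addrK => /eqP. Qed.

Lemma LCD Z Z' : LC L (Z + Z') = LC L Z + LC L Z'.
Proof. by have := LC_lin 1 Z Z'; rewrite !scale1r. Qed.

Lemma LCZ a Z : LC L (a *: Z) = a *: LC L Z.
Proof. by have := LC_lin a Z 0; rewrite !addr0 LC0 addr0. Qed.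

Lemma LC_sum (I : Type) (r : seq I) (f : I -> 'M[C]_3) :
  LC L (\sum_(i <- r) f i) = \sum_(i <- r) LC L (f i).
Proof. exact: (big_morph _ LCD LC0). Qed.

End LinearL.

Lemma cmxM Y Y' : cmx (Y *m Y' : M3) = cmx Y *m cmx Y'.
Proof. exact: map_mxM. Qed.

End ComplexifiedDerivative.

Section KPart.
Variables (R : realType) (W : normedModType R[i]).
Local Notation C := R[i].
Local Notation M3 := 'M[R]_3.
Variables (l q : nat) (c y : M3) (f : M3 -> W) (L : M3 -> W) (a1 a2 : int) (w1 w2 : W).
Hypotheses (ql : (q <= 2 * l)%N) (cS : SO3 c) (yS : SO3 y).
Hypotheses (a1l : 0 <= a1 <= 2 * l%:Z) (a2l : 0 <= a2 <= 2 * l%:Z).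
Local Notation K a x := (kcoef (2 * l%:Z) a q x).
Hypothesis hf : forall x, SO3 x -> f x = K a1 (c^T *m x) *: w1 + K a2 (c^T *m x) *: w2.
Hypothesis lL : real_linear L.
Hypothesis hL : forall (g : R -> M3) v, g 0 = c *m y -> (forall t, SL3 (g t)) ->
  mx_curve_deriv g v -> curve_deriv (f \o g) (L v).

(** Along the curve c phi(u t) y the factor c is cancelled by the transpose of c in the formula for
    [f], leaving left rotations of the two matrix coefficients. *)
Lemma L_rotation (u : R -> 'M[C]_2) v (T' : int -> C) : (forall t, SU2 (u t)) -> u 0 = 1%:M ->
    mx_curve_deriv (fun t => phi (u t)) v ->
    (forall a : int, 0 <= a <= 2 * l%:Z -> curve_deriv (W := C^o) (fun t => K a (phi (u t) *m y)) (T' a)) ->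
  L (c *m v *m y) = T' a1 *: w1 + T' a2 *: w2.
Proof.
move=> uS u0 hv hT.
have phi1 : phi (1%:M : 'M[C]_2) = 1%:M.
  by rewrite -quat1 phi_quat; apply: matrix3P; split; rewrite !mxE /= ?mulr1n ?mulr0n; ring.
have gS t : SO3 (c *m phi (u t) *m y).
  by apply: SO3_mul => //; apply: SO3_mul => //; exact: SU2_phi_SO3.
have h1 := hL (g := fun t => c *m phi (u t) *m y) _ (fun t => SO3_SL3 (gS t)) (mx_curve_derivM c y hv).
have g0 : c *m phi (u 0) *m y = c *m y by rewrite u0 phi1 mulmx1.
have {}h1 := h1 g0.
apply: curve_deriv_unique h1 _.
have -> : f \o (fun t => c *m phi (u t) *m y) =
   (fun t => K a1 (phi (u t) *m y) *: w1 + K a2 (phi (u t) *m y) *: w2).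
  apply/funext => t; rewrite [LHS]/= hf; last exact: gS.
  by rewrite -[c *m _ *m y]mulmxA [c^T *m _]mulmxA (SO3_trVmul cS) mul1mx.
have h2 := curve_derivM (hT _ a1l) (curve_deriv_cst w1).
have h3 := curve_derivM (hT _ a2l) (curve_deriv_cst w2).
by have := curve_derivD h2 h3; congr (curve_deriv _ _); rewrite !scaler0 !addr0.
Qed.

Lemma L_kq : L (c *m kq R *m y) = (- (2 * 'i%C * (a1%:~R - l%:R)) * K a1 y) *: w1
   + (- (2 * 'i%C * (a2%:~R - l%:R)) * K a2 y) *: w2.
Proof.
apply: (L_rotation (T' := fun a => - (2 * 'i%C * (a%:~R - l%:R)) * K a y) (@uq_SU2 R) (@uq0 R) (@phi_uq R)).
by move=> a al; exact: kcoef_uq.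
Qed.

Lemma L_kr : let T' a := - ((a%:~R + 1) * K (a + 1) y) + (2 * l%:R - a%:~R + 1) * K (a - 1) y in
  L (c *m kr R *m y) = T' a1 *: w1 + T' a2 *: w2.
Proof.
move=> T'; apply: (L_rotation (T' := T') (@ur_SU2 R) (@ur0 R) (@phi_ur R)).
by move=> a al; exact: kcoef_ur.
Qed.

Lemma L_ks : let T' a := - ('i%C * ((a%:~R + 1) * K (a + 1) y + (2 * l%:R - a%:~R + 1) * K (a - 1) y)) in
  L (c *m ks R *m y) = T' a1 *: w1 + T' a2 *: w2.
Proof.
move=> T'; apply: (L_rotation (T' := T') (@us_SU2 R) (@us0 R) (@phi_us R)).
by move=> a al; exact: kcoef_us.
Qed.

End KPart.

Section LeftDerivative.
Variables (R : realType) (W : normedModType R[i]).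
Local Notation C := R[i].
Local Notation M3 := 'M[R]_3.
Variables (c y : M3) (L : M3 -> W).
Hypothesis lL : real_linear L.

(* L is the derivative of a section at c y, and Z is transported to the left by c Z c^-1. *)
Definition DL (Z : 'M[C]_3) : W := LC L (cmx c *m Z *m cmx y).

Lemma DLD Z Z' : DL (Z + Z') = DL Z + DL Z'.
Proof. by rewrite /DL mulmxDr mulmxDl LCD. Qed.

Lemma DLZ a Z : DL (a *: Z) = a *: DL Z.
Proof. by rewrite /DL -scalemxAr -scalemxAl LCZ. Qed.

Lemma DLN Z : DL (- Z) = - DL Z.
Proof. by rewrite -scaleN1r DLZ scaleN1r. Qed.

Lemma DL_cmx Y : DL (cmx Y) = L (c *m Y *m y).
Proof. by rewrite /DL -!cmxM LC_cmx. Qed.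

Lemma DL_right r : SO3 c -> SO3 y -> (r <= 4)%N -> LC L (cmx (c *m y) *m Xp R r)
  = \sum_(r' < 5) subst_coef (invmx (su2_lift y)) 4 r' r *: DL (Xp R r').
Proof.
move=> cS yS r4; have [uS ux] := su2_liftP yS.
have := phi_Xp uS r4; rewrite ux => E.
have yy : (cmx y)^T *m cmx y = 1%:M.
  by rewrite /cmx map_trmx -map_mxM (SO3_trVmul yS) map_mx1.
have -> : cmx (c *m y) *m Xp R r = cmx c *m (\sum_(r' < 5) subst_coef (invmx (su2_lift y)) 4 r' r *: Xp R r') *m cmx y.
  by rewrite -E cmxM -!mulmxA yy mulmx1.
rewrite mulmx_sumr mulmx_suml (LC_sum lL); apply: eq_bigr => r' _.
by rewrite -DLZ.
Qed.

Definition E3 (i j : 'I_3) : M3 := delta_mx i j.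

Lemma Xp13_upper : 
  Xp R 1 = - 'i%C *: cmx (E3 0 1) + (- cmx (E3 0 2) + (- ('i%C / 4) *: cmx (ks R) + 4^-1 *: cmx (kr R))) /\
  Xp R 3 = - 'i%C *: cmx (E3 0 1) + (cmx (E3 0 2) + (- ('i%C / 4) *: cmx (ks R) - 4^-1 *: cmx (kr R))).
Proof.
by split; rewrite XpE /Xi; apply: matrix3P; split; rewrite !mxE /= ?(rmorph0, rmorph1, rmorphN, rmorph_nat); field.
Qed.

(** The transpose of [Xp13_upper]: X_1 and X_3 are symmetric, the so(3)-part is antisymmetric and
    changes sign. It serves P_2, since conjugation by [u_c] moves these lower triangular entries
    into the unipotent radical. *)
Lemma Xp13_lower : 
  Xp R 1 = - 'i%C *: cmx (E3 1 0) + (- cmx (E3 2 0) - (- ('i%C / 4) *: cmx (ks R) + 4^-1 *: cmx (kr R))) /\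
  Xp R 3 = - 'i%C *: cmx (E3 1 0) + (cmx (E3 2 0) - (- ('i%C / 4) *: cmx (ks R) - 4^-1 *: cmx (kr R))).
Proof.
by split; rewrite XpE /Xi; apply: matrix3P; split; rewrite !mxE /= ?(rmorph0, rmorph1, rmorphN, rmorph_nat); field.
Qed.

(** Used for the Borel subgroup only: for P_1 and P_2, X_0 and X_4 are conjugate into the
    complexified Levi block and act through D_k. *)
Lemma Xp04_torus : 
  Xp R 0 = cmx (diag3 0 1 (-1)) + (- (2 * 'i%C) *: cmx (E3 1 2) - ('i%C / 2) *: cmx (kq R)) /\
  Xp R 4 = cmx (diag3 0 1 (-1)) + ((2 * 'i%C) *: cmx (E3 1 2) + ('i%C / 2) *: cmx (kq R)).
Proof.
by split; rewrite XpE /Xi; apply: matrix3P; split; rewrite !mxE /= ?(rmorph0, rmorph1, rmorphN, rmorph_nat); field.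
Qed.

End LeftDerivative.

Section KPartTerms.
Variables (R : realType) (W : normedModType R[i]).
Local Notation C := R[i].
Local Notation M3 := 'M[R]_3.
Variables (l q : nat) (c y : M3) (f : M3 -> W) (L : M3 -> W) (a1 a2 : int) (w1 w2 : W).
Hypotheses (ql : (q <= 2 * l)%N) (cS : SO3 c) (yS : SO3 y).
Hypotheses (a1l : 0 <= a1 <= 2 * l%:Z) (a2l : 0 <= a2 <= 2 * l%:Z).
Local Notation K a x := (kcoef (2 * l%:Z) a q x).
Hypothesis hf : forall x, SO3 x -> f x = K a1 (c^T *m x) *: w1 + K a2 (c^T *m x) *: w2.
Hypothesis lL : real_linear L.
Hypothesis hL : forall (g : R -> M3) v, g 0 = c *m y -> (forall t, SL3 (g t)) ->
  mx_curve_deriv g v -> curve_deriv (f \o g) (L v).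
Local Notation D := (DL c y L).

(** [raise] and [lower] are the contributions of the so(3)-parts of X_1 and X_3 to the matrix
    coefficient with index [a]. *)
Definition raise (a : int) : C := - ((a%:~R + 1) / 2 * K (a + 1) y).
Definition lower (a : int) : C := - ((2 * l%:R - a%:~R + 1) / 2 * K (a - 1) y).

Let ii : ('i%C : C) * 'i%C = -1. Proof. by rewrite -expr2 sqr_i. Qed.

Lemma D_k1 : D (- ('i%C / 4) *: cmx (ks R) + 4^-1 *: cmx (kr R)) = raise a1 *: w1 + raise a2 *: w2.
Proof.
rewrite DLD// !DLZ// !DL_cmx// (L_ks ql cS yS a1l a2l hf hL) (L_kr ql cS yS a1l a2l hf hL).
rewrite !scalerDr !scalerA addrACA -!scalerDl /raise; congr (_ *: _ + _ *: _).
- by field: ii.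
- by field: ii.
Qed.

Lemma D_k3 : D (- ('i%C / 4) *: cmx (ks R) - 4^-1 *: cmx (kr R)) = lower a1 *: w1 + lower a2 *: w2.
Proof.
rewrite DLD// DLN// !DLZ// !DL_cmx// (L_ks ql cS yS a1l a2l hf hL) (L_kr ql cS yS a1l a2l hf hL).
rewrite -[- (4^-1 *: _)]scaleNr !scalerDr !scalerA addrACA -!scalerDl /lower; congr (_ *: _ + _ *: _).
- by field: ii.
- by field: ii.
Qed.

Lemma D_raise_upper : L (c *m E3 R 0 1 *m y) = 0 -> L (c *m E3 R 0 2 *m y) = 0 ->
  D (Xp R 1) = raise a1 *: w1 + raise a2 *: w2 /\ D (Xp R 3) = lower a1 *: w1 + lower a2 *: w2.
Proof.
move=> n1 n2; have [-> ->] := Xp13_upper R.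
by split; rewrite !(DLD c y lL (_ *: cmx (E3 _ _ _))) DLZ// DL_cmx// n1 scaler0 add0r DLD// ?DLN// DL_cmx// n2 ?oppr0 add0r;
  [exact: D_k1|exact: D_k3].
Qed.

Lemma D_raise_lower : L (c *m E3 R 1 0 *m y) = 0 -> L (c *m E3 R 2 0 *m y) = 0 ->
  D (Xp R 1) = - (raise a1 *: w1 + raise a2 *: w2) /\ D (Xp R 3) = - (lower a1 *: w1 + lower a2 *: w2).
Proof.
move=> n1 n2; have [-> ->] := Xp13_lower R.
by split; rewrite !(DLD c y lL (_ *: cmx (E3 _ _ _))) DLZ// DL_cmx// n1 scaler0 add0r DLD// ?DLN// DL_cmx// n2 ?oppr0 add0r;
  [rewrite D_k1|rewrite D_k3].
Qed.

Lemma D_torus (g : C) : L (c *m diag3 0 1 (-1) *m y) = g *: f (c *m y) -> L (c *m E3 R 1 2 *m y) = 0 ->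
  D (Xp R 0) = ((g + l%:R - a1%:~R) * K a1 y) *: w1 + ((g + l%:R - a2%:~R) * K a2 y) *: w2 /\
  D (Xp R 4) = ((g - l%:R + a1%:~R) * K a1 y) *: w1 + ((g - l%:R + a2%:~R) * K a2 y) *: w2.
Proof.
move=> hg hn; have [-> ->] := Xp04_torus R.
have fE : f (c *m y) = K a1 y *: w1 + K a2 y *: w2.
  by rewrite hf ?mulmxA ?(SO3_trVmul cS) ?mul1mx//; exact: SO3_mul.
split; rewrite !DLD// ?DLN// !DLZ// !DL_cmx// hn scaler0 add0r hg fE (L_kq ql cS yS a1l a2l hf hL).
  rewrite -[- (_ / 2 *: _)]scaleNr !scalerDr !scalerA addrACA -!scalerDl; congr (_ *: _ + _ *: _); by field: ii.
rewrite !scalerDr !scalerA addrACA -!scalerDl; congr (_ *: _ + _ *: _); by field: ii.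
Qed.

End KPartTerms.

(** * Recoupling *)

Section Recoupling.
Variables (R : realType) (W : normedModType R[i]).
Local Notation C := R[i].
Local Notation ms := ([:: -2; -1; 0; 1; 2] : seq int).
Variables (M : 'M[C]_2) (l p q r : nat).
Hypotheses (dM : \det M = 1) (pl : (p <= 2 * l)%N) (ql : (q <= 2 * l)%N) (r4 : (r <= 4)%N).
Local Notation K := (wcoef M (2 * l%:Z)).
Local Notation a1 := (2 * l%:Z - p%:Z).
Local Notation a2 := (p%:Z).

(** The common shape of gamma^(0), gamma^(1) and gamma^(2). The factors [gp] and [gm] come from X_0
    and X_4, [s] is the scalar by which X_2 acts, and [sg] is the sign of the so(3)-parts of X_1 and
    X_3. *)
Definition coupling (gp gm s sg : C) (m j : int) : C :=
  if j == 1 then gp * Acoef R (2 * l%:Z) m (2 * l%:Z - p%:Z + m - 2) 0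
  else if j == 0 then (s - sg / 3 * (l%:R * m%:~R - 3 + (m * (m + 1))%:~R / 2))
     * Acoef R (2 * l%:Z) m (2 * l%:Z - p%:Z + m) 2
  else if j == -1 then gm * Acoef R (2 * l%:Z) m (2 * l%:Z - p%:Z + m + 2) 4 else 0.

(** The restriction to SO(3) of the target basis vector, with indices in terms of the source. The
    vectors [vp j] and [vm j] carry the values in the inducing representation, and (-1)^m converts
    the sign of the source into that of the target. *)
Definition coupled (vp vm : int -> W) (m j : int) : W :=
  wcoef M (2 * l%:Z + 2 * m) (2 * l%:Z + 2 * m - (p%:Z + m + 2 * j)) (q%:Z + m + r%:Z - 2) *: vp j
  + ((-1) ^+ `|m|%N * wcoef M (2 * l%:Z + 2 * m) (p%:Z + m + 2 * j) (q%:Z + m + r%:Z - 2)) *: vm j.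

Let Bm m := Bcoef R l m q r.
Let S (k : int) (i : nat) (m : int) := Bm m * Acoef R (2 * l%:Z) m k i
   * wcoef M (2 * l%:Z + 2 * m) k (q%:Z + r%:Z + m - 2).

Let CG (r' : nat) (a : int) : (r' <= 4)%N ->
  subst_coef M 4 r' r * K a q = \sum_(m <- ms) S (a + r'%:Z + m - 2) r' m.
Proof. by move=> r'4; rewrite (clebsch_gordan a dM ql r4 r'4). Qed.

Let qE m : q%:Z + m + r%:Z - 2 = q%:Z + r%:Z + m - 2. Proof. by lia. Qed.

Let sgn2 (m : int) : (-1) ^+ `|m|%N * (-1) ^+ `|m|%N = 1 :> C.
Proof. by rewrite -expr2 sqrr_sign. Qed.

(** All three products end at the same index [a + m], so [A_middle] applies for each m separately;
    excluded pairs vanish with B. *)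
Let middle (sg s : C) (a : int) :
  s * (\sum_(m <- ms) S (a + 2%:Z + m - 2) 2 m)
   - sg * ((a%:~R + 1) / 2) * (\sum_(m <- ms) S (a + 1 + 1%:Z + m - 2) 1 m)
   - sg * ((2 * l%:R - a%:~R + 1) / 2) * (\sum_(m <- ms) S (a - 1 + 3%:Z + m - 2) 3 m)
  = \sum_(m <- ms) (s - sg / 3 * (l%:R * m%:~R - 3 + (m * (m + 1))%:~R / 2)) * S (a + m) 2 m.
Proof.
rewrite !mulr_sumr -!sumrB; apply: eq_big_seq => m mm.
have -> : a + 2%:Z + m - 2 = a + m by lia.
have -> : a + 1 + 1%:Z + m - 2 = a + m by lia.
have -> : a - 1 + 3%:Z + m - 2 = a + m by lia.
rewrite /S; have [ex|ex] := boolP (excluded l m).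
  by rewrite /Bm /Bcoef ex !mul0r !mulr0 !subr0.
have h := A_middle R a mm (negbTE ex).
move: h; set A1 := Acoef _ _ _ _ 1; set A2 := Acoef _ _ _ _ 2; set A3 := Acoef _ _ _ _ 3.
move: (wcoef _ _ _ _) (Bm m) => k b h.
transitivity (s * (b * A2 * k) + sg * b * k * (- ((a%:~R + 1) / 2 * A1) - (2 * l%:R - a%:~R + 1) / 2 * A3)).
  by ring.
by rewrite h; field.
Qed.

(** Terms of index 2l - p match the coefficients at once. Those of index p match after the
    reflection [A_sym], which interchanges the roles of X_0 and X_4 and produces the sign in
    [coupled]. *)
Lemma recoupling (D : nat -> W) (gp gm s sg : C) (vp vm : int -> W) :
    D 0%N = (gp * K a1 q) *: vp 1 + (gm * K a2 q) *: vm (-1) ->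
    D 4%N = (gm * K a1 q) *: vp (-1) + (gp * K a2 q) *: vm 1 ->
    D 2%N = s *: (K a1 q *: vp 0 + K a2 q *: vm 0) ->
    D 1%N = sg *: ((- ((a1%:~R + 1) / 2 * K (a1 + 1) q)) *: vp 0 + (- ((a2%:~R + 1) / 2 * K (a2 + 1) q)) *: vm 0) ->
    D 3%N = sg *: ((- ((2 * l%:R - a1%:~R + 1) / 2 * K (a1 - 1) q)) *: vp 0
                 + (- ((2 * l%:R - a2%:~R + 1) / 2 * K (a2 - 1) q)) *: vm 0) ->
  \sum_(r' < 5) subst_coef M 4 r' r *: D r'
  = \sum_(j <- [:: -1; 0; 1] : seq int) \sum_(m <- ms) (coupling gp gm s sg m j * Bcoef R l m q r) *: coupled vp vm m j.
Proof.
move=> D0 D4 D2 D1 D3.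
have inordE (k : nat) : (k <= 4)%N -> nat_of_ord (inord k : 'I_5) = k by move=> k4; rewrite inordK.
rewrite sum5E !inordE// D0 D1 D2 D3 D4.
pose X a (i : nat) := \sum_(m <- ms) S (a + i%:Z + m - 2) i m.
pose V a := s * X a 2 - sg * ((a%:~R + 1) / 2) * X (a + 1) 1 - sg * ((2 * l%:R - a%:~R + 1) / 2) * X (a - 1) 3.
transitivity ((gm * X a1 4) *: vp (-1) + (gm * X a2 0) *: vm (-1)
   + (V a1 *: vp 0 + V a2 *: vm 0 + ((gp * X a1 0) *: vp 1 + (gp * X a2 4) *: vm 1))).
  rewrite /V /X -!CG// !scalerDr !scalerA.
  (* Regroups the ten products by the vectors [vp j] and [vm j] that they multiply. *)
  rewrite [LHS](AC (2*2*2*2*2) ((9*2)*((5*3*7)*(6*4*8)*(1*10)))%AC) /= -!scalerDl.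
  by congr (_ *: _ + _ *: _ + (_ *: _ + _ *: _ + (_ *: _ + _ *: _))); ring.
have sum3 (F : int -> W) : \sum_(j <- [:: -1; 0; 1]) F j = F (-1) + (F 0 + F 1).
  by rewrite !big_cons big_nil addr0.
rewrite sum3.
pose k m j := 2 * l%:Z + 2 * m - (p%:Z + m + 2 * j).
pose k' m j := p%:Z + m + 2 * j.
pose cw m (b : int) := wcoef M (2 * l%:Z + 2 * m) b (q%:Z + r%:Z + m - 2).
have split_j j : \sum_(m <- ms) (coupling gp gm s sg m j * Bcoef R l m q r) *: coupled vp vm m j
  = (\sum_(m <- ms) coupling gp gm s sg m j * Bm m * cw m (k m j)) *: vp j
   + (\sum_(m <- ms) coupling gp gm s sg m j * Bm m * ((-1) ^+ `|m|%N * cw m (k' m j))) *: vm j.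
  rewrite !scaler_suml -big_split /=; apply: eq_bigr => m _.
  by rewrite /coupled !qE scalerDr !scalerA.
rewrite !split_j.
have reflect (g : C) m (i : nat) (b b' : int) : m \in ms -> (i <= 4)%N -> b' = 2 * l%:Z + 2 * m - b ->
    g * Bm m * Acoef R (2 * l%:Z) m b i * cw m b
    = g * Acoef R (2 * l%:Z) m b' (4 - i) * Bm m * ((-1) ^+ `|m|%N * cw m b).
  move=> mm i4 ->; have [ex|ex] := boolP (excluded l m).
    by rewrite /Bm /Bcoef ex !(mulr0, mul0r).
  rewrite A_sym ?(negbTE ex)//.
  by move: (sgn2 m) => /(congr1 ( *%R (g * Bm m * Acoef R (2 * l%:Z) m b i * cw m b))); rewrite mulr1 => <-; ring.
have -> : V a1 = \sum_(m <- ms) coupling gp gm s sg m 0 * Bm m * cw m (k m 0).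
  rewrite /V /X middle; apply: eq_bigr => m _; rewrite /coupling /S /cw /k /=.
  have -> : 2 * l%:Z + 2 * m - (p%:Z + m + 2 * 0) = 2 * l%:Z - p%:Z + m by lia.
  by ring.
have -> : V a2 = \sum_(m <- ms) coupling gp gm s sg m 0 * Bm m * ((-1) ^+ `|m|%N * cw m (k' m 0)).
  rewrite /V /X middle; apply: eq_big_seq => m mm; rewrite /coupling /S /k' /=.
  have -> : p%:Z + m + 2 * 0 = p%:Z + m by lia.
  rewrite -(reflect _ m 2%N _ (2 * l%:Z - p%:Z + m))//; last by lia.
  by rewrite /cw; ring.
have -> : gm * X a1 4 = \sum_(m <- ms) coupling gp gm s sg m (-1) * Bm m * cw m (k m (-1)).
  rewrite mulr_sumr; apply: eq_bigr => m _; rewrite /coupling /S /cw /k /=.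
  have -> : 2 * l%:Z - p%:Z + 4 + m - 2 = 2 * l%:Z - p%:Z + m + 2 by lia.
  have -> : 2 * l%:Z + 2 * m - (p%:Z + m + 2 * -1) = 2 * l%:Z - p%:Z + m + 2 by lia.
  by ring.
have -> : gp * X a1 0 = \sum_(m <- ms) coupling gp gm s sg m 1 * Bm m * cw m (k m 1).
  rewrite mulr_sumr; apply: eq_bigr => m _; rewrite /coupling /S /cw /k /=.
  have -> : 2 * l%:Z - p%:Z + 0 + m - 2 = 2 * l%:Z - p%:Z + m - 2 by lia.
  have -> : 2 * l%:Z + 2 * m - (p%:Z + m + 2 * 1) = 2 * l%:Z - p%:Z + m - 2 by lia.
  by ring.
have -> : gm * X a2 0 = \sum_(m <- ms) coupling gp gm s sg m (-1) * Bm m * ((-1) ^+ `|m|%N * cw m (k' m (-1))).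
  rewrite mulr_sumr; apply: eq_big_seq => m mm; rewrite /coupling /S /k' /=.
  have -> : p%:Z + m + 2 * -1 = p%:Z + 0 + m - 2 by lia.
  rewrite -(reflect _ m 0%N _ (2 * l%:Z - p%:Z + m + 2))//; last by lia.
  by rewrite /cw; ring.
have -> : gp * X a2 4 = \sum_(m <- ms) coupling gp gm s sg m 1 * Bm m * ((-1) ^+ `|m|%N * cw m (k' m 1)).
  rewrite mulr_sumr; apply: eq_big_seq => m mm; rewrite /coupling /S /k' /=.
  have -> : p%:Z + m + 2 * 1 = p%:Z + 4 + m - 2 by lia.
  rewrite -(reflect _ m 4%N _ (2 * l%:Z - p%:Z + m - 2))//; last by lia.
  by rewrite /cw; ring.
by [].
Qed.

End Recoupling.

(** * Differentials of sections *)

Section Sections.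
Variables (R : realType) (mu : {measure set (borelM3 R) -> \bar R}).
Local Notation C := R[i].
Local Notation M3 := 'M[R]_3.
Local Notation ms := ([:: -2; -1; 0; 1; 2] : seq int).
Variables (W : normedModType C) (S : set (M3 -> W)) (H : completeNormedModType C).
Variables (iota : (M3 -> W) -> H) (pi : M3 -> H -> H).
Hypothesis mu_haar : haar_SO3 mu.
Hypothesis rr : right_regular mu S iota pi.
Hypothesis S_smooth : forall f, S f -> smooth_SL3 f.
Hypothesis S_lin : forall (a : C) f g, S f -> S g -> S (fun x => a *: f x + g x).
Hypothesis S_mulmxr : forall f g, SL3 g -> S f -> S (fun x => f (x *m g)).
Hypothesis S_0 : S (fun=> 0).

Lemma iota0 : iota (fun=> 0) = 0.
Proof.
have := iota_linear rr 1 S_0 S_0; under eq_fun do rewrite scaler0 addr0.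
by rewrite scale1r => /esym/eqP; rewrite -subr_eq0 addrK => /eqP.
Qed.

Lemma S_combination a b f g : S f -> S g ->
  S (fun x => a *: f x + b *: g x) /\ iota (fun x => a *: f x + b *: g x) = a *: iota f + b *: iota g.
Proof.
move=> Sf Sg; have Sbg := S_lin b Sg S_0.
have E : (fun x => a *: f x + b *: g x) = (fun x => a *: f x + (b *: g x + 0)).
  by apply/funext => x; rewrite addr0.
rewrite E; split; first exact: (S_lin a Sf Sbg).
by rewrite (iota_linear rr a Sf Sbg) (iota_linear rr b Sg S_0) iota0 addr0.
Qed.

(** Agreement is asked on SO(3) only: pointwise derivatives are compared only there, and the norm of
    H sees nothing else. *)
Definition realizes (v : H) (h : M3 -> W) :=
  exists2 g, S g & iota g = v /\ forall x, SO3 x -> g x = h x.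

Lemma realizes_sum (I : eqType) (s : seq I) (v : I -> H) (h : I -> M3 -> W) :
  (forall i, i \in s -> realizes (v i) (h i)) ->
  realizes (\sum_(i <- s) v i) (fun x => \sum_(i <- s) h i x).
Proof.
elim: s => [|i s IH] hyp.
  by exists (fun=> 0) => //; split=> [|x _]; rewrite big_nil// iota0.
have [g Sg [gE gx]] : realizes (\sum_(i <- s) v i) (fun x => \sum_(i <- s) h i x).
  by apply: IH => k ks; apply: hyp; rewrite inE ks orbT.
have [g' Sg' [g'E g'x]] := hyp i (mem_head i s); have [S1 E1] := S_combination 1 1 Sg' Sg.
exists (fun x => 1 *: g' x + 1 *: g x) => //; split=> [|x xS].
  by rewrite E1 !scale1r g'E gE big_cons.
by rewrite !scale1r big_cons g'x ?gx.
Qed.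

Lemma realizes0 (v : H) (h : M3 -> W) : v = 0 -> (forall x, SO3 x -> h x = 0) -> realizes v h.
Proof. by move=> -> h0; exists (fun=> 0) => //; split=> [|x /h0]//; exact: iota0. Qed.

Lemma realizesZ a v h : realizes v h -> realizes (a *: v) (fun x => a *: h x).
Proof.
move=> [g Sg [gE gx]]; have [S1 E1] := S_combination a 0 Sg Sg.
by exists (fun x => a *: g x + 0 *: g x) => //; split=> [|x xS]; rewrite ?E1 scale0r addr0 ?gE ?gx.
Qed.

(** Complex conjugation of the entries exchanges X_r and X_(4-r) up to the sign (-1)^r. *)
Lemma Xp_conj r : (r <= 4)%N -> exists A B : M3,
  [/\ Xp R r = cmx A + 'i%C *: cmx B & Xp R (4 - r) = (-1) ^+ r *: (cmx A - 'i%C *: cmx B)].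
Proof.
have [x0 x1 x2 x3 x4] := Xp_decomposition R.
have N23 : cmx (sym23 (-1) : M3) = - cmx (sym23 1).
  by apply: matrix3P; split; rewrite !mxE /= ?rmorphN ?rmorph0 ?oppr0.
have Z23 : cmx (sym23 0 : M3) = 0 by apply: matrix3P; split; rewrite !mxE.
have N13 : cmx (sym13 (- 2^-1) : M3) = - cmx (sym13 2^-1).
  by apply: matrix3P; split; rewrite !mxE /= ?rmorphN ?rmorph0 ?oppr0.
move=> r4; case: (nat_le4 r4) => [||| []] ->; [exists (diag3 0 1 (-1)), (sym23 (-1))|
  exists (sym13 (- 2^-1)), (sym12 (- 2^-1))|exists (diag3 (- (2 / 3)) 3^-1 3^-1), (sym23 0)|
  exists (sym13 2^-1), (sym12 (- 2^-1))|exists (diag3 0 1 (-1)), (sym23 1)]; split=> //.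
- by rewrite x4 expr0 scale1r N23 scalerN opprK.
- by rewrite x3 expr1 scaleN1r opprB N13 opprK addrC.
- by rewrite x2 Z23 scaler0 addr0 subr0 sqrrN expr1n scale1r.
- by rewrite x1 -signr_odd scaleN1r N13 opprB addrC.
- by rewrite x0 -signr_odd scale1r N23 scalerN.
Qed.

Lemma Xp_real_parts r : (r <= 4)%N ->
  cmx (map_mx (@complex.Re R) (Xp R r)) = 2^-1 *: Xp R r + ((-1) ^+ r / 2) *: Xp R (4 - r)
  /\ cmx (map_mx (@complex.Im R) (Xp R r)) = (- 'i%C / 2) *: Xp R r + ('i%C * (-1) ^+ r / 2) *: Xp R (4 - r).
Proof.
move=> r4; have ii : ('i%C : C) * 'i%C = -1 by rewrite -expr2 sqr_i.
have ss : (-1) ^+ r * (-1) ^+ r = 1 :> C by rewrite -expr2 sqrr_sign.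
have [A [B [-> ->]]] := Xp_conj r4; rewrite Re_cmx Im_cmx.
split; apply/matrixP => i j; move: (cmx A) (cmx B) ss => A' B'; rewrite !mxE; move: ((-1) ^+ r) (A' i j) (B' i j) => e x y ss.
  by transitivity (2^-1 * (x + 'i%C * y) + (e * e) / 2 * (x - 'i%C * y)); [rewrite ss|]; field.
transitivity (- 'i%C / 2 * (x + 'i%C * y) + (e * e) * ('i%C / 2 * (x - 'i%C * y))); last by ring.
by rewrite ss; field: ii.
Qed.

(** The derivative along a real direction involves both X_r and X_(4-r), which is why the hypotheses
    range over all r. *)
Lemma differential_sections f (v : nat -> H) (h : nat -> M3 -> W) : S f ->
    (forall r, (r <= 4)%N -> realizes (v r) (h r)) ->
    (forall x L, SO3 x -> real_linear L ->
      (forall g w, g 0 = x -> (forall t, SL3 (g t)) -> mx_curve_deriv g w -> curve_deriv (f \o g) (L w)) ->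
      forall r, (r <= 4)%N -> LC L (cmx x *m Xp R r) = h r x) ->
  forall r, (r <= 4)%N -> differential pi (Xp R r) (iota f) (v r).
Proof.
move=> Sf hv hL r r4; have r4' : (4 - r <= 4)%N by rewrite leq_subr.
have [g Sg [gE gx]] := hv r r4; have [g' Sg' [gE' gx']] := hv _ r4'.
have [Re2 Im2] := Xp_real_parts r4; have [tR tI] := Xp_parts R r4.
have key (Z : M3) a b : traceless_diag Z -> cmx Z = a *: Xp R r + b *: Xp R (4 - r) ->
    curve_deriv (fun t => pi (expmx (t *: Z)) (iota f)) (a *: v r + b *: v (4 - r)%N).
  move=> tZ ZE; have [eS eZ] := traceless_expmx tZ; have [Sc E] := S_combination a b Sg Sg'.
  rewrite -gE -gE' -E; apply: (representation_deriv mu_haar rr S_smooth S_lin S_mulmxr Sf Sc _ eS eZ).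
    exact: expmx0.
  move=> x xS; have [L lL hLx] := smooth_frechet (S_smooth Sf) (SO3_SL3 xS).
  have gZ := mx_curve_derivM x 1%:M eZ.
  have -> : (fun t => f (x *m expmx (t *: Z))) = f \o (fun t => x *m expmx (t *: Z) *m 1%:M).
    by apply/funext => t /=; rewrite mulmx1.
  rewrite gx// gx'// -!(hL x L xS lL hLx)// -!LCZ// -LCD// !scalemxAr -mulmxDr -ZE -cmxM LC_cmx//.
  rewrite -[x *m Z]mulmx1; apply: hLx => [|t|//]; first by rewrite expmx0 !mulmx1.
  by rewrite mulmx1; apply: SL3_mul => //; exact: SO3_SL3.
(* Derivatives along the real and imaginary parts of X_r; in w1 + i w2 the contributions of
   [v (4 - r)] cancel. *)
exists (2^-1 *: v r + ((-1) ^+ r / 2) *: v (4 - r)%N), 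
  ((- 'i%C / 2) *: v r + ('i%C * (-1) ^+ r / 2) *: v (4 - r)%N); split; [exact: key|exact: key|].
have ii : ('i%C : C) * 'i%C = -1 by rewrite -expr2 sqr_i.
rewrite scalerDr !scalerA addrACA -!scalerDl.
rewrite [X in _ + X *: _](_ : _ = 0) ?scale0r ?addr0; last by field: ii.
by rewrite [X in X *: _](_ : _ = 1) ?scale1r//; field: ii.
Qed.

Section Coupled.
Variables (c : M3) (l p q : nat) (vp vm : int -> W) (gp gm s sg : C).
Hypotheses (cS : SO3 c) (pl : (p <= 2 * l)%N) (ql : (q <= 2 * l)%N).
Local Notation K a y := (kcoef (2 * l%:Z) a q y).
Local Notation a1 := (2 * l%:Z - p%:Z).
Local Notation a2 := (p%:Z).
Local Notation coef r m j := (coupling l p gp gm s sg m j * Bcoef R l m q r).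

(** The five values of [DL] are what each series has to compute from its transformation law. Targets
    have to be realized only where the coefficient is nonzero. *)
Lemma differential_coupled f (e : nat -> int -> int -> H) : S f ->
    (forall y L, SO3 y -> real_linear L ->
      (forall g w, g 0 = c *m y -> (forall t, SL3 (g t)) -> mx_curve_deriv g w -> curve_deriv (f \o g) (L w)) ->
      [/\ DL c y L (Xp R 0) = (gp * K a1 y) *: vp 1 + (gm * K a2 y) *: vm (-1),
          DL c y L (Xp R 4) = (gm * K a1 y) *: vp (-1) + (gp * K a2 y) *: vm 1,
          DL c y L (Xp R 2) = s *: (K a1 y *: vp 0 + K a2 y *: vm 0),
          DL c y L (Xp R 1) = sg *: (raise l q y a1 *: vp 0 + raise l q y a2 *: vm 0)
        & DL c y L (Xp R 3) = sg *: (lower l q y a1 *: vp 0 + lower l q y a2 *: vm 0)]) ->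
    (forall r m j, (r <= 4)%N -> m \in ms -> j \in ([:: -1; 0; 1] : seq int) -> coef r m j != 0 ->
      realizes (e r m j) (fun x => coupled (invmx (su2_lift (c^T *m x))) l p q r vp vm m j)) ->
  forall r, (r <= 4)%N -> differential pi (Xp R r) (iota f)
    (\sum_(j <- [:: -1; 0; 1] : seq int) \sum_(m <- ms) coef r m j *: e r m j).
Proof.
move=> Sf cell he; pose h r x := \sum_(j <- [:: -1; 0; 1] : seq int) \sum_(m <- ms)
  coef r m j *: coupled (invmx (su2_lift (c^T *m x))) l p q r vp vm m j.
pose v r := \sum_(j <- [:: -1; 0; 1] : seq int) \sum_(m <- ms) coef r m j *: e r m j.
suff [] : (forall r, (r <= 4)%N -> realizes (v r) (h r)) /\
    (forall x L, SO3 x -> real_linear L ->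
      (forall g w, g 0 = x -> (forall t, SL3 (g t)) -> mx_curve_deriv g w -> curve_deriv (f \o g) (L w)) ->
      forall r, (r <= 4)%N -> LC L (cmx x *m Xp R r) = h r x).
  exact: differential_sections.
split=> [r r4|x L xS lL hL r r4].
  pose cp j m x := coef r m j *: coupled (invmx (su2_lift (c^T *m x))) l p q r vp vm m j.
  have hm j m : j \in ([:: -1; 0; 1] : seq int) -> m \in ms -> realizes (coef r m j *: e r m j) (cp j m).
    move=> jj mm; rewrite /cp.
    have [c0|c0] := eqVneq (coef r m j) 0; last by apply: realizesZ; exact: he.
    by rewrite c0; apply: realizes0 => [|x _]; rewrite scale0r.
  have hj j : j \in ([:: -1; 0; 1] : seq int) ->
      realizes (\sum_(m <- ms) coef r m j *: e r m j) (fun x => \sum_(m <- ms) cp j m x).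
    by move=> jj; apply: (realizes_sum (v := fun m => coef r m j *: e r m j)) => m mm; exact: hm.
  exact: (realizes_sum (v := fun j => \sum_(m <- ms) coef r m j *: e r m j)
    (h := fun j x => \sum_(m <- ms) cp j m x) hj).
have yS : SO3 (c^T *m x) by apply: SO3_mul => //; exact: SO3_tr.
have xE : x = c *m (c^T *m x) by rewrite mulmxA (proj1 cS) mul1mx.
have [|D0 D4 D2 D1 D3] := cell _ L yS lL; first by rewrite -xE.
rewrite {1}xE DL_right// /h.
have [uS _] := su2_liftP yS.
rewrite (recoupling (D := fun r' => DL c (c^T *m x) L (Xp R r')) (gp := gp) (gm := gm) (s := s)
  (sg := sg) (vp := vp) (vm := vm) (proj2 (SU2_inv uS)) pl ql r4)//.
Qed.

(** A nonzero B bounds the new q and a nonzero A the new p, so every target that counts has natural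
    indices in range. *)
Lemma coupled_range r m j : (r <= 4)%N -> m \in ms -> j \in ([:: -1; 0; 1] : seq int) -> coef r m j != 0 ->
  exists l' p' q' : nat, [/\ l%:Z + m = l'%:Z, p%:Z + m + 2 * j = p'%:Z, q%:Z + m + r%:Z - 2 = q'%:Z,
    (p' <= 2 * l')%N & (q' <= 2 * l')%N].
Proof.
move=> r4 mm jj; rewrite mulf_eq0 negb_or => /andP[cn Bn].
have hq : 0 <= q%:Z + r%:Z + m - 2 <= 2 * l%:Z + 2 * m.
  by apply: contraNT Bn => h; rewrite B_out.
have hp : 0 <= 2 * l%:Z - p%:Z + m - 2 * j <= 2 * l%:Z + 2 * m.
  apply: contraNT cn => h; apply/eqP; move: jj h; rewrite /coupling /Acoef !inE => /or3P[] /eqP -> /= h.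
  - by rewrite [X in if X then _ else _](_ : _ = false) ?mulr0//; lia.
  - by rewrite [X in if X then _ else _](_ : _ = false) ?mulr0//; lia.
  - by rewrite [X in if X then _ else _](_ : _ = false) ?mulr0//; lia.
exists (absz (l%:Z + m)), (absz (p%:Z + m + 2 * j)), (absz (q%:Z + m + r%:Z - 2)%R); split; lia.
Qed.

End Coupled.

End Sections.

Section SectionClosure.
Variables (R : realType).
Local Notation C := R[i].
Local Notation M3 := 'M[R]_3.

Lemma smooth_0 (W : normedModType C) (f : M3 -> W) : smooth_SL3 f -> smooth_SL3 (fun=> 0 : W).
Proof.
move=> sf; have := smooth_lin (-1) sf sf.
by under eq_fun do rewrite scaleN1r addNr.
Qed.

Lemma section0_lin nu1 nu2 s1 s2 (a : C) f g : section0 nu1 nu2 s1 s2 f -> section0 nu1 nu2 s1 s2 g ->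
  section0 nu1 nu2 s1 s2 (fun x : M3 => a *: f x + g x).
Proof.
move=> [sf ef] [sg eg]; split; first exact: smooth_lin.
move=> n b m x nN bA mM xS; rewrite ef// eg// -[RHS]mulr1 -![_ *: _]/(_ * _); ring.
Qed.

Lemma section0_mulmxr nu1 nu2 s1 s2 f (g : M3) : SL3 g -> section0 nu1 nu2 s1 s2 f ->
  section0 nu1 nu2 s1 s2 (fun x => f (x *m g)).
Proof.
move=> gS [sf ef]; split; first exact: smooth_mulmxr.
by move=> n b m x nN bA mM xS; rewrite -(mulmxA _ x g) ef//; exact: SL3_mul.
Qed.

Lemma section0_0 nu1 nu2 s1 s2 f : section0 nu1 nu2 s1 s2 f -> section0 nu1 nu2 s1 s2 (fun=> 0 : C^o).
Proof.
by move=> [sf _]; split; [exact: smooth_0 sf|move=> n b m x _ _ _ _; rewrite mulr0].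
Qed.

Variables (k : nat) (W : completeNormedModType C) (ip : W -> W -> C).
Variables (D : 'M[R]_2 -> W -> W) (chi : int -> W).
Hypothesis ds : discrete_series k ip D chi.

Lemma sectionP_lin i nu (a : C) f g : sectionP i nu D f -> sectionP i nu D g ->
  sectionP i nu D (fun x : M3 => a *: f x + g x).
Proof.
move=> [sf ef] [sg eg]; split; first exact: smooth_lin.
move=> n t h x nN hS xS; rewrite ef// eg// (D_linear ds hS) scalerDr !scalerA.
by rewrite [a * _]mulrC.
Qed.

Lemma sectionP_mulmxr i nu f (g : M3) : SL3 g -> sectionP i nu D f ->
  sectionP i nu D (fun x => f (x *m g)).
Proof.
move=> gS [sf ef]; split; first exact: smooth_mulmxr.
by move=> n t h x nN hS xS; rewrite -(mulmxA _ x g) ef//; exact: SL3_mul.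
Qed.

Lemma sectionP_0 i nu f : sectionP i nu D f -> sectionP i nu D (fun=> 0 : W).
Proof.
move=> [sf _]; split; first exact: smooth_0 sf.
move=> n t h x _ hS _; have := D_linear ds hS (-1) 0 0.
by rewrite scaler0 addr0 scaleN1r addNr => ->; rewrite scaler0.
Qed.

End SectionClosure.

Section CoupledE.
Variables (R : realType) (W : normedModType R[i]).

Lemma coupledE (y : 'M[R]_3) (l p q r : nat) (vp vm : int -> W) (m j : int) (l' p' q' : nat) :
    l%:Z + m = l'%:Z -> p%:Z + m + 2 * j = p'%:Z -> q%:Z + m + r%:Z - 2 = q'%:Z ->
  coupled (invmx (su2_lift y)) l p q r vp vm m j
  = kcoef (2 * l'%:Z) (2 * l'%:Z - p'%:Z) q' y *: vp j
    + ((-1) ^+ `|m|%N * kcoef (2 * l'%:Z) p' q' y) *: vm j.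
Proof. by move=> lE pE qE; rewrite /coupled -mulrDr lE pE qE. Qed.

Lemma sign_absz (a b : nat) (m e : int) : a%:Z + m = b%:Z + 2 * e ->
  (-1) ^+ b = (-1) ^+ `|m|%N * (-1) ^+ a :> R[i].
Proof.
move=> h; rewrite -exprD -signr_odd -[RHS]signr_odd; congr (_ ^+ (_ : bool)); lia.
Qed.

End CoupledE.

(** * Basis vectors, extended to all indices, as sections *)

Section PrincipalSeriesBasis.
Variables (R : realType) (mu : {measure set (borelM3 R) -> \bar R}).
Local Notation C := R[i].
Local Notation M3 := 'M[R]_3.
Variables (nu1 nu2 : C) (s1 s2 : bool) (H : completeNormedModType C).
Variables (iota : (M3 -> C^o) -> H) (pi : M3 -> H -> H) (s : nat -> nat -> nat -> H).
Local Notation S := (section0 nu1 nu2 s1 s2).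
Hypothesis rr : right_regular mu S iota pi.
Hypothesis hs : forall l p q : nat, Zset s1 s2 l p -> (q <= l.*2)%N ->
  exists2 f, S f /\ restr0 s1 s2 l p q f & s l p q = iota f.

Lemma eps0E l : exists d : int, l - s1%:Z - s2%:Z = 2 * d + (eps0 s1 s2 l)%:Z /\ (eps0 s1 s2 l <= 1)%N.
Proof. exists ((l - s1%:Z - s2%:Z) %/ 2)%Z; rewrite /eps0; split; lia. Qed.

Lemma restr0_kcoef (l p q : nat) (f : M3 -> C^o) x : restr0 s1 s2 l p q f -> SO3 x -> (p <= l.*2)%N -> (q <= l.*2)%N ->
  f x = kcoef (2 * l%:Z) (2 * l%:Z - p%:Z) q x + (-1) ^+ eps0 s1 s2 l * kcoef (2 * l%:Z) p q x.
Proof.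
move=> hf xS pl ql; rewrite hf// !vdual1_tauK ?leq_subr//; congr (kcoef _ _ _ _ + _); lia.
Qed.

(** The conventions for s(l;p,q) outside Z are exactly those making its restriction formula hold for
    every p' up to 2l'. *)
Lemma ext0_realizes (l p q r : nat) (m j : int) (l' p' q' : nat) (e := (-1) ^+ eps0 s1 s2 l : C^o) :
    S (fun=> 0) -> Zset s1 s2 l p ->
    l%:Z + m = l'%:Z -> p%:Z + m + 2 * j = p'%:Z -> q%:Z + m + r%:Z - 2 = q'%:Z ->
    (p' <= 2 * l')%N -> (q' <= 2 * l')%N ->
  realizes S iota (ext0 s1 s2 s (l%:Z + m) (p%:Z + m + 2 * j) (q%:Z + m + r%:Z - 2))
   (fun x => coupled (invmx (su2_lift (1%:M^T *m x))) l p q r (fun=> 1 : C^o) (fun=> e) m j).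
Proof.
move=> S0 Zp lE pE qE pl ql; rewrite lE pE qE.
have [d [dE e1]] := eps0E l; have [d' [d'E e1']] := eps0E l'.
have eE : (-1) ^+ `|m|%N * e = (-1) ^+ eps0 s1 s2 l' :> C.
  have h : (eps0 s1 s2 l)%:Z + m = (eps0 s1 s2 l')%:Z + 2 * (d' - d) by lia.
  by rewrite /e (sign_absz _ h).
have cE x : SO3 x -> coupled (invmx (su2_lift (1%:M^T *m x))) l p q r (fun=> 1 : C^o) (fun=> e) m j
   = kcoef (2 * l'%:Z) (2 * l'%:Z - p'%:Z) q' x + (-1) ^+ eps0 s1 s2 l' * kcoef (2 * l'%:Z) p' q' x.
  move=> xS; rewrite (coupledE _ _ _ lE pE qE) trmx1 mul1mx -eE.
  by rewrite -![_ *: _]/(_ * _) mulr1 mulrAC.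
have Zb (b : nat) : (b == p' %[mod 2])%Z -> (b < l')%N || ((b == l')%N && (eps0 s1 s2 l' == 0)%N) ->
    Zset s1 s2 l' b by move: Zp; rewrite /Zset; lia.
have q2 : (q' <= l'.*2)%N by lia.
rewrite /ext0; case: ifP => pl'.
  case: ifP => [/andP[Zp' _]|nz].
    have [f [Sf rf] ->] := hs Zp' q2; exists f => //; split=> // x xS.
    by rewrite cE// (restr0_kcoef rf)//; lia.
  apply: (realizes0 rr S0) => // x xS; rewrite cE//.
  (* The parity being right, the only p' <= l' left out of Z is p' = l' with odd sign, and there the
     two matrix coefficients cancel. *)
  have [pE' eE'] : p' = l' /\ eps0 s1 s2 l' = 1%N by move: nz (Zb p'); lia.
  by rewrite eE' expr1 mulN1r pE' (_ : 2 * l'%:Z - l'%:Z = l'%:Z) ?subrr//; lia.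
(* For p' > l' the reflection 2l' - p' swaps the two matrix coefficients at the cost of the sign. *)
have Zp' : Zset s1 s2 l' (2 * l' - p')%N by apply: Zb; lia.
have pp : 2 * l'%:Z - p'%:Z = (2 * l' - p')%N by lia.
rewrite pp Zp' /=; case: ifP => [_|]; last by lia.
have [f [Sf rf] ->] := hs Zp' q2.
have : realizes S iota ((-1) ^+ eps0 s1 s2 l' *: iota f) (fun x => (-1) ^+ eps0 s1 s2 l' *: f x).
  by apply: (realizesZ rr _ S0) => [a g h|]; [exact: section0_lin|exists f].
move=> [g Sg [gE gx]]; exists g => //; split=> // x xS.
rewrite gx// cE// (restr0_kcoef rf)//; last by lia.
rewrite -![_ *: _]/(_ * _) mulrDr mulrA -expr2 sqrr_sign mul1r addrC -pp.
by congr (_ + _ * kcoef _ _ _ _); lia.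
Qed.

End PrincipalSeriesBasis.

Section DiscreteSeriesBasis.
Variables (R : realType) (mu : {measure set (borelM3 R) -> \bar R}).
Local Notation C := R[i].
Local Notation M3 := 'M[R]_3.
Variables (i : nat) (nu : C) (k : nat) (W : completeNormedModType C) (ip : W -> W -> C).
Variables (D : 'M[R]_2 -> W -> W) (chi : int -> W) (H : completeNormedModType C).
Variables (iota : (M3 -> W) -> H) (pi : M3 -> H -> H) (t : nat -> nat -> nat -> H).
Hypothesis i12 : i = 1%N \/ i = 2%N.
Hypothesis ht : forall l p q : nat, ZP k l p -> (q <= l.*2)%N ->
  exists2 f, sectionP i nu D f /\ restrP i chi l p q f & t l p q = iota f.

(** Its transpose enters through [vdual2_tauK], and it conjugates the lower right block, used for
    P_1, into the Levi block of P_i. *)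
Definition Levi_rotation : M3 := if i == 1%N then 1%:M else u_c R.
Definition chi_sign (l p : nat) : C := (-1) ^+ (if i == 1%N then p else l).

Lemma Levi_rotation_SO3 : SO3 Levi_rotation.
Proof.
rewrite /Levi_rotation; case: ifP => _; last exact: u_c_SO3.
by split; rewrite ?trmx1 ?mulmx1 ?det1.
Qed.

Lemma restrP_kcoef (l p q : nat) (f : M3 -> W) x : restrP i chi l p q f -> SO3 x ->
    (p <= l.*2)%N -> (q <= l.*2)%N ->
  f x = kcoef (2 * l%:Z) (2 * l%:Z - p%:Z) q (Levi_rotation^T *m x) *: chi (l%:Z - p%:Z)
     + kcoef (2 * l%:Z) p q (Levi_rotation^T *m x) *: (chi_sign l p *: chi (p%:Z - l%:Z)).
Proof.
move=> hf xS pl ql; rewrite hf// scalerA [_ * chi_sign _ _]mulrC /chi_sign /Levi_rotation.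
have -> : 2 * l%:Z - p%:Z = (l.*2 - p)%N :> int by lia.
by case: i12 => ->; rewrite /= ?trmx1 ?mul1mx ?vdual1_tauK ?vdual2_tauK ?leq_subr.
Qed.

(** Both choices of c_i, (-1)^p and (-1)^l, change by (-1)^m from source to target, because p moves
    by m + 2j and l by m. *)
Lemma extP_realizes (l p q r : nat) (m j : int) (l' p' q' : nat) :
    ZP k l p -> ZP k l' p' ->
    l%:Z + m = l'%:Z -> p%:Z + m + 2 * j = p'%:Z -> q%:Z + m + r%:Z - 2 = q'%:Z ->
    (p' <= 2 * l')%N -> (q' <= 2 * l')%N ->
  realizes (sectionP i nu D) iota (extP k t (l%:Z + m) (p%:Z + m + 2 * j) (q%:Z + m + r%:Z - 2))
   (fun x => coupled (invmx (su2_lift (Levi_rotation^T *m x))) l p q r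
     (fun j => chi (l%:Z - p%:Z - 2 * j)) (fun j => chi_sign l p *: chi (p%:Z - l%:Z + 2 * j)) m j).
Proof.
move=> Zp Zp' lE pE qE pl ql; rewrite lE pE qE /extP Zp' /=; case: ifP => [_|]; last by lia.
have q2 : (q' <= l'.*2)%N by lia.
have [f [Sf rf] ->] := ht Zp' q2; exists f => //; split=> // x xS.
rewrite (coupledE _ _ _ lE pE qE) (restrP_kcoef rf)//; last by lia.
have -> : l'%:Z - p'%:Z = l%:Z - p%:Z - 2 * j by lia.
have -> : p'%:Z - l'%:Z = p%:Z - l%:Z + 2 * j by lia.
congr (_ + _); rewrite !scalerA; congr (_ *: _).
suff -> : chi_sign l' p' = (-1) ^+ `|m|%N * chi_sign l p by ring.
have hl : l%:Z + m = l'%:Z + 2 * 0 by lia.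
have hp : p%:Z + m = p'%:Z + 2 * (- j) by lia.
by rewrite /chi_sign; case: ifP => _; [exact: sign_absz hp|exact: sign_absz hl].
Qed.

End DiscreteSeriesBasis.

(** * The principal series and the discrete series *)

Section LeftTranslation.
Variables (R : realType).
Local Notation C := R[i].
Local Notation M3 := 'M[R]_3.

Lemma curve_deriv_cexp (z : C) : curve_deriv (W := C^o) (fun t : R => cexp (t%:C * z)) z.
Proof.
case: z => u v.
have hu : is_derive (0 : R) (1 : R) (fun t => expR (t * u)) u.
  by apply: is_derive_eq; rewrite mul0r expR0 /GRing.scale /=; ring.
have hc : is_derive (0 : R) (1 : R) (fun t => cos (t * v)) 0.
  by apply: is_derive_eq; rewrite mul0r sin0 /GRing.scale /=; ring.
have hs : is_derive (0 : R) (1 : R) (fun t => sin (t * v)) v.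
  by apply: is_derive_eq; rewrite mul0r cos0 /GRing.scale /=; ring.
have := curve_derivM (curve_deriv_real (derive_quotient hu)) (curve_deriv_complex hc hs).
have -> : (fun t : R => (expR (t * u))%:C *: ((cos (t * v) +i* sin (t * v)) : C^o))
   = (fun t => cexp (t%:C * (u +i* v))).
  by apply/funext => t; rewrite /cexp /=; congr ((expR _)%:C * (cos _ +i* sin _)); ring.
rewrite !mul0r expR0 cos0 sin0; congr (curve_deriv _ _).
by rewrite -[LHS]/(u%:C * (1 +i* 0) + 1%:C * (0 +i* v)); simpc.
Qed.

Lemma cexp0 : cexp 0 = 1 :> C.
Proof. by rewrite /cexp /= expR0 cos0 sin0 mul1r. Qed.

Definition unipotent (i j : 'I_3) (t : R) : M3 := 1%:M + t *: E3 R i j.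

Lemma mx_curve_deriv_unipotent i j : mx_curve_deriv (unipotent i j) (E3 R i j).
Proof.
move=> e e0; apply: nearW => t.
by rewrite /unipotent scale0r addr0 [1%:M + _]addrC addrK subrr normr0 mulr_ge0// ltW.
Qed.

Lemma unipotent0 i j : unipotent i j 0 = 1%:M.
Proof. by rewrite /unipotent scale0r addr0. Qed.

Lemma unipotentE t :
 [/\ unipotent 0 1 t = rows 3 [:: [:: 1; t; 0]; [:: 0; 1; 0]; [:: 0; 0; 1]],
     unipotent 0 2 t = rows 3 [:: [:: 1; 0; t]; [:: 0; 1; 0]; [:: 0; 0; 1]]
   & unipotent 1 2 t = rows 3 [:: [:: 1; 0; 0]; [:: 0; 1; t]; [:: 0; 0; 1]]].
Proof.
by split; apply: matrix3P; split; rewrite !mxE /= ?mulr1n ?mulr0n ?mulr1 ?mulr0 ?addr0 ?add0r.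
Qed.

Lemma unipotent_N0 t : [/\ N0 (unipotent 0 1 t), N0 (unipotent 0 2 t) & N0 (unipotent 1 2 t)].
Proof.
by have [-> -> ->] := unipotentE t; split; do 2 apply: ord3P; rewrite ?mxE.
Qed.

Lemma N0_SL3 n : @N0 R n -> SL3 n.
Proof.
move=> nN; rewrite /SL3 /= det_mx3 (nN 1 0)// (nN 2 0)// (nN 2 1)// (nN 0 0)// (nN 1 1)// (nN 2 2)//=.
by rewrite !mulr1n !mulr0n; ring.
Qed.

Lemma block12E (A : 'M[R]_1) (B : 'rV[R]_2) (X : 'cV[R]_2) (Z : 'M[R]_2) :
  block_mx A B X Z = rows 3 [:: [:: A 0 0; B 0 0; B 0 1]; [:: X 0 0; Z 0 0; Z 0 1]; [:: X 1 0; Z 1 0; Z 1 1]] :> M3.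
Proof.
have e0 : (0 : 'I_3) = lshift 2 (0 : 'I_1) by apply/val_inj.
have e1 : (1 : 'I_3) = rshift 1 (0 : 'I_2) by apply/val_inj.
have e2 : (2 : 'I_3) = rshift 1 (1 : 'I_2) by apply/val_inj.
apply: matrix3P; split; rewrite [RHS]mxE ?e2 ?e0 ?e1 /=.
all: first [exact: block_mxEul|exact: block_mxEur|exact: block_mxEdl|exact: block_mxEdr].
Qed.

Lemma block21E (A : 'M[R]_2) (B : 'cV[R]_2) (X : 'rV[R]_2) (Z : 'M[R]_1) :
  block_mx A B X Z = rows 3 [:: [:: A 0 0; A 0 1; B 0 0]; [:: A 1 0; A 1 1; B 1 0]; [:: X 0 0; X 0 1; Z 0 0]] :> M3.
Proof.
have e0 : (0 : 'I_3) = lshift 1 (0 : 'I_2) by apply/val_inj.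
have e1 : (1 : 'I_3) = lshift 1 (1 : 'I_2) by apply/val_inj.
have e2 : (2 : 'I_3) = rshift 2 (0 : 'I_1) by apply/val_inj.
apply: matrix3P; split; rewrite [RHS]mxE ?e2 ?e0 ?e1 /=.
all: first [exact: block_mxEul|exact: block_mxEur|exact: block_mxEdl|exact: block_mxEdr].
Qed.

Lemma unipotent_NP t : [/\ NP 1 (unipotent 0 1 t), NP 1 (unipotent 0 2 t),
  NP 2 (unipotent 0 2 t) & NP 2 (unipotent 1 2 t)].
Proof.
have [e1 e2 e3] := unipotentE t; split; rewrite ?e1 ?e2 ?e3 /NP /=.
- by exists (\row_j [:: t; 0]`_j); rewrite block12E; apply: matrix3P; split; rewrite !mxE.
- by exists (\row_j [:: 0; t]`_j); rewrite block12E; apply: matrix3P; split; rewrite !mxE.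
- by exists (\col_j [:: t; 0]`_j); rewrite block21E; apply: matrix3P; split; rewrite !mxE.
- by exists (\col_j [:: 0; t]`_j); rewrite block21E; apply: matrix3P; split; rewrite !mxE.
Qed.

(** The differential of [mP i] on trace-zero matrices, along which the entry given by the inverse
    determinant stays constant. *)
Definition mp (i : nat) (Z : 'M[R]_2) : M3 :=
  if i == 1%N then rows 3 [:: [:: 0; 0; 0]; [:: 0; Z 0 0; Z 0 1]; [:: 0; Z 1 0; Z 1 1]]
  else rows 3 [:: [:: Z 0 0; Z 0 1; 0]; [:: Z 1 0; Z 1 1; 0]; [:: 0; 0; 0]].

Lemma mPE i h : \det h = 1 -> mP i h =
  if i == 1%N then rows 3 [:: [:: 1; 0; 0]; [:: 0; h 0 0; h 0 1]; [:: 0; h 1 0; h 1 1]]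
  else rows 3 [:: [:: h 0 0; h 0 1; 0]; [:: h 1 0; h 1 1; 0]; [:: 0; 0; 1]] :> M3.
Proof.
by move=> dh; rewrite /mP dh invr1; case: ifP => _; rewrite ?block12E ?block21E; apply: matrix3P; split; rewrite !mxE.
Qed.

Lemma mP_1 i : mP i (1%:M : 'M[R]_2) = 1%:M :> M3.
Proof. by rewrite mPE ?det1//; case: ifP => _; apply: matrix3P; split; rewrite !mxE. Qed.

Lemma mP_SL3 i (h : 'M[R]_2) : \det h = 1 -> SL3 (mP i h : M3).
Proof.
move=> dh; rewrite /SL3 /= -dh mPE// (det_mx2 h); case: ifP => _; rewrite det_mx3 !mxE /=; ring.
Qed.

Lemma mP_expmx i (Z : 'M[R]_2) : traceless_diag Z ->
  mx_curve_deriv (fun t => mP i (expmx (t *: Z))) (mp i Z).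
Proof.
move=> tZ; have dE t := expmx_det t tZ.
have c0 (a : R) : (fun t : R => t^-1 * (a - a)) @ (0 : R)^' --> (0 : R).
  by under eq_fun do rewrite subrr mulr0; exact: cvg_cst.
apply: mx_curve_deriv_entries => a b; under eq_fun do rewrite !mPE//.
rewrite /mp; case: ifP => _; move: a b; do 2 apply: ord3P; under eq_fun do rewrite !mxE /=;
  rewrite mxE /=; first [exact: c0|exact: expmx_entry_deriv].
Qed.

Section LeftDerivatives.
Variables (W : normedModType C) (f L : M3 -> W) (x : M3).
Hypothesis xS : SL3 x.
Hypothesis lL : real_linear L.
Hypothesis hL : forall (g : R -> M3) v, g 0 = x -> (forall t, SL3 (g t)) ->
  mx_curve_deriv g v -> curve_deriv (f \o g) (L v).

Lemma L_left (g : R -> M3) v w : g 0 = 1%:M -> (forall t, SL3 (g t)) -> mx_curve_deriv g v ->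
  curve_deriv (fun t => f (g t *m x)) w -> L (v *m x) = w.
Proof.
move=> g0 gS gv; apply: curve_deriv_unique.
have E : f \o (fun t => 1%:M *m g t *m x) = (fun t => f (g t *m x)).
  by apply/funext => t /=; rewrite mul1mx.
rewrite -E -[v]mul1mx; apply: hL (mx_curve_derivM 1%:M x gv).
  by rewrite g0 !mul1mx.
by move=> t; rewrite mul1mx; exact: SL3_mul.
Qed.

Lemma L_left_invariant (g : R -> M3) v : g 0 = 1%:M -> (forall t, SL3 (g t)) -> mx_curve_deriv g v ->
  (forall t, f (g t *m x) = f x) -> L (v *m x) = 0.
Proof.
move=> g0 gS gv gf; apply: (L_left g0 gS gv); under eq_fun do rewrite gf.
exact: curve_deriv_cst.
Qed.

End LeftDerivatives.
End LeftTranslation.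

(** * The series induced from the Borel subgroup *)

Section PrincipalSeriesAction.
Variables (R : realType) (mu : {measure set (borelM3 R) -> \bar R}).
Local Notation C := R[i].
Local Notation M3 := 'M[R]_3.
Variables (nu1 nu2 : C) (s1 s2 : bool).
Local Notation S := (section0 nu1 nu2 s1 s2).

Lemma section0_N0 f n x : S f -> N0 n -> SL3 x -> f (n *m x) = f x.
Proof.
move=> [_ ef] nN xS; have := ef n 1%:M 1%:M x nN.
have A1 : A0 (1%:M : M3).
  split; [exact: scalar_mx_is_diag|move=> i; by rewrite mxE eqxx ltr01|exact: det1].
have M1 : M0 (1%:M : M3).
  by exists false, false; apply: matrix3P; split; rewrite !mxE /= ?expr0 ?mulr1.
move=> /(_ A1 M1 xS); rewrite !mulmx1 => ->.
rewrite /chi0 /cpow /sigma0 !mxE /= !mulr1n ln1 !mulr0 cexp0 !expr1n !mulr1 -[RHS]mul1r.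
by congr (_ * _); rewrite mul1r.
Qed.

Lemma expR_diag_SL3 (a b c t : R) : a + b + c = 0 ->
  SL3 (diag3 (expR (t * a)) (expR (t * b)) (expR (t * c))).
Proof.
move=> abc; rewrite /SL3 /= det_mx3 !mxE /=.
transitivity (expR (t * a) * expR (t * b) * expR (t * c)); first by ring.
by rewrite -!expRD -!mulrDr abc mulr0 expR0.
Qed.

Lemma section0_torus f (a b c : R) t x : S f -> a + b + c = 0 -> SL3 x ->
  f (diag3 (expR (t * a)) (expR (t * b)) (expR (t * c)) *m x)
  = cexp (t%:C * ((nu1 + 2) * a%:C)) *: (cexp (t%:C * ((nu2 + 1) * b%:C)) *: f x).
Proof.
move=> [_ ef] abc xS; set d := diag3 _ _ _.
have dA : A0 d.
  split; [|by do 1 apply: ord3P; rewrite mxE /= expR_gt0|].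
    by apply/is_diag_mxP; do 2 apply: ord3P; rewrite mxE.
  exact: expR_diag_SL3.
have M1 : M0 (1%:M : M3).
  by exists false, false; apply: matrix3P; split; rewrite !mxE /= ?expr0 ?mulr1.
have N1 : N0 (1%:M : M3) by move=> i j ij; rewrite mxE.
have := ef 1%:M d 1%:M x N1 dA M1 xS; rewrite mul1mx mulmx1 => ->.
have -> : sigma0 s1 s2 (1%:M : M3) = 1 by rewrite /sigma0 !mxE !mulr1n !expr1n mulr1.
rewrite mulr1 /chi0 /cpow !mxE /= !expRK.
have -> : (nu1 + 2) * (t * a)%:C = t%:C * ((nu1 + 2) * a%:C) by rewrite rmorphM; ring.
have -> : (nu2 + 1) * (t * b)%:C = t%:C * ((nu2 + 1) * b%:C) by rewrite rmorphM; ring.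
by move: (cexp _) (cexp _) => u v; rewrite -mulrA.
Qed.

Section Torus.
Variables (f L : M3 -> C^o) (x : M3).
Hypothesis Sf : S f.
Hypothesis xS : SL3 x.
Hypothesis lL : real_linear L.
Hypothesis hL : forall (g : R -> M3) v, g 0 = x -> (forall t, SL3 (g t)) ->
  mx_curve_deriv g v -> curve_deriv (f \o g) (L v).

Lemma L_N0 : [/\ L (E3 R 0 1 *m x) = 0, L (E3 R 0 2 *m x) = 0 & L (E3 R 1 2 *m x) = 0].
Proof.
have N (t : R) := @unipotent_N0 R t.
split; apply: (L_left_invariant xS hL (@unipotent0 R _ _) _ (@mx_curve_deriv_unipotent R _ _)) => t;
  have [n1 n2 n3] := N t; try exact: N0_SL3; exact: section0_N0.
Qed.

Lemma L_torus a b c : a + b + c = 0 ->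
  L (diag3 a b c *m x) = ((nu1 + 2) * a%:C + (nu2 + 1) * b%:C) *: f x.
Proof.
move=> abc; pose g t := diag3 (expR (t * a)) (expR (t * b)) (expR (t * c)).
have hd (u : R) : is_derive (0 : R) (1 : R) (fun t => expR (t * u)) u.
  by apply: is_derive_eq; rewrite mul0r expR0 /GRing.scale /=; ring.
have h0 : is_derive (0 : R) (1 : R) (fun=> 0 : R) 0 by exact: is_derive_cst.
apply: (L_left xS hL (g := g)).
- by apply: matrix3P; split; rewrite /g !mxE /= ?mul0r ?expR0.
- by move=> t; exact: expR_diag_SL3.
- apply: mx_curve_deriv_entries => i j; apply: (@derive_quotient _ (fun t => g t i j)).
  by move: i j; do 2 apply: ord3P; under eq_fun do rewrite /g mxE /=; rewrite mxE /=.
- under eq_fun do rewrite (section0_torus _ Sf abc xS).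
  have h := curve_derivM (@curve_deriv_cexp R ((nu1 + 2) * a%:C))
    (curve_derivM (@curve_deriv_cexp R ((nu2 + 1) * b%:C)) (curve_deriv_cst (f x))).
  by rewrite !mul0r !cexp0 !scale1r addr0 -scalerDl in h.
Qed.

End Torus.

(** Compared only after multiplication by B: for excluded pairs [gamma0] is 0 by convention while
    [coupling] follows its formula, and B vanishes there. *)
Lemma gamma0_coupling (l p q r : nat) (m j : int) :
  gamma0 nu1 nu2 l m p j * Bcoef R l m q r
  = coupling l p (nu2 + 1 - l%:R + p%:R) (nu2 + 1 + l%:R - p%:R)
      (- 3^-1 * (2 * (nu1 + 2) - (nu2 + 1))) 1 m j * Bcoef R l m q r.
Proof.
rewrite /gamma0 /coupling; case: ifP => [ex|_]; first by rewrite /Bcoef ex !mulr0.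
case: ifP => _; first by rewrite -!pmulrn.
case: ifP => _; last by rewrite -!pmulrn.
by congr (_ * _ * _); rewrite intrM; field.
Qed.

Variables (H : completeNormedModType C).
Variables (iota : (M3 -> C^o) -> H) (pi : M3 -> H -> H) (s : nat -> nat -> nat -> H).
Hypothesis mu_haar : haar_SO3 mu.
Hypothesis rr : right_regular mu S iota pi.
Hypothesis hs : forall l p q : nat, Zset s1 s2 l p -> (q <= l.*2)%N ->
  exists2 f, S f /\ restr0 s1 s2 l p q f & s l p q = iota f.

Lemma principal_series_action l p q r : Zset s1 s2 (l : nat) (p : nat) -> (q <= l.*2)%N -> (r <= 4)%N ->
  differential pi (Xp R r) (s l p q)
    (\sum_(j <- [:: -1; 0; 1] : seq int) \sum_(m <- [:: -2; -1; 0; 1; 2] : seq int)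
      (gamma0 nu1 nu2 l m p j * Bcoef R l m q r) *:
        ext0 s1 s2 s (l%:Z + m) (p%:Z + m + 2 * j) (q%:Z + m + r%:Z - 2)).
Proof.
move=> Zp ql r4; have [f [Sf rf] ->] := hs Zp ql.
have pl : (p <= l)%N by move: Zp; rewrite /Zset; lia.
have pl2 : (p <= 2 * l)%N by lia.
have ql2 : (q <= 2 * l)%N by lia.
have a1l : 0 <= 2 * l%:Z - p%:Z <= 2 * l%:Z by lia.
have a2l : 0 <= p%:Z <= 2 * l%:Z by lia.
have S0 := section0_0 Sf.
have cS : SO3 (1%:M : M3) by split; rewrite ?trmx1 ?mulmx1 ?det1.
pose e : C^o := (-1) ^+ eps0 s1 s2 l.
under eq_bigr do under eq_bigr do rewrite gamma0_coupling.
pose ext r m j := ext0 s1 s2 s (l%:Z + m) (p%:Z + m + 2 * j) (q%:Z + m + r%:Z - 2).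
have hf x : SO3 x -> f x = kcoef (2 * l%:Z) (2 * l%:Z - p%:Z) q (1%:M^T *m x) *: (1 : C^o)
    + kcoef (2 * l%:Z) p%:Z q (1%:M^T *m x) *: e.
  move=> xS; rewrite (restr0_kcoef rf)//; last by lia.
  by rewrite trmx1 mul1mx -![_ *: _]/(_ * _) mulr1 [e * _]mulrC.
apply: (differential_coupled mu_haar rr _ _ _ S0 cS pl2 ql2 (vp := fun=> 1 : C^o) (vm := fun=> e)
  (e := ext)) => //.
- by move=> g [].
- by move=> a g h; exact: section0_lin.
- by move=> g x; exact: section0_mulmxr.
- move=> y L yS lL hL.
  have xS : SL3 (1%:M *m y) by rewrite mul1mx; exact: SO3_SL3.
  have dE (Z : M3) : Z *m (1%:M *m y) = 1%:M *m Z *m y by rewrite !mul1mx.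
  have := L_N0 Sf xS hL; rewrite !dE => -[n1 n2 n3].
  have tor a b c := @L_torus f L _ Sf xS hL a b c.
  have [D1 D3] := D_raise_upper ql2 cS yS a1l a2l hf lL hL n1 n2.
  (* The character reads only the first two diagonal entries, so diag(0, 1, -1) contributes nu_(0,2)
     + rho_(0,2) alone. *)
  have hg : L (1%:M *m diag3 0 1 (-1) *m y) = (nu2 + 1) *: f (1%:M *m y).
    by rewrite -dE tor ?add0r ?subrr// mulr0 mulr1 add0r.
  have [D0 D4] := D_torus ql2 cS yS a1l a2l hf lL hL hg n3.
  split.
  - rewrite D0; congr (_ *: _ + _ *: _); congr (_ * _); rewrite ?intrD ?mulrNz -?pmulrn; ring.
  - rewrite D4; congr (_ *: _ + _ *: _); congr (_ * _); rewrite ?intrD ?mulrNz -?pmulrn; ring.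
  - have [_ _ -> _ _] := Xp_decomposition R.
    have Z23 : cmx (sym23 0 : M3) = 0 by apply: matrix3P; split; rewrite !mxE.
    rewrite Z23 scaler0 addr0 DL_cmx// -dE tor; last by field.
    rewrite hf; last by rewrite mul1mx.
    have -> : 1%:M^T *m (1%:M *m y) = y by rewrite trmx1 !mul1mx.
    by congr (_ *: _); rewrite rmorphN rmorphM !fmorphV !rmorph_nat; field.
  - by rewrite scale1r.
  - by rewrite scale1r.
- move=> r' m j r'4 mm jj cn.
  have [l' [p' [q' [lE pE qE pl' ql']]]] := coupled_range pl2 ql2 r'4 mm jj cn.
  exact: (ext0_realizes rr hs S0 Zp lE pE qE pl' ql').
Qed.

End PrincipalSeriesAction.

(** * The series induced from the maximal parabolic subgroups *)

Section DiscreteSeriesAction.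
Variables (R : realType) (mu : {measure set (borelM3 R) -> \bar R}).
Local Notation C := R[i].
Local Notation M3 := 'M[R]_3.
Variables (i : nat) (nu : C) (k : nat) (W : completeNormedModType C) (ip : W -> W -> C).
Variables (D : 'M[R]_2 -> W -> W) (chi : int -> W).
Hypothesis i12 : i = 1%N \/ i = 2%N.
Hypothesis ds : discrete_series k ip D chi.
Local Notation S := (sectionP i nu D).
Local Notation c := (Levi_rotation R i).

Lemma NP_1 : NP i (1%:M : M3).
Proof.
by case: i12 => ->; exists 0; rewrite -scalar_mx_block.
Qed.

Lemma SLpm2_1 (h : 'M[R]_2) : \det h = 1 -> SLpm2 h. Proof. by left. Qed.

Lemma sectionP_NP f n x : S f -> NP i n -> SL3 x -> f (n *m x) = f x.
Proof.
move=> [_ ef] nN xS; have := ef n 0 1%:M x nN (SLpm2_1 (det1 _ _)) xS.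
by rewrite expmx0 mP_1 !mulmx1 mul0r cexp0 scale1r (D_one ds).
Qed.

Lemma sectionP_mP f h x : S f -> \det h = 1 -> SL3 x -> f (mP i h *m x) = D h (f x).
Proof.
move=> [_ ef] dh xS; have := ef 1%:M 0 h x NP_1 (SLpm2_1 dh) xS.
by rewrite expmx0 !mul1mx mul0r cexp0 scale1r.
Qed.

Lemma sectionP_HP f t x : S f -> SL3 x -> f (expmx (t *: HP R i) *m x) = cexp (t%:C * (nu + 3)) *: f x.
Proof.
move=> [_ ef] xS; have := ef 1%:M t 1%:M x NP_1 (SLpm2_1 (det1 _ _)) xS.
by rewrite mul1mx mP_1 mulmx1 (D_one ds).
Qed.

Section Derivatives.
Variables (f L : M3 -> W) (x : M3).
Hypothesis Sf : S f.
Hypothesis xS : SL3 x.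
Hypothesis lL : real_linear L.
Hypothesis hL : forall (g : R -> M3) v, g 0 = x -> (forall t, SL3 (g t)) ->
  mx_curve_deriv g v -> curve_deriv (f \o g) (L v).

Lemma unipotent_SL3 (a b : 'I_3) (t : R) : (a < b)%N -> SL3 (unipotent a b t).
Proof.
have [n1 n2 n3] := unipotent_N0 t.
by move: a b; do 2 apply: ord3P => //; move=> _; exact: N0_SL3.
Qed.

Lemma L_NP (a b : 'I_3) : (a < b)%N -> (forall t : R, NP i (unipotent a b t)) -> L (E3 R a b *m x) = 0.
Proof.
move=> ab N; apply: (L_left_invariant xS hL (@unipotent0 R _ _) _ (@mx_curve_deriv_unipotent R _ _)) => t.
  exact: unipotent_SL3.
exact: sectionP_NP.
Qed.

Lemma L_mP (Z : 'M[R]_2) w : traceless_diag Z ->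
  curve_deriv (fun t => D (expmx (t *: Z)) (f x)) w -> L (mp i Z *m x) = w.
Proof.
move=> tZ hw; have dZ (t : R) := expmx_det t tZ.
apply: (L_left xS hL (g := fun t => mP i (expmx (t *: Z)))) => [|t||].
- by rewrite expmx0 mP_1.
- exact: mP_SL3.
- exact: mP_expmx.
- by under eq_fun do rewrite (sectionP_mP Sf (dZ _) xS).
Qed.

Lemma HP_traceless : traceless_diag (HP R i).
Proof. by case: i12 => ->; apply: diag3_traceless; ring. Qed.

Lemma L_HP : L (HP R i *m x) = (nu + 3) *: f x.
Proof.
have [eS eH] := traceless_expmx HP_traceless.
apply: (L_left xS hL _ eS eH); first exact: expmx0.
under eq_fun do rewrite (sectionP_HP _ Sf xS).
have h := curve_derivM (@curve_deriv_cexp R (nu + 3)) (curve_deriv_cst (f x)).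
by rewrite scaler0 addr0 in h.
Qed.

End Derivatives.

Definition xRe : 'M[R]_2 := rows 2 [:: [:: 1; 0]; [:: 0; -1]].
Definition xIm (e : R) : 'M[R]_2 := rows 2 [:: [:: 0; e]; [:: e; 0]].

Lemma xpm_parts (e : R) : map_mx (@complex.Re R) (xpm e%:C) = xRe
  /\ map_mx (@complex.Im R) (xpm e%:C) = xIm e.
Proof. by split; apply: matrix2P; rewrite !mxE /=; simpc. Qed.

Lemma traceless_xpm (e : R) : traceless_diag xRe /\ traceless_diag (xIm e).
Proof.
have s2 (V : nmodType) (F : 'I_2 -> V) := sum2E F.
split.
  exists 1%:M, 1%:M, (\row_j [:: 1; -1]`_j); split; rewrite ?mulmx1 ?s2 ?mxE ?subrr//.
  by rewrite mul1mx; apply: matrix2P; rewrite !mxE.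
exists (rows 2 [:: [:: 1; 1]; [:: 1; -1]]), (rows 2 [:: [:: 1 / 2; 1 / 2]; [:: 1 / 2; - (1 / 2)]]),
   (\row_j [:: e; - e]`_j); split; rewrite ?s2 ?mxE ?subrr//.
  by apply: matrix2P; rewrite !mxE s2 !mxE /= ?mulr1n ?mulr0n; by field.
by apply: matrix2P; rewrite !mxE s2 !mul_mx_diag !mxE /=; field.
Qed.

(** The action of x_pm is prescribed on weight vectors, while the value of a section on SO(3)
    combines two of them. *)
Lemma D_derivative_lin (X : 'M[C]_2) v1 v2 w1 w2 (a1 a2 : C) :
    traceless_diag (map_mx (@complex.Re R) X) -> traceless_diag (map_mx (@complex.Im R) X) ->
    differential D X v1 w1 -> differential D X v2 w2 ->
  differential D X (a1 *: v1 + a2 *: v2) (a1 *: w1 + a2 *: w2).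
Proof.
move=> tR tI [x1 [y1 [hx1 hy1 ->]]] [x2 [y2 [hx2 hy2 ->]]].
have lin (Z : 'M[R]_2) u1 u2 : traceless_diag Z ->
    curve_deriv (fun t => D (expmx (t *: Z)) v1) u1 -> curve_deriv (fun t => D (expmx (t *: Z)) v2) u2 ->
    curve_deriv (fun t => D (expmx (t *: Z)) (a1 *: v1 + a2 *: v2)) (a1 *: u1 + a2 *: u2).
  move=> tZ h1 h2; have hS t := SLpm2_1 (expmx_det t tZ).
  have E (h : 'M[R]_2) v : SLpm2 h -> forall a, D h (a *: v) = a *: D h v.
    move=> hh a; have D0 : D h 0 = 0.
      by have := D_linear ds hh (-1) 0 0; rewrite scaler0 addr0 scaleN1r addNr.
    by have := D_linear ds hh a v 0; rewrite addr0 D0 addr0.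
  under eq_fun do rewrite (D_linear ds (hS _)) (E _ _ (hS _)).
  exact: (curve_deriv_lin h1 (curve_derivZ h2)).
exists (a1 *: x1 + a2 *: x2), (a1 *: y1 + a2 *: y2); split; [exact: lin|exact: lin|].
by rewrite !scalerDr !scalerA [_ * a1]mulrC [_ * a2]mulrC addrACA.
Qed.

(** The source of the signs (-1)^(i+1): conjugation by [u_c] carries the lower right block to the
    upper left one and negates both matrices. *)
Lemma Levi_conj (e : R) :
  c *m diag3 0 1 (-1) = (-1) ^+ i.+1 *: (mp i xRe *m c) /\
  c *m sym23 e = (-1) ^+ i.+1 *: (mp i (xIm e) *m c).
Proof.
have signs : (-1) ^+ 2 = 1 :> R /\ (-1) ^+ 3 = -1 :> R by split; ring.
case: i12 => ->; rewrite (signs.1, signs.2) /Levi_rotation /mp /=; split;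
  apply: matrix3P; split; rewrite !mxE !sum3E !mxE /= ?mulr1n ?mulr0n; ring.
Qed.

Lemma Levi_conj_HP : c *m diag3 (- (2 / 3)) 3^-1 3^-1 = ((-1) ^+ i / 3) *: (HP R i *m c).
Proof.
have signs : (-1) ^+ 1 = -1 :> R /\ (-1) ^+ 2 = 1 :> R by split; ring.
case: i12 => ->; rewrite (signs.1, signs.2) /Levi_rotation /HP /=;
  apply: matrix3P; split; rewrite !mxE !sum3E !mxE /= ?mulr1n ?mulr0n; by field.
Qed.

Lemma u_c_unipotent : u_c R *m E3 R 1 0 = E3 R 1 2 *m u_c R
  /\ u_c R *m E3 R 2 0 = - E3 R 0 2 *m u_c R.
Proof.
by split; apply: matrix3P; split; rewrite !mxE !sum3E !mxE /= ?mulr1n ?mulr0n; ring.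
Qed.

End DiscreteSeriesAction.

Section DiscreteSeriesCells.
Variables (R : realType) (mu : {measure set (borelM3 R) -> \bar R}).
Local Notation C := R[i].
Local Notation M3 := 'M[R]_3.
Variables (i : nat) (nu : C) (k : nat) (W : completeNormedModType C) (ip : W -> W -> C).
Variables (D : 'M[R]_2 -> W -> W) (chi : int -> W).
Hypothesis i12 : i = 1%N \/ i = 2%N.
Hypothesis ds : discrete_series k ip D chi.
Local Notation S := (sectionP i nu D).
Local Notation c := (Levi_rotation R i).

(** After conjugation by [c] the matrix lies in the complexified Lie algebra of M_i, so the left law
    turns its derivative into D_k applied to the value of the section. The cases e = -1 and e = 1
    are X_0 and X_4. *)
Lemma DL_xpm (f L : M3 -> W) (y : M3) (e : R) w : S f -> SL3 (c *m y) -> real_linear L ->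
    (forall (g : R -> M3) v, g 0 = c *m y -> (forall t, SL3 (g t)) ->
      mx_curve_deriv g v -> curve_deriv (f \o g) (L v)) ->
    differential D (xpm e%:C) (f (c *m y)) w ->
  DL c y L (cmx (diag3 0 1 (-1)) + 'i%C *: cmx (sym23 e)) = (-1) ^+ i.+1 *: w.
Proof.
move=> Sf xS lL hL [w1 [w2 [h1 h2 ->]]].
have [tR tI] := traceless_xpm e; have [E1 E2] := xpm_parts e; rewrite E1 in h1; rewrite E2 in h2.
have [c1 c2] := Levi_conj i12 e.
rewrite DLD// DLZ// !DL_cmx// c1 c2 -!scalemxAl -!(mulmxA _ c y) !(real_linearZ lL).
rewrite (L_mP i12 Sf xS hL tR h1) (L_mP i12 Sf xS hL tI h2).
by rewrite rmorph_sign scalerDr !scalerA mulrC.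
Qed.

Lemma ZP_weight (l p : nat) : ZP k l p -> Dk_weight k (l%:Z - p%:Z) /\ Dk_weight k (p%:Z - l%:Z).
Proof.
rewrite /ZP => Zp; have [a aE] : exists a : nat, (l = p + k + a.*2)%N.
  by exists ((l - p - k) %/ 2)%N; lia.
by split; exists a; [left|right]; lia.
Qed.

Lemma gammaP_coupling (l p : nat) (m j : int) :
  gammaP i k nu l m p j = coupling l p ((-1) ^+ i.+1 * (k%:R - l%:R + p%:R))
    ((-1) ^+ i.+1 * (k%:R + l%:R - p%:R)) ((-1) ^+ i / 3 * (nu + 3)) ((-1) ^+ i.+1) m j :> C.
Proof.
rewrite /gammaP /coupling; case: ifP => _; first by rewrite -!pmulrn.
case: ifP => _; last by rewrite -!pmulrn.
by congr (_ * _); rewrite intrM exprS; field.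
Qed.

Variables (H : completeNormedModType C).
Variables (iota : (M3 -> W) -> H) (pi : M3 -> H -> H) (t : nat -> nat -> nat -> H).
Hypothesis mu_haar : haar_SO3 mu.
Hypothesis rr : right_regular mu S iota pi.
Hypothesis ht : forall l p q : nat, ZP k l p -> (q <= l.*2)%N ->
  exists2 f, S f /\ restrP i chi l p q f & t l p q = iota f.

Lemma discrete_series_action (l p q r : nat) : ZP k l p -> (q <= l.*2)%N -> (r <= 4)%N ->
  differential pi (Xp R r) (t l p q)
    (\sum_(j <- [:: -1; 0; 1] : seq int) \sum_(m <- [:: -2; -1; 0; 1; 2] : seq int)
      (gammaP i k nu l m p j * Bcoef R l m q r) *:
        extP k t (l%:Z + m) (p%:Z + m + 2 * j) (q%:Z + m + r%:Z - 2)).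
Proof.
move=> Zp ql r4; have [f [Sf rf] ->] := ht Zp ql.
have pl : (p + k <= l)%N by move: Zp; rewrite /ZP; lia.
have pl2 : (p <= 2 * l)%N by lia.
have ql2 : (q <= 2 * l)%N by lia.
have a1l : 0 <= 2 * l%:Z - p%:Z <= 2 * l%:Z by lia.
have a2l : 0 <= p%:Z <= 2 * l%:Z by lia.
have S0 := sectionP_0 ds Sf.
have cS := Levi_rotation_SO3 R i.
have [wt1 wt2] := ZP_weight Zp.
pose sg := chi_sign R i l p.
pose vp (j : int) := chi (l%:Z - p%:Z - 2 * j).
pose vm (j : int) := sg *: chi (p%:Z - l%:Z + 2 * j).
under eq_bigr do under eq_bigr do rewrite gammaP_coupling.
pose ext r m j := extP k t (l%:Z + m) (p%:Z + m + 2 * j) (q%:Z + m + r%:Z - 2).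
have hf x : SO3 x -> f x = kcoef (2 * l%:Z) (2 * l%:Z - p%:Z) q (c^T *m x) *: vp 0
    + kcoef (2 * l%:Z) p%:Z q (c^T *m x) *: vm 0.
  move=> xS; rewrite (restrP_kcoef i12 rf)//; last by lia.
  by rewrite /vp /vm mulr0 subr0 addr0.
have D13 y L : SO3 y -> real_linear L ->
    (forall g w, g 0 = c *m y -> (forall t, SL3 (g t)) -> mx_curve_deriv g w -> curve_deriv (f \o g) (L w)) ->
    DL c y L (Xp R 1) = (-1) ^+ i.+1 *: (raise l q y (2 * l%:Z - p%:Z) *: vp 0 + raise l q y p%:Z *: vm 0) /\
    DL c y L (Xp R 3) = (-1) ^+ i.+1 *: (lower l q y (2 * l%:Z - p%:Z) *: vp 0 + lower l q y p%:Z *: vm 0).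
  move=> yS lL hL; have xS : SL3 (c *m y) by apply: SO3_SL3; exact: SO3_mul.
  have up := D_raise_upper ql2 cS yS a1l a2l hf lL hL.
  have low := D_raise_lower ql2 cS yS a1l a2l hf lL hL.
  have N := L_NP ds Sf xS hL.
  have U (t : R) := unipotent_NP t.
  case: i12 => iE.
    have cE : c = 1%:M by rewrite /Levi_rotation iE.
    have -> : (-1) ^+ i.+1 = 1 :> C by rewrite iE; ring.
    have dE (Z : M3) : c *m Z *m y = Z *m (c *m y) by rewrite cE !mul1mx.
    rewrite !scale1r; apply: up; rewrite dE; apply: N => // u; rewrite iE; by case: (U u).
  have cE : c = u_c R by rewrite /Levi_rotation iE.
  have [u1 u2] := u_c_unipotent R.
  have -> : (-1) ^+ i.+1 = -1 :> C by rewrite iE; ring.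
  have dE (Z Z' : M3) : u_c R *m Z = Z' *m u_c R -> c *m Z *m y = Z' *m (c *m y).
    by rewrite cE => ->; rewrite mulmxA.
  rewrite !scaleN1r; apply: low.
    by rewrite (dE _ _ u1); apply: N => // u; rewrite iE; case: (U u).
  rewrite (dE _ _ u2) mulNmx -scaleN1r (real_linearZ lL) N ?scaler0// => u.
  by rewrite iE; case: (U u).
apply: (differential_coupled mu_haar rr _ _ _ S0 cS pl2 ql2 (vp := vp) (vm := vm) (e := ext)) => //.
- by move=> g [].
- by move=> a g h; exact: (sectionP_lin ds).
- by move=> g x; exact: sectionP_mulmxr.
- move=> y L yS lL hL.
  have xS : SL3 (c *m y) by apply: SO3_SL3; exact: SO3_mul.
  have fE : f (c *m y) = kcoef (2 * l%:Z) (2 * l%:Z - p%:Z) q y *: vp 0 + kcoef (2 * l%:Z) p%:Z q y *: vm 0.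
    rewrite hf; last exact: SO3_mul.
    by rewrite mulmxA (SO3_trVmul cS) mul1mx.
  have fE' : f (c *m y) = kcoef (2 * l%:Z) (2 * l%:Z - p%:Z) q y *: chi (l%:Z - p%:Z)
     + (kcoef (2 * l%:Z) p%:Z q y * sg) *: chi (p%:Z - l%:Z).
    by rewrite fE /vp /vm scalerA mulr0 subr0 addr0.
  have [_ _ X2 _ _] := Xp_decomposition R.
  have [X0 _ _ _ X4] := Xp_decomposition R.
  have [E1 E2] := xpm_parts (1 : R); have [E1' E2'] := xpm_parts (-1 : R).
  have [tR tI] := traceless_xpm (1 : R); have [_ tI'] := traceless_xpm (-1 : R).
  have N1 : (-1 : R)%:C = -1 by rewrite rmorphN.
  have d4 : differential D (xpm (1 : R)%:C) (f (c *m y))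
      (kcoef (2 * l%:Z) (2 * l%:Z - p%:Z) q y *: ((k%:R + (l%:Z - p%:Z)%:~R) *: chi (l%:Z - p%:Z + 2))
      + (kcoef (2 * l%:Z) p%:Z q y * sg) *: ((k%:R + (p%:Z - l%:Z)%:~R) *: chi (p%:Z - l%:Z + 2))).
    by rewrite fE'; apply: (D_derivative_lin ds); rewrite ?E1 ?E2//; exact: (D_xplus ds).
  have d0 : differential D (xpm (-1 : R)%:C) (f (c *m y))
      (kcoef (2 * l%:Z) (2 * l%:Z - p%:Z) q y *: ((k%:R - (l%:Z - p%:Z)%:~R) *: chi (l%:Z - p%:Z - 2))
      + (kcoef (2 * l%:Z) p%:Z q y * sg) *: ((k%:R - (p%:Z - l%:Z)%:~R) *: chi (p%:Z - l%:Z - 2))).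
    by rewrite fE'; apply: (D_derivative_lin ds); rewrite ?E1' ?E2'// N1; exact: (D_xminus ds).
  split.
  - rewrite X0 (DL_xpm Sf xS lL hL d0) /vp /vm !scalerDr !scalerA mulr1.
    rewrite (_ : p%:Z - l%:Z + 2 * -1 = p%:Z - l%:Z - 2); last by lia.
    by congr (_ *: _ + _ *: _); rewrite intrB -!pmulrn; ring.
  - rewrite X4 (DL_xpm Sf xS lL hL d4) /vp /vm !scalerDr !scalerA mulr1.
    rewrite (_ : l%:Z - p%:Z - 2 * -1 = l%:Z - p%:Z + 2); last by lia.
    by congr (_ *: _ + _ *: _); rewrite intrB -!pmulrn; ring.
  - have Z23 : cmx (sym23 0 : M3) = 0 by apply: matrix3P; split; rewrite !mxE.
    rewrite X2 Z23 scaler0 addr0 DL_cmx// (Levi_conj_HP R i12) -scalemxAl -(mulmxA _ c y) (real_linearZ lL).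
    rewrite (L_HP i12 ds Sf xS hL) scalerA fE; congr (_ *: _ ).
    by rewrite rmorphM rmorph_sign fmorphV rmorph_nat.
  - exact: (D13 y L yS lL hL).1.
  - exact: (D13 y L yS lL hL).2.
- move=> r' m j r'4 mm jj cn.
  have [l' [p' [q' [lE pE qE pl' ql']]]] := coupled_range pl2 ql2 r'4 mm jj cn.
  have Zp' : ZP k l' p'.
    (* At p = l - k the weights are the extreme ones k and -k, and the factor k - l + p vanishes. By
       parity this is the only way in which the new p could exceed its bound. *)
    have pk : ~~ ((j == 1) && (p + k == l)%N).
      apply: contra cn => /andP[/eqP -> /eqP <-].
      by rewrite /coupling /= natrD (_ : k%:R - (p%:R + k%:R) + p%:R = 0) ?mulr0 ?mul0r//; ring.
    move: Zp mm jj pk; rewrite /ZP !inE; lia.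
  exact: (extP_realizes i12 ht Zp Zp' lE pE qE pl' ql').
Qed.

End DiscreteSeriesCells.

Theorem proposition7p2 (R : realType)
    (mu : {measure set (borelM3 R) -> \bar R}) (mu_haar : haar_SO3 mu) :
  (forall (nu1 nu2 : R[i]) (s1 s2 : bool)
      (H : completeNormedModType R[i])
      (iota : ('M[R]_3 -> R[i]^o) -> H) (pi : 'M[R]_3 -> H -> H)
      (s : nat -> nat -> nat -> H),
    right_regular mu (section0 nu1 nu2 s1 s2) iota pi ->
    (forall l p q : nat, Zset s1 s2 l p -> (q <= l.*2)%N ->
       exists2 f, section0 nu1 nu2 s1 s2 f /\ restr0 s1 s2 l p q f
                & s l p q = iota f) ->
    forall l p q r : nat, Zset s1 s2 l p -> (q <= l.*2)%N -> (r <= 4)%N ->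
      differential pi (Xp R r) (s l p q)
        (\sum_(j <- [:: -1; 0; 1] : seq int)
          \sum_(m <- [:: -2; -1; 0; 1; 2] : seq int)
            (gamma0 nu1 nu2 l m p j * Bcoef R l m q r) *:
              ext0 s1 s2 s (l%:Z + m) (p%:Z + m + 2 * j)
                (q%:Z + m + r%:Z - 2)))
  /\
  (forall (i : nat) (nu : R[i]) (k : nat)
      (W : completeNormedModType R[i]) (ip : W -> W -> R[i])
      (D : 'M[R]_2 -> W -> W) (chi : int -> W)
      (H : completeNormedModType R[i])
      (iota : ('M[R]_3 -> W) -> H) (pi : 'M[R]_3 -> H -> H)
      (t : nat -> nat -> nat -> H),
    i = 1%N \/ i = 2%N -> (2 <= k)%N ->
    discrete_series k ip D chi ->
    right_regular mu (sectionP i nu D) iota pi ->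
    (forall l p q : nat, ZP k l p -> (q <= l.*2)%N ->
       exists2 f, sectionP i nu D f /\ restrP i chi l p q f
                & t l p q = iota f) ->
    forall l p q r : nat, ZP k l p -> (q <= l.*2)%N -> (r <= 4)%N ->
      differential pi (Xp R r) (t l p q)
        (\sum_(j <- [:: -1; 0; 1] : seq int)
          \sum_(m <- [:: -2; -1; 0; 1; 2] : seq int)
            (gammaP i k nu l m p j * Bcoef R l m q r) *:
              extP k t (l%:Z + m) (p%:Z + m + 2 * j)
                (q%:Z + m + r%:Z - 2))).
Proof.
split.
  move=> nu1 nu2 s1 s2 H iota pi s rr hs l p q r.
  exact: (principal_series_action mu_haar rr hs).
move=> i nu k W ip D chi H iota pi t i12 k2 ds rr ht l p q r.
exact: (discrete_series_action i12 ds mu_haar rr ht).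
Qed.
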